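(* Let $K=\{0,1\}$, let $L$ be a singleton, and let $X$ have generator $R=\begin{pmatrix}-a & a\\ b & -b\end{pmatrix}$ with $a,b>0$. Assume that $0<h(p)<f(p)$ for all $p\in[0,1]$, that $h(0)<h(1)$ and $f(0)<f(1)$, and that $\frac b{b+r}h(1)>f(0)$. Let $p_0$ be the unique solution in $(0,\frac b{a+b})$ of $\frac{h(1)-f(p_0)}{1-p_0}=\frac{-rf(p_0)}{(a+b)p_0-b}$, and let $$\lambda_1:=\frac{b-(a+b)p_0}{p_0(1-p_0)}>0.$$ Then an optimal strategy $\mu:\Omega\times[0,1]\to[0,+\infty]$ for player 1 in the stopping game with $\mathbb P(X_0=0)=p$ is given by the following expressions. (i) For $p=p_0$: $$\mu(\omega,u)=\inf\Big\{t\ge0\ :\ \int_0^t\mathbf 1_{X_s=0}\,ds\ge\frac{-\ln(1-u)}{\lambda_1}\Big\}.$$ (ii) For $p>p_0$: $$\mu(\omega,u)=\begin{cases}0&\text{if }X_0=0\text{ and }u\in[0,c(p)),\\ \inf\Big\{t\ge0\ :\ \int_0^t\mathbf 1_{X_s=0}\,ds\ge\frac{-\ln(1-\tilde u)}{\lambda_1}\Big\}&\text{otherwise,}\end{cases}$$ where $c(p)=\frac{p-p_0}{p(1-p_0)}$ and $\tilde u=\frac{u-c(p)}{1-c(p)}\mathbf 1_{X_0=0}+u\,\mathbf 1_{X_0=1}$ (with the convention $\frac00=0$). (iii) For $p<p_0$: $$\mu(\omega,u)=\inf\Big\{t\ge t(p)\ :\ \int_{t(p)}^t\mathbf 1_{X_s=0}\,ds\ge\frac{-\ln(1-u)}{\lambda_1}\Big\},$$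 where $t(p)=\inf\{t\ge0:\mathbb P_p(X_t=0)=p_0\}$.
   Context: **The game.** $X$ is a continuous-time Markov chain on $K=\{0,1\}$ (rows and columns of the generator $R$ ordered as $0,1$) with $\mathbb P(X_0=0)=p\in[0,1]$, realized as the canonical process on $\Omega=\mathbb D([0,\infty),K)$; its law is $\mathbb P_p$, with expectation $\mathbb E_p$, and $\mathcal F^X$ is its filtration. Player 1 (maximizer) observes $X$; player 2 (minimizer) observes nothing. Player 1 chooses a mixed stopping time $\mu\in\mathcal T^X_m$: an $\mathcal F^X_\infty\otimes\mathcal B([0,1])$-measurable map $\mu(\omega,u)$ on $\Omega\times[0,1]$ such that $\mu(\cdot,u)$ is an ($[0,+\infty]$-valued) $\mathcal F^X$-stopping time for every $u\in[0,1]$. Player 2 chooses a random time $\nu\in\mathcal T^\emptyset_m$: a Borel map $\nu:[0,1]\to[0,+\infty]$. $r>0$ is a fixed discount rate, $f\ge h$ are real functions on $K$. The payoff is $$\Gamma_p(\mu,\nu)=\mathbb E_p\Big[\int_0^1\int_0^1\big(e^{-r\nu(v)}f(X_{\nu(v)})\mathbf 1_{\nu(v)<\mu(\omega,u)}+e^{-r\mu(\omega,u)}h(X_{\mu(\omega,u)})\mathbf 1_{\mu(\omega,u)\le\nu(v)}\big)du\,dv\Big],$$ with integrand $0$ where $\mu=\nu=+\infty$. The game has a value $V(p)=\inf_\nu\sup_\mu\Gamma_p(\mu,\nu)=\sup_\mu\inf_\nu\Gamma_p(\mu,\nu)$, and $\mu$ is optimal for player 1 if $\inf_\nu\Gamma_p(\mu,\nu)=V(p)$.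 **Notation.** $f,h$ are extended linearly to $\Delta(K)$ and written as functions of $p\in[0,1]$, where $p$ is the probability of state $0$: so $f(p)$ means $p\cdot f(\text{state }0)+(1-p)\cdot f(\text{state }1)$, and similarly $h(p)$. In particular $h(1)$ is the payoff in state $0$ and $f(0)$ the payoff in state $1$. Conventions: $\inf\emptyset=+\infty$, $-\ln 0=+\infty$. *)

(* Defs.v *)
From HB Require Import structures.
From mathcomp Require Import all_boot all_order all_algebra.
From mathcomp Require Import all_classical all_reals all_analysis.
From mathcomp Require Import measurable_realfun.
Set Implicit Arguments.
Unset Strict Implicit.
Unset Printing Implicit Defensive.
Import Order.TTheory GRing.Theory Num.Theory.
Import numFieldNormedType.Exports.
Local Open Scope classical_set_scope.
Local Open Scope ring_scope.

(** The state space K = {0,1} is ['I_2], with elements [0] and [1]. *)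

(** * Canonical path space D([0,oo), K)

    A path is stored as a function on the whole line that is constant on
    the negative half-line, so that there is exactly one such function for
    each element of D([0,oo), K). Since K is discrete, a one-sided limit
    exists iff the path is constant on a one-sided punctured neighborhood. *)
Definition cadlag (R : realType) (w : R -> 'I_2) : Prop :=
  [/\ forall t, 0 <= t -> \forall s \near t^'+, w s = w t,
      forall t, 0 < t -> exists k, \forall s \near t^'-, w s = k &
      forall t, t < 0 -> w t = w 0].

Definition cadlag_path (R : realType) : Type := {w : R -> 'I_2 | cadlag w}.

Definition X (R : realType) (t : R) (w : cadlag_path R) : 'I_2 := sval w t.

Lemma cadlag_cst (R : realType) : cadlag (fun _ : R => 0 : 'I_2).
Proof.
by split=> // t _; [exact: nearW | exists 0; exact: nearW].
Qed.

HB.instance Definition _ (R : realType) := gen_eqMixin (cadlag_path R).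
HB.instance Definition _ (R : realType) := gen_choiceMixin (cadlag_path R).
HB.instance Definition _ (R : realType) :=
  isPointed.Build (cadlag_path R) (exist _ _ (@cadlag_cst R)).

(** The filtration of X: F_t is generated by the X_s, s in [0,t]. *)
Definition filtX (R : realType) (t : R) : set (set (cadlag_path R)) :=
  <<s [set A | exists s k, [/\ 0 <= s, s <= t & A = [set w | X s w = k]]] >>.

(** [Omega R] is the path space with F_oo, generated by all X_s, s >= 0. *)
Definition cylinders (R : realType) : set (set (cadlag_path R)) :=
  [set A | exists s k, 0 <= s /\ A = [set w | X s w = k]].

Notation Omega R := (g_sigma_algebraType (@cylinders R)).

(** * Markov chains on K *)

Definition generator (R : realType) (a b : R) : 'M[R]_2 :=
  \matrix_(i, j) if i == 0 then (if j == 0 then - a else a)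
                 else (if j == 0 then b else - b).

(** Matrix exponential, by its power series (entrywise limit). *)
Definition expmx (R : realType) (A : 'M[R]_2) : 'M[R]_2 :=
  \matrix_(i, j) limn (series (fun n => (A ^+ n) i j / n`!%:R)).

(** [P] is the law of the Markov chain with generator [Q] and initial
    distribution P(X_0 = 0) = p, P(X_0 = 1) = 1 - p: its finite-dimensional
    distributions are given by the transition semigroup t |-> exp (t Q). *)
Definition is_chain_law (R : realType) (Q : 'M[R]_2) (p : R)
    (P : probability (Omega R) R) : Prop :=
  forall (n : nat) (t : nat -> R) (x : nat -> 'I_2),
    t 0%N = 0 -> (forall i, (i < n)%N -> t i <= t i.+1) ->
    P [set w | forall i, (i <= n)%N -> X (t i) w = x i] =
      ((if x 0%N == 0 then p else 1 - p) *
       \prod_(i < n) expmx ((t i.+1 - t i) *: Q) (x i) (x i.+1))%:E.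

(** * Strategies *)

Definition stopping_time (R : realType) (tau : cadlag_path R -> \bar R) :=
  (forall w, (0 <= tau w)%E) /\
  (forall t : R, 0 <= t -> filtX t [set w | (tau w <= t%:E)%E]).

(** The randomization parameters range over [0,1]; the values of a strategy
    at parameters outside [0,1] are irrelevant. *)
Definition mixed_stopping_time (R : realType)
    (mu : Omega R -> R -> \bar R) : Prop :=
  measurable_fun ([set: Omega R] `*` (`[0, 1]%classic : set R))
    (fun wu : Omega R * R => mu wu.1 wu.2) /\
  (forall u, 0 <= u <= 1 -> stopping_time (mu ^~ u)).

Definition random_time (R : realType) (nu : R -> \bar R) : Prop :=
  measurable_fun (`[0, 1]%classic : set R) nu /\
  (forall v, 0 <= v <= 1 -> (0 <= nu v)%E).

(** * Payoff and value *)

Section payoff.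
Variables (R : realType) (r : R) (f h : 'I_2 -> R).

(** Payoff when player 1 stops at [m] and player 2 at [n]; the last case is
    m = n = +oo. *)
Definition stop_payoff (w : cadlag_path R) (m n : \bar R) : R :=
  if (n < m)%E then expR (- r * fine n) * f (X (fine n) w)
  else if (m < +oo)%E then expR (- r * fine m) * h (X (fine m) w)
  else 0.

Variable P : probability (Omega R) R.

Definition Gamma (mu : Omega R -> R -> \bar R) (nu : R -> \bar R) : \bar R :=
  \int[P]_w \int[lebesgue_measure]_(v in `[(0 : R)%R, 1%R])
    \int[lebesgue_measure]_(u in `[(0 : R)%R, 1%R])
      (stop_payoff w (mu w u) (nu v))%:E.

Definition guarantee1 (mu : Omega R -> R -> \bar R) : \bar R :=
  ereal_inf [set Gamma mu nu | nu in @random_time R].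

Definition guarantee2 (nu : R -> \bar R) : \bar R :=
  ereal_sup [set Gamma mu nu | mu in @mixed_stopping_time R].

Definition is_game_value (V : \bar R) : Prop :=
  V = ereal_inf [set guarantee2 nu | nu in @random_time R] /\
  V = ereal_sup [set guarantee1 mu | mu in @mixed_stopping_time R].

(** The amount guaranteed by [mu] is the value of the game; in particular
    the upper and lower values agree. *)
Definition optimal1 (mu : Omega R -> R -> \bar R) : Prop :=
  mixed_stopping_time mu /\ is_game_value (guarantee1 mu).

End payoff.

(** * Notation of the proposition *)

(** Linear extension of [g] to Delta(K), [p] being the mass of state 0. *)
Definition lin (R : realType) (g : 'I_2 -> R) (p : R) : R :=
  p * g 0 + (1 - p) * g 1.

Definition is_p0 (R : realType) (a b r : R) (f h : 'I_2 -> R) (p0 : R) :=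
  0 < p0 < b / (a + b) /\
  (lin h 1 - lin f p0) / (1 - p0) = - r * lin f p0 / ((a + b) * p0 - b).

Definition lambda1 (R : realType) (a b p0 : R) : R :=
  (b - (a + b) * p0) / (p0 * (1 - p0)).

(** - ln (1 - u) / lam, equal to +oo at u = 1 ([lne 0 = -oo], whereas the
    real-valued [ln] has [ln 0 = 0]). *)
Definition threshold (R : realType) (lam u : R) : \bar R :=
  (- lne (1 - u)%:E * lam^-1%:E)%E.

(** inf {t >= t0 : time spent in state 0 during [t0,t] is at least th}, with
    inf of the empty set +oo. *)
Definition occupation_hitting (R : realType) (t0 : R) (th : \bar R)
    (w : cadlag_path R) : \bar R :=
  ereal_inf [set t%:E | t in [set t : R | t0 <= t /\
    (th <= \int[lebesgue_measure]_(s in `[t0, t]) ((X s w == 0)%:R)%:E)%E]].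

Definition mu_i (R : realType) (lam : R) (w : Omega R) (u : R) : \bar R :=
  occupation_hitting 0 (threshold lam u) w.

Definition c_ (R : realType) (p p0 : R) : R := (p - p0) / (p * (1 - p0)).

Definition utilde (R : realType) (c : R) (w : Omega R) (u : R) : R :=
  (u - c) / (1 - c) * (X 0 w == 0)%:R + u * (X 0 w == 1)%:R.

Definition mu_ii (R : realType) (lam c : R) (w : Omega R) (u : R) : \bar R :=
  if (X 0 w == 0) && (0 <= u < c) then 0%E
  else occupation_hitting 0 (threshold lam (utilde c w u)) w.

(** When P is the chain law with P(X_0 = 0) = p < p0 < b / (a + b), the set
    below is nonempty, so that the real-valued [inf] is the intended one. *)
Definition tp (R : realType) (P : probability (Omega R) R) (p0 : R) : R :=
  inf [set t : R | 0 <= t /\ P [set w | X t w = 0] = p0%:E].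

Definition mu_iii (R : realType) (lam t0 : R) (w : Omega R) (u : R) : \bar R :=
  occupation_hitting t0 (threshold lam u) w.

(* Main.v *)
(* At the belief [p0] player 1 stops in state 0 at rate [lam = lambda1], so that
   the information conveyed by his not having stopped cancels the drift of the
   chain: conditionally on that event the state keeps the law [(p0, 1 - p0)], and
   the equation defining [p0] says that player 2 is indifferent between all
   stopping times.
   The survival weights are computed by a Feynman-Kac formula, obtained as the
   limit of grid approximations of the occupation time. For [p > p0] the atom at
   time 0 moves the belief to [p0]; for [p < p0] the discounted payoff of player 2
   increases until the belief reaches [p0].
   Player 2 matches these guarantees by stopping at once if [p <= p0], and, if
   [p > p0], at an exponential time whose rate makes player 1 indifferent in
   state 0; then a function of the state solves the corresponding stopping
   problem, by an optional stopping argument on grids and Fatou's lemma. *)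

Require Import Defs.
From HB Require Import structures.
From mathcomp Require Import all_boot all_order all_algebra.
From mathcomp Require Import all_classical all_reals all_analysis.
From mathcomp Require Import measurable_realfun.
From mathcomp Require Import ring lra.
Set Implicit Arguments.
Unset Strict Implicit.
Unset Printing Implicit Defensive.
Import Order.TTheory GRing.Theory Num.Theory.
Import numFieldNormedType.Exports.
Local Open Scope classical_set_scope.
Local Open Scope ring_scope.

(** * The two-state chain *)

(** Only finite-dimensional laws are given, so statements about path functionals start as exact
    identities or inequalities on a grid, from the Markov property, and pass to the limit by right
    continuity. The discount on the grid is tuned to the mesh so that [(p0, 1 - p0)] is an exact
    left eigenvector; no error accumulates over the steps. The three strategies are instances of
    [cut_strategy], with a starting time [s] of the clock and an atom [c] at time 0, and share one
    estimate, in which [k0] is the mass that survives the atom. Along a given path, player 1 stops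
    in state 1 only for countably many parameters [u], so that a stop earns the discounted [h 0]. A
    strategy of player 2 with the same guarantee gives optimality and the existence of the value
    together. For [p > p0] the value is affine in [p], on the line through [(p0, lin f p0)] and
    [(1, h 0)]: its extrapolation to 0 gives [w1], the equation of the stopping problem in state 0
    then determines the rate [eta], and the equation in state 1 is that of [p0]. *)

Lemma ord2P (i : 'I_2) : i = 0 \/ i = 1.
Proof. by case: i => -[|[|//]] ?; [left|right]; apply: val_inj. Qed.

(* The transition semigroup in closed form: [Q^2 = - (a + b) Q]. *)
Definition tr (R : realType) (a b t : R) (i j : 'I_2) : R :=
  (i == j)%:R + (1 - expR (- (a + b) * t)) / (a + b) * generator a b i j.

Lemma generator_expr (R : realType) (a b : R) n :
  generator a b ^+ n.+1 = (- (a + b)) ^+ n *: generator a b.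
Proof.
elim: n => [|n ih]; first by rewrite expr1 expr0 scale1r.
have Q2 : generator a b * generator a b = - (a + b) *: generator a b.
  apply/matrixP => i j; rewrite !mxE !big_ord_recl big_ord0 !mxE/=.
  by case: (ord2P i) => ->; case: (ord2P j) => -> /=; ring.
by rewrite exprS ih -scalerAr Q2 scalerA -exprSr.
Qed.

(** By [generator_expr], each term of index at least 1 is [- q] times the exponential coefficient at
    [x]; the term of index 0 is brought into the same form by the correction [(i == j)%:R + q]. *)
Lemma expmx_generator (R : realType) (a b t : R) i j : a + b != 0 ->
  expmx (t *: generator a b) i j = tr a b t i j.
Proof.
move=> s0; rewrite mxE; set x := - (a + b) * t.
set q := generator a b i j / (a + b).
have -> : (fun n => ((t *: generator a b) ^+ n) i j / n`!%:R) =
  (fun n => (n == 0%N)%:R * ((i == j)%:R + q) - q * exp_coeff x n).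
  apply/funext => -[|n].
    by rewrite /exp_coeff/= !expr0 fact0 !divr1 mxE mul1r mulr1 addrK.
  rewrite exprZn generator_expr scalerA mxE /exp_coeff/= mul0r sub0r /q /x.
  by rewrite exprMn !exprS; field; rewrite s0 pnatr_eq0 -lt0n fact_gt0.
apply/cvg_lim => //.
have -> : tr a b t i j = ((i == j)%:R + q) - q * expR x.
  by rewrite /tr /q /x; field.
have -> : series (fun n => (n == 0%N)%:R * ((i == j)%:R + q) - q * exp_coeff x n) =
  (fun N => (N != 0%N)%:R * ((i == j)%:R + q) - q * series (exp_coeff x) N).
  apply/funext => N; rewrite /series/= big_split/= -mulr_suml; congr (_ * _ + _).
    by case: N => [|N]; [rewrite big_geq|rewrite big_ltn//= big1_seq ?addr0// => -[|m]//=;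
      rewrite mem_index_iota].
  by rewrite sumrN mulr_sumr.
apply: cvgB; last by apply: cvgMr; exact: is_cvg_series_exp_coeff.
rewrite -[X in _ --> X]mul1r; apply: cvgMl; apply: cvg_near_cst.
by exists 1%N => // n /=; rewrite -lt0n => ->.
Qed.

Lemma tr_ge0 (R : realType) (a b t : R) i j : 0 < a -> 0 < b -> 0 <= t ->
  0 <= tr a b t i j.
Proof.
move=> a0 b0 t0; have s0 : 0 < a + b by rewrite addr_gt0.
have e1 : expR (- (a + b) * t) <= 1.
  by rewrite -[leRHS]expR0 ler_expR; nra.
have e0 := expR_gt0 (- (a + b) * t).
rewrite /tr mxE; set e := expR _ in e1 e0 *.
have h c : 0 <= c <= a + b -> 0 <= (1 - e) / (a + b) * c <= 1.
  move=> /andP[c0 cs]; rewrite mulrAC ler_pdivrMr// divr_ge0//=.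
  - by rewrite mul1r; nra.
  - by rewrite mulr_ge0// subr_ge0.
  - exact: ltW.
have /h/andP[] : 0 <= a <= a + b by rewrite ltW//= lerDl ltW.
have /h/andP[] : 0 <= b <= a + b by rewrite ltW//= lerDr ltW.
by case: (ord2P i) => ->; case: (ord2P j) => -> /= *; rewrite ?mulrN; lra.
Qed.

(** * Paths, filtration and the Markov property *)

Lemma measurable_X (R : realType) (t : R) k : 0 <= t ->
  measurable ([set w | X t w = k] : set (Omega R)).
Proof. by move=> t0; apply: sub_sigma_algebra; exists t, k. Qed.

Lemma filtX_X (R : realType) (s t : R) k : 0 <= s -> s <= t ->
  filtX t [set w | X s w = k].
Proof. by move=> s0 st; apply: sub_sigma_algebra; exists s, k. Qed.

Lemma filtX_le (R : realType) (s t : R) : s <= t -> @filtX R s `<=` filtX t.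
Proof.
move=> st; apply: sub_sigma_algebra2 => _ [u [k [u0 us ->]]].
by exists u, k; split => //; exact: le_trans st.
Qed.

Lemma filtX_measurable (R : realType) (t : R) (A : set (Omega R)) :
  filtX t A -> measurable A.
Proof.
by apply: sub_sigma_algebra2 => _ [u [k [u0 us ->]]]; exists u, k.
Qed.

(** Prescribing the states by a function of time keeps repetitions in [l] from conflicting. *)
Definition finite_cylinder (R : realType) (l : seq R) (x : R -> 'I_2) :
  set (cadlag_path R) := [set w | forall t, t \in l -> X t w = x t].

(** The empty set makes the family stable under intersection: two cylinders may prescribe different
    states at a common time. *)
Definition cylinder_system (R : realType) (s : R) : set (set (cadlag_path R)) :=
  [set A | A = set0 \/ exists (l : seq R) x,
    (forall t, t \in l -> 0 <= t <= s) /\ A = finite_cylinder l x].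

Lemma cylinder_systemI (R : realType) (s : R) : setI_closed (@cylinder_system R s).
Proof.
move=> A B [->|[l [x [ls ->]]]]; first by left; rewrite set0I.
case=> [->|[l' [x' [ls' ->]]]]; first by left; rewrite setI0.
have [[t [tl tl' xx']]|H] := pselect (exists t, [/\ t \in l, t \in l' & x t <> x' t]).
  left; apply/seteqP; split => // w [/(_ _ tl) wx /(_ _ tl')].
  by rewrite wx.
right; exists (l ++ l'), (fun t => if t \in l then x t else x' t); split.
  by move=> t; rewrite mem_cat => /orP[/ls|/ls'].
apply/seteqP; split => [w [wl wl'] t|w wl].
  by rewrite mem_cat; case: ifPn => [tl _|_ /= tl']; [exact: wl|exact: wl'].
split=> t tl; first by rewrite wl ?mem_cat tl.
rewrite wl ?mem_cat ?tl ?orbT//; case: ifPn => // tl2; apply: contrapT => n.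
by apply: H; exists t.
Qed.

(** Uniqueness of measures needs generators that form a pi-system, which the single-time events of
    [filtX] do not. *)
Lemma filtX_cylinder_system (R : realType) (s : R) :
  @filtX R s = <<s @cylinder_system R s >>.
Proof.
apply/seteqP; split.
  apply: sub_sigma_algebra2 => _ [t [k [t0 ts ->]]]; right.
  exists [:: t], (fun=> k); split => [u|]; first by rewrite inE => /eqP ->; rewrite t0.
  apply/seteqP; split => [w /= wk u|w /= /(_ t)]; first by rewrite inE => /eqP->.
  by rewrite inE eqxx => /(_ isT).
apply: smallest_sub; first exact: smallest_sigma_algebra.
move=> _ [->|[l [x [ls ->]]]]; first exact: sigma_algebra0.
elim: l ls => [_|t l ih ls].
  rewrite [X in filtX _ X](_ : _ = setT); last by apply/seteqP; split.
  exact: (@measurableT _ (g_sigma_algebraType _)).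
rewrite [X in filtX _ X](_ : _ = [set w | X t w = x t] `&` finite_cylinder l x).
  apply: (@measurableI _ (g_sigma_algebraType _)).
    by have /andP[t0 ts] := ls t (mem_head _ _); exact: filtX_X.
  by apply: ih => u ul; apply: ls; rewrite inE ul orbT.
apply/seteqP; split => [w wl|w [wt wl] u].
  by split => [/=|u ul]; apply: wl; rewrite inE ?eqxx// ul orbT.
by rewrite inE => /orP[/eqP->//|/wl].
Qed.

Section chain.
Context (R : realType) (a b p : R) (P : probability (Omega R) R).
Hypotheses (ha : 0 < a) (hb : 0 < b).
Hypothesis Plaw : is_chain_law (generator a b) p P.

Let s0 : a + b != 0. Proof. by rewrite gt_eqF// addr_gt0. Qed.

Lemma chain_init k : P [set w | X 0 w = k] = (if k == 0 then p else 1 - p)%:E.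
Proof.
have := @Plaw 0%N (fun=> 0) (fun=> k) erefl.
rewrite big_ord0 mulr1 => <- //; congr (P _).
by apply/seteqP; split => [w /= wk i _//|w /= /(_ 0%N)]; exact.
Qed.

Lemma chain_markov_cylinder (l : seq R) (x : R -> 'I_2) k s t i j :
  (forall u, u \in l -> 0 <= u <= s) -> 0 <= s -> s <= t ->
  P ([set w | X 0 w = k] `&` finite_cylinder l x `&` [set w | X s w = i]
       `&` [set w | X t w = j]) =
  (P ([set w | X 0 w = k] `&` finite_cylinder l x `&` [set w | X s w = i])
     * (tr a b (t - s) i j)%:E)%E.
Proof.
move=> ls s_ge0 st.
(* [is_chain_law] covers nondecreasing times that start at 0, so the times are sorted and the state
   at time 0 is part of the event. The default value [j] of [y] is the state at the last index,
   [(size sl).+2]. *)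
pose sl := sort <=%R l; pose tt := nth t (0 :: rcons (rcons sl s) t).
pose y := nth j (k :: rcons (map x sl) i).
have slE u : (u \in sl) = (u \in l) by rewrite mem_sort.
have tt0 : tt 0%N = 0 by [].
have ttP : forall m, (m < (size sl).+2)%N -> tt m <= tt m.+1.
  have /(pathP t) : path <=%R 0 (rcons (rcons sl s) t).
    have: path <=%R 0 sl.
      rewrite path_min_sorted; first exact: sort_sorted le_total _.
      by apply/allP => u; rewrite slE => /ls/andP[].
    rewrite !rcons_path last_rcons st andbT => ->/=.
    have := mem_last 0 sl; rewrite inE => /orP[/eqP->//|].
    by rewrite slE => /ls/andP[].
  by rewrite !size_rcons => H m /H.
have tts : tt (size sl).+1 = s.
  by rewrite /tt/= nth_rcons size_rcons ltnSn nth_rcons ltnn eqxx.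
have ttt : tt (size sl).+2 = t.
  by rewrite /tt/= nth_rcons size_rcons ltnn eqxx.
have yi : y (size sl).+1 = i by rewrite /y/= nth_rcons size_map ltnn eqxx.
have yj : y (size sl).+2 = j by rewrite /y/= nth_default// size_rcons size_map.
have ttm m : (m < size sl)%N -> tt m.+1 = nth t sl m.
  by move=> ml; rewrite /tt/= nth_rcons size_rcons ltnS ltnW// nth_rcons ml.
have ym m : (m < size sl)%N -> y m.+1 = x (nth t sl m).
  by move=> ml; rewrite /y/= nth_rcons size_map ml (nth_map t).
have E1 : [set w | X 0 w = k] `&` finite_cylinder l x `&` [set w | X s w = i] =
    [set w | forall m, (m <= (size sl).+1)%N -> X (tt m) w = y m].
  apply/seteqP; split => [w [[w0 wl] ws] [|m]// |w wm].
    rewrite ltnS leq_eqVlt => /predU1P[->|ml]; first by rewrite tts yi.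
    by rewrite ttm// ym// wl// -slE mem_nth.
  split; last by rewrite /= -tts wm.
  split=> [/=|u]; first by rewrite -tt0 wm.
  rewrite -slE => /(nthP t)[m ml <-].
  by rewrite -(ym _ ml) -ttm//; apply: wm; exact: ltnW.
have E2 : [set w | X 0 w = k] `&` finite_cylinder l x `&` [set w | X s w = i]
       `&` [set w | X t w = j] =
    [set w | forall m, (m <= (size sl).+2)%N -> X (tt m) w = y m].
  rewrite E1; apply/seteqP; split => [w [wm wj] m|w wm].
    by rewrite leq_eqVlt => /predU1P[->|/wm//]; rewrite ttt yj.
  by split=> [m mn|/=]; [apply/wm/leqW|rewrite -ttt wm].
rewrite E2 E1 !Plaw// => [|m mn]; last by apply: ttP; rewrite ltnW.
by rewrite -EFinM -mulrA big_ord_recr/= ttt tts yi yj expmx_generator.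
Qed.

Lemma setI_decomp_X0 (A : set (Omega R)) : measurable A ->
  P A = (P ([set w | X 0%R w = 0%R] `&` A) + P ([set w | X 0%R w = 1%R] `&` A))%E.
Proof.
move=> mA; have m k := @measurable_X R 0 k (lexx _).
rewrite -measureU; last 3 first.
- exact: measurableI.
- exact: measurableI.
- by apply/seteqP; split => // w [[/= -> _] []].
rewrite -setIUl; congr (P _); apply/seteqP; split => [w Aw|w [//]].
by split => //=; exact: ord2P.
Qed.

(** Both sides are finite measures in [A], the right one thanks to [tr_ge0]. They agree on cylinders
    once the state at time 0 is summed out, hence on the generated sigma-algebra. *)
Lemma chain_markov (A : set (Omega R)) s t i j : filtX s A -> 0 <= s -> s <= t ->
  P (A `&` [set w | X s w = i] `&` [set w | X t w = j]) =
  (P (A `&` [set w | X s w = i]) * (tr a b (t - s) i j)%:E)%E.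
Proof.
move=> + s_ge0 st.
have mi := @measurable_X R s i s_ge0.
have mj := @measurable_X R t j (le_trans s_ge0 st).
have tr0 : 0 <= tr a b (t - s) i j by apply: tr_ge0 => //; rewrite subr_ge0.
rewrite filtX_cylinder_system => GA.
pose m1 : {measure set (Omega R) -> \bar R} := mrestr P (measurableI _ _ mi mj).
pose m2 : {measure set (Omega R) -> \bar R} := mscale (NngNum tr0) (mrestr P mi).
rewrite -setIA muleC; suff: m1 A = m2 A by [].
apply: (@g_sigma_algebra_measure_unique _ R (Omega R) (cylinder_system s) _
    (fun=> setT) _ _ m1 m2 _ _ _ A GA).
- move=> B GB; apply: (@filtX_measurable _ s).
  by rewrite filtX_cylinder_system; exact: sub_sigma_algebra.
- by move=> _; right; exists [::], (fun=> 0); split => //; apply/seteqP; split.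
- by apply/seteqP; split => // w _; exists 0%N.
- exact: cylinder_systemI.
- move=> B [->|[l [x [ls Bl]]]]; first by rewrite !measure0.
  have mB : measurable (B : set (Omega R)).
    apply: (@filtX_measurable _ s); rewrite filtX_cylinder_system.
    by apply: sub_sigma_algebra; right; exists l, x.
  rewrite /m1 /m2 /= /mrestr /mscale/= /mrestr.
  rewrite setI_decomp_X0; last by apply: measurableI => //; exact: measurableI.
  rewrite (setI_decomp_X0 (A := B `&` _)); last exact: measurableI.
  rewrite Bl !setIA !chain_markov_cylinder// ge0_muleDr//.
  by rewrite ![(_ * (_)%:E)%E]muleC.
- by move=> _; rewrite /m1 /= ltey_eq fin_num_measure//; apply: measurableI => //; exact: measurableI.
Qed.

End chain.

(** * Joint measurability of the payoff *)

(* Sampling at grid points to the right of [t] is what makes the right-continuity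
   of the paths enough for pointwise convergence. *)
Definition next_grid (R : realType) (d t : R) : R := (Num.truncn (t / d)).+1%:R * d.

Lemma next_grid_gt (R : realType) (d t : R) : 0 < d -> 0 <= t ->
  t < next_grid d t <= t + d.
Proof.
move=> d0 t0; have /truncn_itv/andP[h1 h2] : 0 <= t / d by rewrite divr_ge0// ltW.
rewrite /next_grid -ltr_pdivrMr// h2/= -natr1 mulrDl mul1r lerD2r.
by rewrite -ler_pdivlMr.
Qed.

Lemma next_gridE (R : realType) (d t : R) k : 0 < d ->
  k%:R * d <= t < k.+1%:R * d -> next_grid d t = k.+1%:R * d.
Proof.
move=> d0 /andP[h1 h2]; rewrite /next_grid (@truncn_def _ _ k)//.
by rewrite ler_pdivlMr// h1 ltr_pdivrMr.
Qed.

Lemma cvg_next_grid (R : realType) (d : R^nat) (t : R) : (forall n, 0 < d n) ->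
  d @ \oo --> 0 -> 0 <= t -> next_grid (d n) t @[n --> \oo] --> t.
Proof.
move=> d0 dcvg t0; apply: (@squeeze_cvgr _ _ _ _ (fun=> t) (fun n => t + d n)).
- apply: nearW => n; have /andP[h1 h2] := next_grid_gt (d0 n) t0.
  by rewrite (ltW h1) h2.
- exact: cvg_cst.
- by rewrite -[X in _ --> X]addr0; apply: cvgD => //; exact: cvg_cst.
Qed.

Lemma X_right_cont (R : realType) (w : cadlag_path R) (t : R) (u : R^nat) :
  0 <= t -> (forall n, t <= u n) -> u @ \oo --> t ->
  \forall n \near \oo, X (u n) w = X t w.
Proof.
move=> t0 tu ut; have [/(_ _ t0) wt _ _] := svalP w.
have : \forall n \near \oo, t < u n -> X (u n) w = X t w by exact: (ut _ wt).
apply: filterS => n h.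
by have := tu n; rewrite le_eqVlt => /predU1P[<-//|]; exact: h.
Qed.

Lemma X_next_grid (R : realType) (w : cadlag_path R) (d : R^nat) (t : R) :
  (forall n, 0 < d n) -> d @ \oo --> 0 -> 0 <= t ->
  \forall n \near \oo, X (next_grid (d n) t) w = X t w.
Proof.
move=> d0 dcvg t0; apply: X_right_cont => //; last exact: cvg_next_grid.
by move=> n; have /andP[/ltW] := next_grid_gt (d0 n) t0.
Qed.

Lemma X_max0 (R : realType) (w : cadlag_path R) t : X (Num.max 0 t) w = X t w.
Proof.
rewrite /Num.max; case: ltP => //; rewrite le_eqVlt => /predU1P[->//|t0].
by have [_ _ h] := svalP w; rewrite /X (h _ t0).
Qed.

Lemma cvg_harmonicS (R : realType) : (n.+1%:R^-1 : R) @[n --> \oo] --> 0.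
Proof. exact: cvg_harmonic. Qed.

(** The set is the lower limit of the events [E n] that the path is in state [k] at the next grid
    point, each a countable union of rectangles. Negative times are sent to 0, since paths are
    constant there. *)
Lemma measurable_X_joint (R : realType) k :
  measurable [set tw : R * Omega R | X tw.1 tw.2 = k].
Proof.
pose d n : R := n.+1%:R^-1; have d0 n : 0 < d n by rewrite invr_gt0.
pose E n := \bigcup_m ([set t : R | m%:R * d n <= Num.max 0 t < m.+1%:R * d n]
   `*` [set w : Omega R | X (m.+1%:R * d n) w = k]).
have EP n tw : E n tw <-> X (next_grid (d n) (Num.max 0 tw.1)) tw.2 = k.
  split=> [[m _ /= [/(next_gridE (d0 n)) -> //]]|Xk].
  exists (Num.truncn (Num.max 0 tw.1 / d n)) => //; split => //=.
  have /truncn_itv : 0 <= Num.max 0 tw.1 / d n.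
    by rewrite divr_ge0 ?le_max ?lexx// ltW.
  by rewrite ler_pdivlMr// ltr_pdivrMr.
have mE n : measurable (E n).
  apply: bigcupT_measurable => m; apply: measurableX; last first.
    by apply: measurable_X; rewrite mulr_ge0// ltW.
  rewrite (_ : [set _ | _] =
    setT `&` (fun t => Num.max 0 t) @^-1` `[m%:R * d n, m.+1%:R * d n[%classic).
    have mm : measurable_fun setT (fun t : R => Num.max 0 t) by exact: measurable_maxr.
    exact: mm.
  by apply/seteqP; split => t /=; rewrite in_itv//= => -[].
rewrite (_ : [set _ | _] = \bigcup_N \bigcap_n E (N + n)%N).
  by apply: bigcupT_measurable => N; apply: bigcapT_measurable.
apply/seteqP; split => -[t w] /=.
  move=> Xk; have m0 : 0 <= Num.max 0 t by rewrite le_max lexx.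
  have [N _ NP] := X_next_grid w d0 (@cvg_harmonicS R) m0.
  exists N => // n _; apply/EP => /=.
  by rewrite NP ?X_max0//= leq_addr.
case=> N _ h; have m0 : 0 <= Num.max 0 t by rewrite le_max lexx.
have [M _ MP] := X_next_grid w d0 (@cvg_harmonicS R) m0.
by move/EP: (h M I) => /=; rewrite MP ?X_max0//=; exact: leq_addl.
Qed.

Lemma ffun2E (R : realType) (g : 'I_2 -> R) (i : 'I_2) :
  g i = g 1 + (g 0 - g 1) * (i == 0)%:R.
Proof. by case: (ord2P i) => -> /=; ring. Qed.

Section payoff_measurability.
Context (R : realType) d (T : measurableType d).

Lemma measurable_fun_X (g : 'I_2 -> R) (t : T -> R) (w : T -> Omega R) :
  measurable_fun setT t -> measurable_fun setT w ->
  measurable_fun setT (fun x => g (X (t x) (w x))).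
Proof.
move=> mt mw; have -> : (fun x => g (X (t x) (w x))) =
  (fun x => g 1 + (g 0 - g 1) * (X (t x) (w x) == 0)%:R).
  by apply/funext => x; rewrite -ffun2E.
apply: (measurable_funD (f := cst (g 1))) => //.
apply: (measurable_funM (f := cst (g 0 - g 1))) => //.
have -> : (fun x => (X (t x) (w x) == 0)%:R : R) =
  \1_[set tw : R * Omega R | X tw.1 tw.2 = 0] \o (fun x => (t x, w x)).
  by apply/funext => x; rewrite /= indicE; congr (nat_of_bool _)%:R;
    apply/eqP/idP => [h|]; [exact/mem_set|rewrite inE].
apply: measurableT_comp; last exact: measurable_fun_pair.
by apply: measurable_indic; exact: measurable_X_joint.
Qed.

Lemma measurable_stop_payoff r (f h : 'I_2 -> R) (w : T -> Omega R)
    (m n : T -> \bar R) :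
  measurable_fun setT w -> measurable_fun setT m -> measurable_fun setT n ->
  measurable_fun setT (fun x => stop_payoff r f h (w x) (m x) (n x)).
Proof.
move=> mw mm mn.
have mf (k : T -> \bar R) (g : 'I_2 -> R) : measurable_fun setT k ->
    measurable_fun setT (fun x => expR (- r * fine (k x)) * g (X (fine (k x)) (w x))).
  move=> mk; have mfk : measurable_fun setT (fun x => fine (k x)).
    exact: measurableT_comp (fine_measurable _) mk.
  apply: measurable_funM; last exact: measurable_fun_X.
  by apply: measurableT_comp => //; exact: measurable_funM.
apply: measurable_fun_ifT; first exact: measurable_fun_lte.
  exact: mf.
by apply: measurable_fun_ifT => //; [exact: measurable_fun_lte|exact: mf].
Qed.

End payoff_measurability.

(** * Tonelli's theorem on a measurable rectangle *)

Section tonelli_dom.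
Context d1 d2 (T1 : measurableType d1) (T2 : measurableType d2) (R : realType).
Variables (m1 : {sigma_finite_measure set T1 -> \bar R})
  (m2 : {sigma_finite_measure set T2 -> \bar R}).
Variables (D1 : set T1) (D2 : set T2) (f : T1 * T2 -> \bar R).
Hypotheses (mD1 : measurable D1) (mD2 : measurable D2).
Hypotheses (mf : measurable_fun (D1 `*` D2) f) (f0 : forall x, (0 <= f x)%E).

Let F := f \_ (D1 `*` D2).

Let mF : measurable_fun setT F.
Proof. by apply/(measurable_restrictT _ _).1 => //; exact: measurableX. Qed.

Let F0 x : (0 <= F x)%E. Proof. by rewrite /F patchE; case: ifP. Qed.

Let F1 x : x \in D1 -> (\int[m2]_(y in D2) f (x, y) = \int[m2]_y F (x, y))%E.
Proof.
move=> xD; rewrite integral_mkcond; apply: eq_integral => y _.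
by rewrite /F !patchE in_setX xD.
Qed.

Let F2 y : y \in D2 -> (\int[m1]_(x in D1) f (x, y) = \int[m1]_x F (x, y))%E.
Proof.
move=> yD; rewrite integral_mkcond; apply: eq_integral => x _.
by rewrite /F !patchE in_setX yD andbT.
Qed.

Lemma measurable_integral_dom :
  measurable_fun D1 (fun x => \int[m2]_(y in D2) f (x, y))%E.
Proof.
have := measurable_fun_fubini_tonelli_F (m2 := m2) F mF F0.
move/(measurable_funS measurableT (@subsetT _ D1)).
by apply: eq_measurable_fun => x xD; rewrite F1.
Qed.

(** Extension of [f] by 0 outside the rectangle turns both sides into integrals over the whole
    product. *)
Lemma tonelli_dom :
  (\int[m1]_(x in D1) \int[m2]_(y in D2) f (x, y) =
   \int[m2]_(y in D2) \int[m1]_(x in D1) f (x, y))%E.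
Proof.
rewrite (eq_integral _ _ F1) (eq_integral _ _ F2).
transitivity (\int[m1]_x \int[m2]_y F (x, y))%E.
  rewrite integral_mkcond; apply: eq_integral => x _; rewrite patchE.
  case: ifPn => // xD; symmetry; apply: integral0_eq => y _.
  by rewrite /F patchE in_setX (negbTE xD).
rewrite (fubini_tonelli (m1 := m1) (m2 := m2) F mF F0).
rewrite [RHS]integral_mkcond; apply: eq_integral => y _; rewrite patchE.
case: ifPn => // yD; apply: integral0_eq => x _.
by rewrite /F patchE in_setX (negbTE yD) andbF.
Qed.

End tonelli_dom.

(** * Bounded measurable functions and step functions *)

Section bounded_measurable.
Context d (T : measurableType d) (R : realType).
Variables (mu : {measure set T -> \bar R}) (D : set T).
Hypotheses (mD : measurable D) (Dfin : (mu D < +oo)%E).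
Implicit Types f g : T -> R.

(** On a set of finite measure these functions form an algebra of integrable functions, so
    integrability follows from the shape of the integrand. *)
Definition bmfun f := measurable_fun D f /\ exists B, forall x, D x -> `|f x| <= B.

Lemma bmfun_integrable f : bmfun f -> mu.-integrable D (EFin \o f).
Proof.
move=> [mf [B fB]]; apply: measurable_bounded_integrable => //.
exists B; split; first exact: num_real.
by move=> M BM x Dx /=; rewrite (le_trans (fB _ Dx))// ltW.
Qed.

Lemma bmfun_cst (k : R) : bmfun (fun=> k).
Proof. by split; [exact: measurable_cst|exists `|k|]. Qed.

Lemma bmfunD f g : bmfun f -> bmfun g -> bmfun (fun x => f x + g x).
Proof.
move=> [mf [B fB]] [mg [C gC]]; split; first exact: measurable_funD.
exists (B + C) => x Dx; rewrite (le_trans (ler_normD _ _))// lerD//; [exact: fB|exact: gC].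
Qed.

Lemma bmfunM f g : bmfun f -> bmfun g -> bmfun (fun x => f x * g x).
Proof.
move=> [mf [B fB]] [mg [C gC]]; split; first exact: measurable_funM.
by exists (B * C) => x Dx; rewrite normrM ler_pM//; [exact: fB|exact: gC].
Qed.

Lemma bmfunZ (k : R) f : bmfun f -> bmfun (fun x => k * f x).
Proof. by apply: bmfunM; exact: bmfun_cst. Qed.

Lemma bmfun_indic (A : set T) : measurable A -> bmfun (\1_A : T -> R).
Proof.
move=> mA; split; first exact: measurable_indic.
by exists 1 => x _; rewrite indicE; case: (_ \in _); rewrite ?normr1 ?normr0.
Qed.

Lemma bmfun_sum n (F : nat -> T -> R) : (forall k, (k < n)%N -> bmfun (F k)) ->
  bmfun (fun x => \sum_(k < n) F k x).
Proof.
elim: n => [|n ih] FP.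
  by under eq_fun do rewrite big_ord0; exact: bmfun_cst.
under eq_fun do rewrite big_ord_recr/=; apply: bmfunD; last exact: FP.
by apply: ih => k kn; apply: FP; rewrite ltnS ltnW.
Qed.

Lemma bmfun_prod n (F : nat -> T -> R) : (forall k, (k < n)%N -> bmfun (F k)) ->
  bmfun (fun x => \prod_(k < n) F k x).
Proof.
elim: n => [|n ih] FP.
  by under eq_fun do rewrite big_ord0; exact: bmfun_cst.
under eq_fun do rewrite big_ord_recr/=; apply: bmfunM; last exact: FP.
by apply: ih => k kn; apply: FP; rewrite ltnS ltnW.
Qed.

Lemma bmfun_integralE f : bmfun f ->
  (\int[mu]_(x in D) (f x)%:E = (\int[mu]_(x in D) f x)%R%:E)%E.
Proof.
by move=> bf; rewrite /Rintegral fineK//; apply: integrable_fin_num => //; exact: bmfun_integrable.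
Qed.

Lemma bmfun_RintegralD f g : bmfun f -> bmfun g ->
  \int[mu]_(x in D) (f x + g x) = \int[mu]_(x in D) f x + \int[mu]_(x in D) g x.
Proof. by move=> bf bg; apply: RintegralD => //; exact: bmfun_integrable. Qed.

Lemma bmfun_RintegralZ (k : R) f : bmfun f ->
  \int[mu]_(x in D) (k * f x) = k * \int[mu]_(x in D) f x.
Proof. by move=> bf; apply: RintegralZl => //; exact: bmfun_integrable. Qed.

Lemma bmfun_Rintegral_sum n (F : nat -> T -> R) :
  (forall k, (k < n)%N -> bmfun (F k)) ->
  \int[mu]_(x in D) (\sum_(k < n) F k x) = \sum_(k < n) \int[mu]_(x in D) F k x.
Proof.
elim: n => [|n ih] FP.
  by under eq_Rintegral do rewrite big_ord0; rewrite Rintegral_cst// mul0r big_ord0.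
have FP' k : (k < n)%N -> bmfun (F k) by move=> kn; apply: FP; rewrite ltnS ltnW.
under eq_Rintegral do rewrite big_ord_recr/=.
rewrite bmfun_RintegralD ?ih ?big_ord_recr//; first exact: bmfun_sum.
exact: FP.
Qed.

Lemma bmfun_Rintegral_le f g : bmfun f -> bmfun g -> (forall x, D x -> f x <= g x) ->
  \int[mu]_(x in D) f x <= \int[mu]_(x in D) g x.
Proof. by move=> bf bg; apply: le_Rintegral => //; exact: bmfun_integrable. Qed.

(** The conclusion [bmfun f] matters as well: it is how the exponential of the occupation time, a
    limit of grid products, is found to be measurable in the path. *)
Lemma bounded_convergence (f_ : nat -> T -> R) f (B : R) :
  (forall n, measurable_fun D (f_ n)) ->
  (forall n x, D x -> `|f_ n x| <= B) ->
  (forall x, D x -> f_ n x @[n --> \oo] --> f x) ->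
  bmfun f /\ \int[mu]_(x in D) f_ n x @[n --> \oo] --> \int[mu]_(x in D) f x.
Proof.
move=> mf_ f_B f_f.
have mf : measurable_fun D f by apply: (measurable_fun_cvg mf_).
have bf : bmfun f.
  split=> //; exists B => x Dx; have /cvg_norm nf := f_f _ Dx.
  by apply: (cvgr_to_le nf); apply: nearW => n; exact: f_B.
split=> //.
have bf_ n : bmfun (f_ n) by split => //; exists B; exact: f_B.
have h : (\int[mu]_(x in D) (f_ n x)%:E)%E @[n --> \oo] --> (\int[mu]_(x in D) (f x)%:E)%E.
  have [] := @dominated_convergence _ _ _ mu D mD (fun n => EFin \o f_ n) (EFin \o f)
    (EFin \o cst B).
  - by move=> n; exact/measurable_EFinP.
  - exact/measurable_EFinP.
  - by apply: aeW => x Dx; apply: cvg_EFin; [exact: nearW|exact: f_f].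
  - by apply: bmfun_integrable; exact: bmfun_cst.
  - by apply: aeW => x n Dx /=; rewrite lee_fin; exact: f_B.
  by [].
have /fine_cvgP[_] : (\int[mu]_(x in D) (f_ n x)%:E)%E @[n --> \oo] -->
  (\int[mu]_(x in D) f x)%R%:E by rewrite -bmfun_integralE.
exact.
Qed.

Lemma Rintegral_indic (A : set T) : measurable A ->
  \int[mu]_(x in D) (\1_A x) = fine (mu (A `&` D)).
Proof. by move=> mA; rewrite /Rintegral integral_indic. Qed.

End bounded_measurable.

Section step.
Context (R : realType).
(* The cells are [[e k, e k.+1[] if [b] holds, and []e k, e k.+1]] otherwise. *)
Variables (b : bool) (e : R^nat) (c : R^nat).

Definition cell k : set R := [set` Interval (BSide b (e k)) (BSide b (e k.+1))].

Definition step n (x : R) : R := \sum_(k < n) c k * \1_(cell k) x.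

Lemma measurable_cell k : measurable (cell k). Proof. exact: measurable_itv. Qed.

Lemma cellP k x : cell k x <-> e k < x ?<= if b /\ x < e k.+1 ?<= if ~~ b.
Proof.
by rewrite /cell /= in_itv/=; case: b; split => /andP.
Qed.

Hypothesis e_nd : nondecreasing_seq e.

Lemma cell_uniq j k x : cell j x -> cell k x -> j = k.
Proof.
wlog jk : j k / (j < k)%N.
  by move=> h jx kx; case: (ltngtP j k) => // jk; [|symmetry]; exact: h.
move=> /cellP[_ xj] /cellP[xk _].
(* Exactly one of the two bounds is strict, whatever [b] is, so [e k < e j.+1], against
   monotonicity. *)
have := lteif_trans xk xj; rewrite andbN => /lt_le_trans/(_ (e_nd jk)).
by rewrite ltxx.
Qed.

Lemma step_cell n j x : (j < n)%N -> cell j x -> step n x = c j.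
Proof.
move=> jn jx; rewrite /step (bigD1 (Ordinal jn))//= indicE mem_set// mulr1.
rewrite big1 ?addr0// => k kj; rewrite indicE memNset ?mulr0// => kx.
by move/eqP: kj; apply; apply: val_inj; exact: (cell_uniq kx jx).
Qed.

Lemma stepP n x : (exists j, [/\ (j < n)%N, cell j x & step n x = c j]) \/
  ((forall j, (j < n)%N -> ~ cell j x) /\ step n x = 0).
Proof.
have [[j [jn jx]]|h] := pselect (exists j, (j < n)%N /\ cell j x).
  by left; exists j; split => //; exact: step_cell.
have h' j : (j < n)%N -> ~ cell j x by move=> jn jx; apply: h; exists j.
right; split=> //; rewrite /step big1// => -[k kn] _ /=.
by rewrite indicE memNset ?mulr0//; exact: h'.
Qed.

Lemma bmfun_step D n : bmfun D (step n).
Proof.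
apply: (@bmfun_sum _ _ _ D n (fun k x => c k * \1_(cell k) x)) => k _.
by apply: bmfunZ; apply: bmfun_indic; exact: measurable_cell.
Qed.

Lemma Rintegral_step (D : set R) n : measurable D ->
  (lebesgue_measure D < +oo)%E ->
  (forall k, (k < n)%N -> cell k `<=` D) ->
  \int[lebesgue_measure]_(x in D) step n x = \sum_(k < n) c k * (e k.+1 - e k).
Proof.
move=> mD Dfin cD.
have bmi k : bmfun D (\1_(cell k) : R -> R) by apply: bmfun_indic; exact: measurable_cell.
rewrite (bmfun_Rintegral_sum (mu := lebesgue_measure) mD Dfin
  (F := fun k x => c k * \1_(cell k) x)) => [|k kn]; last exact: (bmfunZ (c k) (bmi k)).
apply: eq_bigr => k _; rewrite (bmfun_RintegralZ (mu := lebesgue_measure) mD Dfin (c k) (bmi k)); congr (_ * _).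
rewrite (Rintegral_indic lebesgue_measure mD (measurable_cell k)).
rewrite setIidl; last exact: cD.
transitivity (fine (lebesgue_measure (cell k))) => //.
rewrite /cell lebesgue_measure_itv/= lte_fin; case: ltP => [_|h]; first by rewrite -EFinB.
by apply/eqP; rewrite eq_sym subr_eq0 eq_le h e_nd.
Qed.

End step.

(** * Occupation time of state 0 *)

Section occupation.
Context (R : realType).
Implicit Types (w : cadlag_path R) (s t : R).

Definition in0 w (x : R) : R := (X x w == 0)%:R.

Definition occ w s t : R := \int[lebesgue_measure]_(x in `[s, t]) in0 w x.

Lemma in0_ge0 w x : 0 <= in0 w x. Proof. by rewrite /in0 ler0n. Qed.

Lemma in0_le1 w x : in0 w x <= 1. Proof. by rewrite /in0 lern1 leq_b1. Qed.

Lemma bmfun_in0 w (D : set R) : measurable D -> bmfun D (in0 w).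
Proof.
move=> mD; split; last by exists 1 => x _; rewrite ger0_norm ?in0_ge0 ?in0_le1.
apply: (@measurable_funS _ _ _ _ setT) => //.
exact: (@measurable_fun_X _ _ _ (fun i => (i == 0)%:R) id (fun=> (w : Omega R))).
Qed.

Lemma itv_lebesgue_fin (b0 b1 : bool) s t :
  (lebesgue_measure [set` Interval (BSide b0 s) (BSide b1 t)] < +oo)%E.
Proof. by rewrite lebesgue_measure_itv/=; case: ifP => // _; rewrite -EFinD ltry. Qed.

Lemma occE w s t :
  (\int[lebesgue_measure]_(x in `[s, t]) ((X x w == 0%R)%:R)%:E = (occ w s t)%:E)%E.
Proof.
by apply: bmfun_integralE => //; [exact: itv_lebesgue_fin|exact: bmfun_in0].
Qed.

Lemma occ_ge0 w s t : 0 <= occ w s t.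
Proof. by apply: Rintegral_ge0 => x _; exact: in0_ge0. Qed.

Lemma occ_le w s t : s <= t -> occ w s t <= t - s.
Proof.
move=> st; apply: (@le_trans _ _ (\int[lebesgue_measure]_(x in `[s, t]) (fun=> 1) x)).
  apply: bmfun_Rintegral_le => //; first exact: itv_lebesgue_fin.
  - exact: bmfun_in0.
  - exact: bmfun_cst.
  - by move=> x _; exact: in0_le1.
rewrite Rintegral_cst// mul1r (_ : fine _ = fine (lebesgue_measure `[s, t]%classic))//.
rewrite lebesgue_measure_itv/= lte_fin; case: ltP => //= _.
by rewrite subr_ge0.
Qed.

Lemma occ_ss w s : occ w s s = 0.
Proof. by apply/eqP; rewrite eq_le occ_ge0 andbT -[leRHS](subrr s) occ_le. Qed.

Lemma occ_split w s u t : s <= u -> u <= t -> occ w s t = occ w s u + occ w u t.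
Proof.
move=> su ut; rewrite /occ.
have int (D : set R) : measurable D -> (lebesgue_measure D < +oo)%E ->
    lebesgue_measure.-integrable D (EFin \o in0 w).
  by move=> mD fD; apply: bmfun_integrable => //; exact: bmfun_in0.
rewrite -(@Rintegral_itv_obnd_cbnd _ u); last by apply: int => //; exact: itv_lebesgue_fin.
have E := @itv_bndbnd_setU _ R (BLeft s) (BRight u) (BRight t) su ut.
rewrite E Rintegral_setU//; first by rewrite -E; apply: int => //; exact: itv_lebesgue_fin.
apply/disj_setPS => x [/=]; rewrite !in_itv/= => /andP[_ h1] /andP[h2 _].
by have := lt_le_trans h2 h1; rewrite ltxx.
Qed.

Lemma occ_nd w s u t : s <= u -> u <= t -> occ w s u <= occ w s t.
Proof. by move=> su ut; rewrite (occ_split _ su ut) lerDl occ_ge0. Qed.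

(** The sums are integrals of step functions that sample the path at the right end of each cell;
    right continuity makes these converge pointwise, with no need to count jumps. *)
Lemma occ_riemann w s t : 0 <= s -> s < t ->
  (t - s) / n.+1%:R * \sum_(k < n.+1) in0 w (s + k.+1%:R * ((t - s) / n.+1%:R))
    @[n --> \oo] --> occ w s t.
Proof.
move=> s0 st; pose d n := (t - s) / n.+1%:R.
have ts0 : 0 < t - s by rewrite subr_gt0.
have d0 n : 0 < d n by rewrite divr_gt0.
have dcvg : d @ \oo --> 0.
  by rewrite -(mulr0 (t - s)); apply: cvgMr; exact: cvg_harmonic.
pose e n k := s + k%:R * d n.
have e_nd n : nondecreasing_seq (e n).
  by move=> j k jk; rewrite /e lerD2l ler_pM2r// ler_nat.
have eS n k : e n k.+1 - e n k = d n by rewrite /e -natr1; ring.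
have dn n : n.+1%:R * d n = t - s by rewrite /d mulrC divfK// pnatr_eq0.
(* The right end is in no cell; leaving it out does not change the integral. *)
pose D := `[s, t[%classic : set R.
have mD : measurable D by exact: measurable_itv.
have Dfin : (lebesgue_measure D < +oo)%E by exact: itv_lebesgue_fin.
pose F n x := step true (e n) (fun k => in0 w (e n k.+1)) n.+1 x.
have cvgF x : D x -> F n x @[n --> \oo] --> in0 w x.
  rewrite /D/= in_itv/= => /andP[sx xt].
  have xs0 : 0 <= x - s by rewrite subr_ge0.
  apply: cvg_near_cst.
  have : \forall n \near \oo, X (s + next_grid (d n) (x - s)) w = X x w.
    apply: X_right_cont.
    - exact: le_trans sx.
    - by move=> n; rewrite -lerBlDl; have /andP[/ltW] := next_grid_gt (d0 n) xs0.
    - rewrite -[X in _ --> X](subrKC s); apply: cvgD; first exact: cvg_cst.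
      exact: cvg_next_grid.
  apply: filterS => n Xn; rewrite /F.
  have := next_grid_gt (d0 n) xs0.
  have /truncn_itv : 0 <= (x - s) / d n by rewrite divr_ge0// ltW.
  set j := Num.truncn _; rewrite ler_pdivlMr// ltr_pdivrMr// => /andP[j1 j2] _.
  rewrite (@step_cell _ _ _ _ (e_nd n) _ j).
  - by rewrite /in0 -Xn.
  - rewrite -(ltr_nat R) -(ltr_pM2r (d0 n)) dn.
    by rewrite (le_lt_trans j1)// ltrD2r.
  - by apply/cellP; rewrite /e/= -lerBrDl j1 -ltrBlDl.
have mF n : measurable_fun D (F n) by have [] := @bmfun_step _ true (e n) (fun k => in0 w (e n k.+1)) D n.+1.
have FB n x : D x -> `|F n x| <= 1.
  move=> _; rewrite /F; case: (stepP true (fun k => in0 w (e n k.+1)) (e_nd n) n.+1 x).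
    by move=> [j [_ _ ->]]; rewrite ger0_norm ?in0_ge0 ?in0_le1.
  by move=> [_ ->]; rewrite normr0.
have [_] := bounded_convergence (mu := lebesgue_measure) mD Dfin mF FB cvgF.
rewrite /occ -Rintegral_itv_bndo_bndc; last first.
  by apply: bmfun_integrable => //; exact: bmfun_in0.
apply: cvg_trans; apply: near_eq_cvg; apply: nearW => n /=.
rewrite Rintegral_step//.
  by rewrite mulr_sumr; apply: eq_bigr => k _; rewrite eS mulrC.
move=> k kn x /cellP[/= h1 h2]; rewrite /D/= in_itv/=; apply/andP; split.
  by apply: le_trans h1; rewrite lerDl mulr_ge0// ltW.
apply: (lt_le_trans h2); rewrite /e -lerBrDl -(dn n).
by rewrite ler_pM2r// ler_nat.
Qed.

End occupation.

(** * Feynman-Kac formula at the stationary belief *)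

(** Turns a first-order expansion in the mesh into a limit: for the logarithms of the grid discounts
    with horizon [T], and for the one-step drift with [T = 1]. *)
Lemma cvg_scaled_derive (R : realType) (psi : R -> R) (c T : R) : 0 <= T ->
  is_derive (0 : R) (1 : R) psi c -> psi 0 = 0 ->
  n.+1%:R * psi (T / n.+1%:R) @[n --> \oo] --> T * c.
Proof.
move=> T0 [dpsi psiE] psi0; move: T0; rewrite le_eqVlt => /predU1P[<-|T0].
  by under eq_fun do rewrite mul0r psi0 mulr0; rewrite mul0r; exact: cvg_cst.
have h : h^-1 * psi h @[h --> 0^'] --> c.
  rewrite -psiE; have : cvg ((fun h => h^-1 *: ((psi \o shift 0) (h *: 1) - psi 0)) @ 0^') := dpsi.
  rewrite /derive; apply: cvg_trans; apply: near_eq_cvg; apply: nearW => h /=.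
  by rewrite addr0 psi0 subr0 /GRing.scale/= mulr1.
have /cvg_at_rightP H := cvg_dnbhs_at_right h.
have u0 : T / n.+1%:R @[n --> \oo] --> 0.
  by rewrite -(mulr0 T); apply: cvgMr; exact: cvg_harmonic.
have c1 := H (fun n => T / n.+1%:R) (conj (fun n => divr_gt0 T0 (ltr0Sn R n)) u0).
have : T * ((T / n.+1%:R)^-1 * psi (T / n.+1%:R)) @[n --> \oo] --> T * c by apply: cvgMr.
apply: cvg_trans; apply: near_eq_cvg; apply: nearW => n /=.
by rewrite invf_div mulrA (mulrC T) divfK ?gt_eqF.
Qed.

Section feynman_kac_grid.
Context (R : realType) (a b p : R) (P : probability (Omega R) R).
Hypotheses (ha : 0 < a) (hb : 0 < b).
Hypothesis Plaw : is_chain_law (generator a b) p P.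

Lemma bmfun_X (t : R) (F : 'I_2 -> R) : 0 <= t ->
  bmfun [set: Omega R] (fun w => F (X t w)).
Proof.
move=> t0; split; first exact: (measurable_fun_X F (t := fun=> t) (w := id)).
exists (\sum_l `|F l|) => w _; rewrite (bigD1 (X t w))//= lerDl.
exact: sumr_ge0.
Qed.

Lemma indicX (t : R) i (w : Omega R) :
  \1_[set w : Omega R | X t w = i] w = (X t w == i)%:R :> R.
Proof. by rewrite indicE; congr (nat_of_bool _)%:R; apply/idP/eqP; rewrite inE. Qed.

(** The discount is that of the state of arrival, to match Riemann sums at right ends. *)
Definition discounted_tr (d : 'I_2 -> R) (delta : R) : 'M[R]_2 :=
  \matrix_(i, j) (tr a b delta i j * d j).

Let PT : (P setT < +oo)%E. Proof. by rewrite ltey_eq fin_num_measure. Qed.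

(** The induction peels off the first step, so [t] and [A] are general: [A] together with the state
    at [t] becomes the past event at [t + delta]. *)
Lemma integral_grid (d : 'I_2 -> R) (delta : R) n : 0 <= delta ->
  forall (t : R) (A : set (Omega R)) i j, 0 <= t -> filtX t A ->
  \int[P]_w (\1_(A `&` [set w | X t w = i]) w *
    ((\prod_(k < n) d (X (t + k.+1%:R * delta) w)) *
     (X (t + n%:R * delta) w == j)%:R)) =
  fine (P (A `&` [set w | X t w = i])) * (discounted_tr d delta ^+ n) i j.
Proof.
move=> delta0; elim: n => [|n ih] t A i j t0 tA.
  have mA : measurable A := filtX_measurable tA; have mi := @measurable_X R t i t0.
  transitivity (\int[P]_w (((i == j)%:R : R) * \1_(A `&` [set w | X t w = i]) w)).
    apply: eq_Rintegral => w _; rewrite big_ord0 mul1r mul0r addr0 indicI/= indicX.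
    by have [->|_] := eqVneq (X t w) i; rewrite ?mulr0 ?mul0r ?mulr1// mulrC.
  rewrite (bmfun_RintegralZ measurableT PT); last by apply: bmfun_indic; exact: measurableI.
  rewrite (Rintegral_indic P measurableT); last exact: measurableI.
  by rewrite setIT expr0 mxE mulrC.
have t1 : 0 <= t + delta by rewrite addr_ge0.
pose B := A `&` [set w | X t w = i].
have tB : filtX (t + delta) B.
  apply: (@measurableI _ (g_sigma_algebraType _)); last by apply: filtX_X; rewrite ?lerDl.
  by apply: (filtX_le _ tA); rewrite lerDl.
have mB : measurable (B : set (Omega R)) := filtX_measurable tB.
pose F l (w : Omega R) := \1_(B `&` [set w | X (t + delta) w = l]) w *
    ((\prod_(k < n) d (X (t + delta + k.+1%:R * delta) w)) *
     (X (t + delta + n%:R * delta) w == j)%:R) : R.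
have bF l : bmfun [set: Omega R] (F l).
  apply: bmfunM.
    by apply: bmfun_indic; apply: measurableI => //; exact: measurable_X.
  apply: bmfunM.
    apply: (@bmfun_prod _ _ _ _ n (fun k (w : Omega R) => d (X (t + delta + k.+1%:R * delta) w))) => k _.
    by apply: bmfun_X; rewrite addr_ge0// mulr_ge0.
  by apply: (bmfun_X (fun i => (i == j)%:R)); rewrite addr_ge0// mulr_ge0.
transitivity (\int[P]_w (d 0 * F 0 w + d 1 * F 1 w)).
  apply: eq_Rintegral => w _; rewrite big_ord_recl/= mul1r.
  have -> : \prod_(k < n) d (X (t + (bump 0 k).+1%:R * delta) w) =
            \prod_(k < n) d (X (t + delta + k.+1%:R * delta) w).
    apply: eq_bigr => k _; congr (d (X _ w)).
    by rewrite /bump leq0n add1n -[in LHS]natr1; ring.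
  have -> : t + n.+1%:R * delta = t + delta + n%:R * delta by rewrite -natr1; ring.
  rewrite /F (indicI _ B)/= (indicI _ B)/= !indicX -/B.
  by case: (ord2P (X (t + delta) w)) => -> /=; ring.
rewrite (bmfun_RintegralD measurableT PT); [|exact: bmfunZ..].
rewrite !(bmfun_RintegralZ measurableT PT)// /F !ih//.
rewrite exprS mxE !big_ord_recl big_ord0 addr0.
have -> : lift ord0 ord0 = 1 :> 'I_2 by apply: val_inj.
have -> : ord0 = 0 :> 'I_2 by apply: val_inj.
have PB l : fine (P (B `&` [set w | X (t + delta) w = l])) =
    fine (P B) * tr a b delta i l.
  rewrite (chain_markov ha hb Plaw)// ?lerDl// addrAC subrr add0r.
  by rewrite fineM// fin_num_measure.
rewrite !PB /discounted_tr !mxE -/(discounted_tr _ _); ring.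
Qed.

(** The weight [g] turns the law at time [t] into a multiple of the eigenvector. For player 1 it is
    the probability, given the path, of not stopping in the atom at time 0, and [k0] is its
    expectation. *)
Lemma integral_grid_left_eigen (d pi g : 'I_2 -> R) (delta rho k0 t : R) n j :
  0 <= delta -> 0 <= t ->
  (forall j, \sum_i pi i * discounted_tr d delta i j = rho * pi j) ->
  (forall i, g i * fine (P [set w | X t w = i]) = k0 * pi i) ->
  \int[P]_w (g (X t w) * ((\prod_(k < n) d (X (t + k.+1%:R * delta) w)) *
     (X (t + n%:R * delta) w == j)%:R)) = k0 * (rho ^+ n * pi j).
Proof.
move=> delta0 t0 eig init.
have eign m : forall j, \sum_i pi i * (discounted_tr d delta ^+ m) i j = rho ^+ m * pi j.
  elim: m => [|m ih] l.
    rewrite !big_ord_recl big_ord0 expr0 mul1r !mxE addr0.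
    have -> : lift ord0 ord0 = 1 :> 'I_2 by apply: val_inj.
    by case: (ord2P l) => -> /=; rewrite ?mulr1 ?mulr0 ?addr0 ?add0r.
  rewrite exprSr; under eq_bigr do rewrite mxE mulr_sumr.
  rewrite exchange_big/=; under eq_bigr do under eq_bigr do rewrite mulrA.
  under eq_bigr do rewrite -mulr_suml ih -mulrA.
  by rewrite -mulr_sumr eig mulrA -exprSr.
pose F l (w : Omega R) := \1_(setT `&` [set w | X t w = l]) w *
    ((\prod_(k < n) d (X (t + k.+1%:R * delta) w)) *
     (X (t + n%:R * delta) w == j)%:R) : R.
have bF l : bmfun [set: Omega R] (F l).
  apply: bmfunM.
    by apply: bmfun_indic; apply: measurableI => //; exact: measurable_X.
  apply: bmfunM.
    apply: (@bmfun_prod _ _ _ _ n (fun k (w : Omega R) => d (X (t + k.+1%:R * delta) w))) => k _.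
    by apply: bmfun_X; rewrite addr_ge0// mulr_ge0.
  by apply: (bmfun_X (fun i => (i == j)%:R)); rewrite addr_ge0// mulr_ge0.
transitivity (\int[P]_w (g 0 * F 0 w + g 1 * F 1 w)).
  apply: eq_Rintegral => w _; rewrite /F !setTI !indicX.
  by case: (ord2P (X t w)) => -> /=; ring.
have tT : filtX t [set: Omega R] by exact: (@measurableT _ (g_sigma_algebraType _)).
rewrite (bmfun_RintegralD measurableT PT); [|exact: bmfunZ..].
rewrite !(bmfun_RintegralZ measurableT PT)// /F !integral_grid// !setTI !mulrA !init.
rewrite -!mulrA -mulrDr -eign !big_ord_recl big_ord0 addr0.
by have -> : lift ord0 ord0 = 1 :> 'I_2 by apply: val_inj.
Qed.

End feynman_kac_grid.

Lemma is_derive_ln_1expR (R : realType) (c s : R) :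
  is_derive (0 : R) (1 : R) (fun x => ln (1 + c * (1 - expR (- s * x)))) (c * s).
Proof.
pose u (x : R) : R := 1 + c * (1 - expR (- s * x)).
have du : is_derive (0 : R) (1 : R) u (c * s).
  have de : is_derive (0 : R) (1 : R) (fun x => expR (- s * x)) (- s).
    have e0 : is_derive (0 : R) (1 : R) (fun x : R => - s * x) (- s).
      by apply: is_derive_eq; rewrite /GRing.scale/= mulr1.
    have e1 : is_derive (- s * 0) (1 : R) expR 1.
      by apply: is_derive_eq; rewrite mulr0 expR0.
    have := @is_derive1_comp _ expR (fun x : R => - s * x) 0 _ _ e1 e0.
    by rewrite mul1r.
  rewrite /u; apply: is_derive_eq.
  by rewrite /GRing.scale/=; ring.
have u0 : u 0 = 1 by rewrite /u mulr0 expR0 subrr mulr0 addr0.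
have dl : is_derive (u 0) (1 : R) (@ln R) 1.
  by rewrite u0; apply: is_derive_eq; [exact: is_derive1_ln|rewrite invr1].
have := @is_derive1_comp _ (@ln R) u 0 _ _ dl du.
by rewrite mul1r.
Qed.

Section feynman_kac.
Context (R : realType) (a b p p0 lam : R) (P : probability (Omega R) R).
Hypotheses (ha : 0 < a) (hb : 0 < b).
Hypothesis Plaw : is_chain_law (generator a b) p P.
Hypotheses (p0_gt0 : 0 < p0) (p0_lt1 : p0 < 1) (lam_gt0 : 0 < lam).
Hypothesis lamE : b - (a + b) * p0 = lam * (p0 * (1 - p0)).

Definition two_point (i : 'I_2) : R := if i == 0 then p0 else 1 - p0.

Let s_gt0 : 0 < a + b. Proof. by rewrite addr_gt0. Qed.

Let yy (delta : R) : R := lam * ((1 - expR (- (a + b) * delta)) / (a + b)).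

Let yy_ge0 delta : 0 <= delta -> 0 <= yy delta.
Proof.
move=> d0; rewrite /yy mulr_ge0 ?(ltW lam_gt0)// divr_ge0 ?(ltW s_gt0)// subr_ge0.
by rewrite -expR0 ler_expR mulNr oppr_le0 mulr_ge0// ltW.
Qed.

Let p0yy delta : 0 <= delta -> p0 * yy delta < 1.
Proof.
move=> d0; have e0 := expR_gt0 (- (a + b) * delta).
rewrite /yy; set e := expR _ in e0 *.
rewrite !mulrA ltr_pdivrMr// mul1r -(ltr_pM2r (x := 1 - p0)) ?subr_gt0//.
have -> : p0 * lam * (1 - e) * (1 - p0) = (b - (a + b) * p0) * (1 - e).
  by rewrite lamE; ring.
have lp : 0 < b - (a + b) * p0 by rewrite lamE !mulr_gt0// subr_gt0.
have h := mulr_gt0 lp e0; rewrite -subr_gt0.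
have -> : (a + b) * (1 - p0) - (b - (a + b) * p0) * (1 - e) =
  a + (b - (a + b) * p0) * e by ring.
exact: addr_gt0.
Qed.

(** By [lamE], one step moves [(p0, 1 - p0)] to [(p0 * (1 + (1 - p0) * y), (1 - p0) * (1 - p0 * y))]
    with [y = yy delta]. As state 1 is not discounted, the eigenvalue has to be [1 - p0 * y], and
    this fixes the discount in state 0. *)
Let disc (delta : R) (i : 'I_2) : R :=
  if i == 0 then (1 - p0 * yy delta) / (1 + (1 - p0) * yy delta) else 1.

Let den delta : 0 <= delta -> 0 < 1 + (1 - p0) * yy delta.
Proof.
by move=> d0; rewrite ltr_wpDr// mulr_ge0 ?yy_ge0// subr_ge0 ltW.
Qed.

(* The discount is chosen so that [two_point] is exactly a left eigenvector of
   the discounted one-step matrix, for every mesh. *)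
Let disc_eigen delta j : 0 <= delta ->
  \sum_i two_point i * discounted_tr a b (disc delta) delta i j =
  (1 - p0 * yy delta) * two_point j.
Proof.
move=> d0; have := den d0; rewrite /yy => /gt_eqF/negbT dd.
have s0 : a + b != 0 by rewrite gt_eqF.
rewrite !big_ord_recl big_ord0 addr0.
have -> : lift ord0 ord0 = 1 :> 'I_2 by apply: val_inj.
rewrite !mxE /two_point /disc /tr !mxE /yy /=.
set E := (1 - expR _) / _ in dd *.
have h : E * (b - (a + b) * p0) = p0 * (1 - p0) * (lam * E) by rewrite lamE; ring.
case: (ord2P j) => -> /=.
  have -> : p0 * ((1 + E * - a) * ((1 - p0 * (lam * E)) / (1 + (1 - p0) * (lam * E)))) +
    (1 - p0) * ((0 + E * b) * ((1 - p0 * (lam * E)) / (1 + (1 - p0) * (lam * E)))) =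
    (p0 + E * (b - (a + b) * p0)) * ((1 - p0 * (lam * E)) / (1 + (1 - p0) * (lam * E))).
    by ring.
  by rewrite h; field.
rewrite !mulr1.
have -> : p0 * (0 + E * a) + (1 - p0) * (1 + E * - b) = 1 - p0 - E * (b - (a + b) * p0) by ring.
by rewrite h; ring.
Qed.

(** In this form a product of discounts along the grid is the exponential of a multiple of a Riemann
    sum of the occupation time. *)
Let disc_expR delta i : 0 <= delta -> disc delta i =
  expR ((ln (1 - p0 * yy delta) - ln (1 + (1 - p0) * yy delta)) * (i == 0)%:R).
Proof.
move=> d0; rewrite /disc; case: ifP => _; last by rewrite mulr0 expR0.
by rewrite mulr1 expRB !lnK// posrE ?den// subr_gt0 p0yy.
Qed.

Let disc_le1 delta i : 0 <= delta -> 0 <= disc delta i <= 1.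
Proof.
move=> d0; rewrite /disc; case: ifP => _; last by rewrite ler01 lexx.
have h1 := den d0; have h2 := p0yy d0; have h3 := yy_ge0 d0.
rewrite divr_ge0 ?subr_ge0 ?(ltW h2) ?(ltW h1)//=.
rewrite ler_pdivrMr// mul1r lerD2l.
apply: (@le_trans _ _ 0); first by rewrite oppr_le0 mulr_ge0// ltW.
by rewrite mulr_ge0// subr_ge0 ltW.
Qed.

Let PT : (P setT < +oo)%E. Proof. by rewrite ltey_eq fin_num_measure. Qed.

Let cvg_yy q T : 0 <= T ->
  n.+1%:R * ln (1 + q * yy (T / n.+1%:R)) @[n --> \oo] --> T * (q * lam).
Proof.
move=> T0; have := cvg_scaled_derive T0 (is_derive_ln_1expR (q * lam / (a + b)) (a + b)).
have -> : q * lam / (a + b) * (a + b) = q * lam by rewrite divfK// gt_eqF.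
rewrite mulr0 expR0 subrr mulr0 addr0 ln1 => /(_ erefl).
have E x : q * lam / (a + b) * (1 - expR (- (a + b) * x)) = q * yy x by rewrite /yy; ring.
by under eq_fun do rewrite E.
Qed.

(** The grid product [Z n] is evaluated twice: pathwise it tends to the exponential of the
    occupation time, while its weighted expectation is exactly a power of the eigenvalue, which
    tends to [expR (- (lam * p0) * (t - s))]. *)
Lemma feynman_kac (s t k0 : R) (g : 'I_2 -> R) j : 0 <= s -> s <= t ->
  (forall i, g i * fine (P [set w | X s w = i]) = k0 * two_point i) ->
  bmfun [set: Omega R] (fun w => expR (- lam * occ w s t)) /\
  \int[P]_w (g (X s w) * (expR (- lam * occ w s t) * (X t w == j)%:R)) =
  k0 * (expR (- (lam * p0) * (t - s)) * two_point j).
Proof.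
move=> s0; rewrite le_eqVlt => /predU1P[<-{t}|st] init.
  split.
    by under eq_fun do rewrite occ_ss; exact: bmfun_cst.
  rewrite subrr mulr0 expR0 mul1r -init.
  transitivity (\int[P]_w (g j * \1_[set w : Omega R | X s w = j] w)).
    apply: eq_Rintegral => w _; rewrite occ_ss mulr0 expR0 mul1r indicX.
    by have [->//|_] := eqVneq; rewrite !mulr0.
  have mj := @measurable_X R s j s0.
  rewrite (bmfun_RintegralZ measurableT PT); last exact: bmfun_indic.
  by rewrite (Rintegral_indic P measurableT)// setIT.
have t0 : 0 <= t by rewrite (le_trans s0)// ltW.
pose T := t - s; have T0 : 0 < T by rewrite subr_gt0.
pose dl n := T / n.+1%:R; have dl0 n : 0 <= dl n by rewrite divr_ge0// ltW.
have dlT n : s + n.+1%:R * dl n = t.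
  by rewrite /dl mulrC divfK ?pnatr_eq0// /T subrKC.
pose Z n (w : Omega R) := \prod_(k < n.+1) disc (dl n) (X (s + k.+1%:R * dl n) w).
have ZE n w : Z n w = expR ((n.+1%:R * ln (1 - p0 * yy (dl n)) -
    n.+1%:R * ln (1 + (1 - p0) * yy (dl n))) / T *
    (T / n.+1%:R * \sum_(k < n.+1) in0 w (s + k.+1%:R * dl n))).
  rewrite /Z; under eq_bigr do rewrite disc_expR//.
  rewrite -expR_sum -mulr_sumr -mulrBr; congr expR; rewrite -/(dl n) /dl.
  have key (N x y : R) : N != 0 -> N * x / T * (T / N * y) = x * y.
    by move=> N0; field; rewrite N0 gt_eqF.
  by rewrite key// pnatr_eq0.
have bX n k : bmfun [set: Omega R] (fun w => disc (dl n) (X (s + k%:R * dl n) w)).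
  by apply: bmfun_X; rewrite addr_ge0// mulr_ge0.
have bZ n : bmfun [set: Omega R] (Z n).
  by apply: (@bmfun_prod _ _ _ _ n.+1
    (fun k (w : Omega R) => disc (dl n) (X (s + k.+1%:R * dl n) w))) => k _; exact: bX.
have Z01 n w : 0 <= Z n w <= 1.
  apply/andP; split; first by apply: prodr_ge0 => k _; have /andP[] := disc_le1 (X (s + k.+1%:R * dl n) w) (dl0 n).
  by apply: prodr_ile1 => k _; exact: disc_le1.
have Zcvg w : Z n w @[n --> \oo] --> expR (- lam * occ w s t).
  under eq_fun do rewrite ZE.
  apply: continuous_cvg; first exact: continuous_expR.
  apply: cvgM; last exact: occ_riemann.
  (* The numerator of the discount contributes [- p0 * lam] and its denominator
     [- (1 - p0) * lam]. *)
  have -> : - lam = (T * (- p0 * lam) - T * ((1 - p0) * lam)) / T by field; rewrite gt_eqF.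
  apply: cvgMl; apply: cvgB; last by apply: cvg_yy; exact: ltW.
  by under eq_fun do rewrite -mulNr; apply: cvg_yy; exact: ltW.
have [bE _] : bmfun [set: Omega R] (fun w => expR (- lam * occ w s t)) /\
    \int[P]_w Z n w @[n --> \oo] --> \int[P]_w expR (- lam * occ w s t).
  apply: (bounded_convergence measurableT PT (B := 1)) => //.
  - by move=> n; case: (bZ n).
  - by move=> n w _; have /andP[z0 z1] := Z01 n w; rewrite ger0_norm.
split=> //.
have bg := bmfun_X g s0; have bj := bmfun_X (fun i => (i == j)%:R : R) t0.
have [_ [G GB]] := bg.
have [_ lim1] : bmfun [set: Omega R] (fun w => g (X s w) * (expR (- lam * occ w s t) * (X t w == j)%:R)) /\
    \int[P]_w (g (X s w) * (Z n w * (X t w == j)%:R)) @[n --> \oo] -->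
    \int[P]_w (g (X s w) * (expR (- lam * occ w s t) * (X t w == j)%:R)).
  apply: (bounded_convergence measurableT PT (B := G)) => //.
  - by move=> n; have [] := bmfunM bg (bmfunM (bZ n) bj).
  - move=> n w _; rewrite normrM -[leRHS]mulr1 ler_pM//; first exact: GB.
    have /andP[z0 z1] := Z01 n w; rewrite normrM (ger0_norm z0).
    by case: (_ == _); rewrite ?normr0 ?mulr0 ?normr1 ?mulr1.
  - by move=> w _; apply: cvgMr; apply: cvgMl; exact: Zcvg.
have lim2 : \int[P]_w (g (X s w) * (Z n w * (X t w == j)%:R)) @[n --> \oo] -->
    k0 * (expR (- (lam * p0) * (t - s)) * two_point j).
  have -> : (fun n => \int[P]_w (g (X s w) * (Z n w * (X t w == j)%:R))) =
      (fun n => k0 * (expR (n.+1%:R * ln (1 + - p0 * yy (dl n))) * two_point j)).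
    apply/funext => n.
    have := @integral_grid_left_eigen R a b p P ha hb Plaw (disc (dl n)) two_point g
      (dl n) (1 - p0 * yy (dl n)) k0 s n.+1 j (dl0 n) s0 (fun j => disc_eigen j (dl0 n)) init.
    rewrite dlT => ->; congr (_ * (_ * _)).
    by rewrite mulNr expRM_natl lnK// posrE subr_gt0 p0yy.
  apply: cvgMr; apply: cvgMl; apply: continuous_cvg; first exact: continuous_expR.
  have -> : - (lam * p0) * (t - s) = T * (- p0 * lam) by rewrite /T; ring.
  by apply: cvg_yy; exact: ltW.
exact: (cvg_unique _ lim1 lim2).
Qed.

End feynman_kac.

Lemma measurable_fun_ereal_le d (T : measurableType d) (R : realType) (D : set T)
    (f : T -> \bar R) :
  (forall r : R, measurable (D `&` [set x | (f x <= r%:E)%E])) -> measurable_fun D f.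
Proof.
move=> mf mD; apply: (measurability _ (ErealGenOInfty.measurableE R)) => //.
move=> /= _ [_ [r ->] <-].
rewrite (_ : _ `&` _ = D `\` (D `&` [set x | (f x <= r%:E)%E])); first exact: measurableD.
apply/seteqP; split => [x [Dx /=]|x [Dx /= h]].
  by rewrite in_itv/= andbT => h; split => // -[_ /=]; rewrite leNgt h.
by split=> //=; rewrite in_itv/= andbT ltNge; apply/negP => h'; apply: h.
Qed.

(** * Strategies of player 1 *)

Section hitting.
Context (R : realType).
Implicit Types (w : cadlag_path R) (s t y : R).

Lemma occupation_hittingE s (th : \bar R) w : occupation_hitting s th w =
  ereal_inf [set t%:E | t in [set t : R | s <= t /\ (th <= (occ w s t)%:E)%E]].
Proof.
by rewrite /occupation_hitting; under eq_set do rewrite occE.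
Qed.

Lemma occupation_hitting_ge s th w : (s%:E <= occupation_hitting s th w)%E.
Proof.
by rewrite occupation_hittingE; apply: le_ereal_inf_tmp => _ [t [st _] <-]; rewrite lee_fin.
Qed.

Lemma occupation_hitting_oo s w : occupation_hitting s +oo%E w = +oo%E.
Proof.
rewrite occupation_hittingE (_ : [set _ | _ in _] = set0) ?ereal_inf0//.
by apply/seteqP; split => // x [t [_ /=]]; rewrite leye_eq.
Qed.

Lemma occupation_hitting_le s y t w : s <= t ->
  (occupation_hitting s y%:E w <= t%:E)%E = (y <= occ w s t).
Proof.
move=> st; apply/idP/idP => [|yt]; last first.
  by rewrite occupation_hittingE; apply: ereal_inf_lbound; exists t.
apply: contraTT; rewrite -!ltNge => ty.
(* The occupation time grows at rate at most 1, so [y] cannot be reached before this time. *)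
apply: (@lt_le_trans _ _ (t + (y - occ w s t))%:E).
  by rewrite lte_fin ltrDl subr_gt0.
rewrite occupation_hittingE; apply: le_ereal_inf_tmp => _ [u [su +] <-].
rewrite !lee_fin => yu; have [tu|ut] := leP t u.
  by have h := occ_le w tu; rewrite (occ_split w st tu) in yu; lra.
by have h := occ_nd w su (ltW ut); lra.
Qed.

Lemma occ_occupation_hitting s y m w : 0 <= y ->
  occupation_hitting s y%:E w = m%:E -> occ w s m = y.
Proof.
move=> y0 hm; have sm : s <= m by rewrite -lee_fin -hm occupation_hitting_ge.
apply/eqP; rewrite eq_le; apply/andP; split; last first.
  by rewrite -occupation_hitting_le ?hm.
rewrite leNgt; apply/negP => ym.
have [sm'|] := ltP s m; last first.
  by move=> ms; have := ym; rewrite (le_anti (introT andP (conj ms sm))) occ_ss ltNge y0.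
(* Again by the rate bound, a surplus over [y] at time [m] means that [y] was reached earlier by at
   least that much, or already at [s]. *)
pose t := Num.max s (m - (occ w s m - y)).
have st : s <= t by rewrite le_max lexx.
have tm : t < m by rewrite gt_max sm'/= ltrBlDr ltrDl subr_gt0.
have : (occupation_hitting s y%:E w <= t%:E)%E.
  rewrite occupation_hitting_le//.
  have h1 := occ_le w (ltW tm); have h2 := occ_split w st (ltW tm).
  have h3 : m - (occ w s m - y) <= t by rewrite le_max lexx orbT.
  by lra.
by rewrite hm lee_fin leNgt tm.
Qed.

Lemma thresholdE (lam u : R) : u < 1 -> threshold lam u = (- ln (1 - u) / lam)%:E.
Proof. by move=> u1; rewrite /threshold lne_EFin ?subr_gt0// -EFinN -EFinM. Qed.

Lemma threshold1 (lam : R) : 0 < lam -> threshold lam 1 = +oo%E.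
Proof.
move=> lam0; by rewrite /threshold subrr le0_lneNy//= gt0_mulye// lte_fin invr_gt0.
Qed.

(** Given the path, a uniform [u] thus survives [t] with probability [expR (- lam * occ w s t)], the
    weight in [feynman_kac]. *)
Lemma hitting_threshold_le (lam u s t : R) w : 0 < lam -> u <= 1 -> s <= t ->
  (occupation_hitting s (threshold lam u) w <= t%:E)%E =
  (u <= 1 - expR (- lam * occ w s t)).
Proof.
move=> lam0; rewrite le_eqVlt => /predU1P[->|u1] st.
  rewrite threshold1// occupation_hitting_oo leye_eq/=.
  by symmetry; apply/negbTE; rewrite -ltNge ltrBlDr ltrDl expR_gt0.
rewrite thresholdE// occupation_hitting_le// ler_pdivrMr// lerNl -[LHS]ler_expR.
rewrite lnK ?posrE ?subr_gt0// mulNr (mulrC lam).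
by apply/idP/idP => h; lra.
Qed.

(* Common form of [mu_i], [mu_ii] and [mu_iii]. If [c i = 1], only [u = 1] reaches
   the second branch, where the division by zero gives the threshold 0. *)
Definition cut_strategy (lam s : R) (c : 'I_2 -> R) (w : Omega R) (u : R) : \bar R :=
  if u < c (X 0 w) then 0%E
  else occupation_hitting s (threshold lam ((u - c (X 0 w)) / (1 - c (X 0 w)))) w.

Lemma cut_param (c u : R) : 0 <= c <= 1 -> c <= u -> u <= 1 ->
  0 <= (u - c) / (1 - c) <= 1.
Proof.
move=> /andP[c0]; rewrite le_eqVlt => /predU1P[->|c1] cu u1.
  by rewrite [1 - 1]subrr invr0 mulr0 lexx ler01.
rewrite divr_ge0 ?subr_ge0 ?(ltW c1)//= ler_pdivrMr ?subr_gt0// mul1r lerD2r//.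
Qed.

Local Notation past t := (g_sigma_algebraType [set A | exists s k,
  [/\ 0 <= s, s <= t & A = [set w : cadlag_path R | X s w = k]]]).

(** The Riemann sums look at the path only at times in [[s, t]], so their limit is adapted. *)
Lemma occ_filtX_measurable s t : 0 <= s -> s <= t ->
  measurable_fun [set: past t] (fun w : past t => occ w s t).
Proof.
move=> s0; rewrite le_eqVlt => /predU1P[<-{t}|st].
  rewrite [X in measurable_fun _ X](_ : _ = cst 0); first exact: measurable_cst.
  by apply/funext => w; rewrite /= occ_ss.
apply: (measurable_fun_cvg (h := fun n (w : past t) => (t - s) / n.+1%:R *
  \sum_(k < n.+1) in0 w (s + k.+1%:R * ((t - s) / n.+1%:R)))); last first.
  by move=> w _; exact: occ_riemann.
move=> n; apply: measurable_funM; first exact: measurable_cst.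
apply: measurable_sum => k; set u := s + _.
have tu : 0 <= u <= t.
  have ts : 0 <= t - s by rewrite subr_ge0 ltW.
  rewrite addr_ge0 ?mulr_ge0 ?divr_ge0//= /u -lerBrDl mulrA ler_pdivrMr ?ltr0n//.
  by rewrite mulrC ler_wpM2l// ler_nat.
have -> : (fun w : past t => in0 w u) = \1_([set w | X u w = 0] : set (past t)).
  by apply/funext => w; rewrite indicE /in0; congr (nat_of_bool _)%:R; apply/eqP/idP; rewrite inE.
apply: measurable_indic; have /andP[u0 ut] := tu; exact: filtX_X.
Qed.

Lemma occ_filtX s t (y : R) : 0 <= s -> s <= t ->
  filtX t [set w | y <= occ w s t].
Proof.
move=> s0 st; have := @occ_filtX_measurable s t s0 st measurableT `[y, +oo[%classic.
rewrite setTI => h; have := h (measurable_itv _).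
rewrite (_ : _ @^-1` _ = [set w | y <= occ w s t])//.
by apply/seteqP; split => w /=; rewrite in_itv/= andbT.
Qed.

Lemma measurable_occ s t : 0 <= s -> s <= t ->
  measurable_fun [set: Omega R] (fun w => occ w s t).
Proof.
move=> s0 st mT Y mY; rewrite setTI.
apply: (@filtX_measurable R t); have := occ_filtX_measurable s0 st measurableT mY.
by rewrite setTI.
Qed.

End hitting.

Section cut_strategy.
Context (R : realType) (lam s : R) (c : 'I_2 -> R).
Hypotheses (lam_gt0 : 0 < lam) (s_ge0 : 0 <= s) (c01 : forall i, 0 <= c i <= 1).

Local Notation cut := (cut_strategy lam s c).

Lemma cut_strategy_ge0 w u : (0 <= cut w u)%E.
Proof.
rewrite /cut_strategy; case: ifP => // _.
by apply: le_trans (occupation_hitting_ge _ _ _); rewrite lee_fin.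
Qed.

Lemma cut_strategy_le (w : Omega R) u (t : R) : 0 <= u <= 1 -> 0 <= t ->
  (cut w u <= t%:E)%E = (u < c (X 0 w)) || ((s <= t) &&
    ((u - c (X 0 w)) / (1 - c (X 0 w)) <= 1 - expR (- lam * occ w s t))).
Proof.
move=> /andP[u0 u1] t0; rewrite /cut_strategy; case: ltP => [_|cu] /=.
  by rewrite lee_fin.
have /andP[v0 v1] := cut_param (c01 (X 0 w)) cu u1.
have [st|ts] := leP s t; first by rewrite hitting_threshold_le.
apply/negbTE; rewrite -ltNge.
by apply: lt_le_trans (occupation_hitting_ge _ _ _); rewrite lte_fin.
Qed.

Lemma filtX_hitting_threshold (v t : R) : v <= 1 ->
  filtX t [set w | (occupation_hitting s (threshold lam v) w <= t%:E)%E].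
Proof.
have F0 : filtX t set0 by exact: sigma_algebra0.
move=> v1; have [st|ts] := leP s t; last first.
  rewrite (_ : [set _ | _] = set0)//; apply/seteqP; split => // w /=.
  by rewrite leNgt (lt_le_trans _ (occupation_hitting_ge _ _ _))// lte_fin.
move: v1; rewrite le_eqVlt => /predU1P[->|v1].
  rewrite (_ : [set _ | _] = set0)//; apply/seteqP; split => // w /=.
  by rewrite threshold1// occupation_hitting_oo leye_eq.
rewrite thresholdE//; under eq_set do rewrite occupation_hitting_le//.
exact: occ_filtX.
Qed.

(** By [cut_strategy_le], sublevel sets involve only the state at time 0 and the occupation time.
    For the stopping-time property [u] is fixed, and splitting by the initial state makes the
    threshold a constant. *)
Lemma mixed_cut_strategy : mixed_stopping_time cut.
Proof.
split.
  apply: measurable_fun_ereal_le => t.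
  have mD : measurable ([set: Omega R] `*` (`[0, 1]%classic : set R)).
    exact: measurableX.
  have [t0|t0] := ltP t 0.
    rewrite (_ : _ `&` _ = set0); first exact: measurable0.
    apply/seteqP; split => // -[w u] [_ /=].
    by rewrite leNgt (lt_le_trans _ (cut_strategy_ge0 _ _))// lte_fin.
  have mg (g : 'I_2 -> R) :
      measurable_fun setT (fun wu : Omega R * R => g (X 0 wu.1)).
    exact: (measurable_fun_X g (t := fun=> 0)).
  rewrite (_ : _ `&` _ = ([set: Omega R] `*` (`[0, 1]%classic : set R)) `&`
    ((fun wu : Omega R * R => wu.2 < c (X 0 wu.1)) @^-1` [set true] `|`
     (if s <= t then (fun wu : Omega R * R => (wu.2 - c (X 0 wu.1)) * (1 - c (X 0 wu.1))^-1
       <= 1 - expR (- lam * occ wu.1 s t)) @^-1` [set true] else set0))); last first.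
    apply/seteqP; split => -[w u] [[wT u01] /=];
      have u01' : 0 <= u <= 1 by have := u01; rewrite /= in_itv.
      rewrite cut_strategy_le//.
      by move=> /orP[h|/andP[-> h]]; split => //; [left|right].
    move=> h; split => //=; rewrite cut_strategy_le//.
    by case: h => [->//|]; case: ifP => // _ /= ->; rewrite orbT.
  apply: measurableI => //; apply: measurableU.
    by rewrite -[X in measurable X]setTI; apply: measurable_fun_ltr => //; exact: (mg c).
  case: ifPn => [st|_]; last exact: measurable0.
  rewrite -[X in measurable X]setTI; apply: measurable_fun_ler => //.
    apply: (measurable_funM (f := fun wu : Omega R * R => wu.2 - c (X 0 wu.1))).
      by apply: measurable_funB => //; exact: (mg c).
    exact: (mg (fun i => (1 - c i)^-1)).
  apply: measurable_funB => //; apply: measurableT_comp => //.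
  apply: measurable_funM => //.
  exact: (measurableT_comp (measurable_occ s_ge0 st) measurable_fst).
move=> u u01; split=> [w|t t0]; first exact: cut_strategy_ge0.
have /andP[u0 u1] := u01.
have Fi i : filtX t [set w | X 0 w = i /\ (cut w u <= t%:E)%E].
  have [uc|cu] := ltP u (c i).
    rewrite (_ : [set _ | _] = [set w | X 0 w = i]); first exact: filtX_X.
    by apply/seteqP; split => [w []//|w /= wi]; rewrite /cut_strategy wi uc lee_fin.
  rewrite (_ : [set _ | _] = [set w | X 0 w = i] `&`
    [set w | (occupation_hitting s (threshold lam ((u - c i) / (1 - c i))) w <= t%:E)%E]).
    apply: (@measurableI _ (g_sigma_algebraType _)); first exact: filtX_X.
    by apply: filtX_hitting_threshold; have /andP[] := cut_param (c01 i) cu u1.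
  by apply/seteqP; split => [w /= []|w [/=]] wi; rewrite /cut_strategy wi ltNge cu.
rewrite (_ : [set _ | _] = [set w | X 0 w = 0 /\ (cut w u <= t%:E)%E] `|`
  [set w | X 0 w = 1 /\ (cut w u <= t%:E)%E]).
  by apply: (@measurableU _ (g_sigma_algebraType _)); exact: Fi.
apply/seteqP; split => [w /= h|w [[]|[]]//].
by have [?|?] := ord2P (X 0 w); [left|right].
Qed.

End cut_strategy.

(** * Strategies that agree on the parameter interval, and saddle points *)

Section congruence.
Context (R : realType) (r : R) (f h : 'I_2 -> R) (P : probability (Omega R) R).

Lemma mixed_stopping_time_congr (mu mu' : Omega R -> R -> \bar R) :
  (forall w u, 0 <= u <= 1 -> mu w u = mu' w u) ->
  mixed_stopping_time mu' -> mixed_stopping_time mu.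
Proof.
move=> E [mm st]; split.
  apply: eq_measurable_fun mm => -[w u]; rewrite inE => -[_ /=].
  by rewrite in_itv/= => u01; rewrite E.
move=> u u01; have [s0 sf] := st u u01; split=> [w|t t0]; first by rewrite E.
rewrite (_ : [set _ | _] = [set w | (mu' w u <= t%:E)%E]); first exact: sf.
by apply/seteqP; split => w /=; rewrite E.
Qed.

Lemma Gamma_congr (mu mu' : Omega R -> R -> \bar R) nu :
  (forall w u, 0 <= u <= 1 -> mu w u = mu' w u) ->
  Gamma r f h P mu nu = Gamma r f h P mu' nu.
Proof.
move=> E; apply: eq_integral => w _; apply: eq_integral => v _.
by apply: eq_integral => u; rewrite inE/= in_itv/= => u01; rewrite E.
Qed.

Lemma optimal1_congr (mu mu' : Omega R -> R -> \bar R) :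
  (forall w u, 0 <= u <= 1 -> mu w u = mu' w u) ->
  optimal1 r f h P mu' -> optimal1 r f h P mu.
Proof.
move=> E [mm V]; split; first exact: mixed_stopping_time_congr mm.
have gE : guarantee1 r f h P mu = guarantee1 r f h P mu'.
  have iE : [set Gamma r f h P mu nu | nu in @random_time R] =
      [set Gamma r f h P mu' nu | nu in @random_time R].
    apply: eq_imagel => nu _; exact: (Gamma_congr nu E).
  exact: (f_equal (@ereal_inf R) iE).
exact: (eq_ind_r (is_game_value r f h P) V gE).
Qed.

(** With one pair of strategies whose guarantees meet at [V], both the infimum and the supremum in
    [is_game_value] are squeezed to [V]. *)
Lemma optimal1_saddle (mu : Omega R -> R -> \bar R) (nu : R -> \bar R) (V : \bar R) :
  mixed_stopping_time mu -> random_time nu ->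
  (forall nu', random_time nu' -> (V <= Gamma r f h P mu nu')%E) ->
  (forall mu', mixed_stopping_time mu' -> (Gamma r f h P mu' nu <= V)%E) ->
  optimal1 r f h P mu.
Proof.
move=> mmu mnu lo up; split => //.
have g1V : guarantee1 r f h P mu = V.
  apply/eqP; rewrite eq_le; apply/andP; split.
    by apply: (le_trans _ (up _ mmu)); apply: ereal_inf_lbound; exists nu.
  by apply: le_ereal_inf_tmp => _ [nu' nu'r <-]; exact: lo.
have g2V : guarantee2 r f h P nu = V.
  apply/eqP; rewrite eq_le; apply/andP; split.
    by apply: ge_ereal_sup => _ [mu' mu'm <-]; exact: up.
  by apply: (le_trans (lo _ mnu)); apply: ereal_sup_ubound; exists mu.
rewrite g1V; split; apply/eqP; rewrite eq_le; apply/andP; split.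
- apply: le_ereal_inf_tmp => _ [nu' nu'r <-]; apply: (le_trans (lo _ nu'r)).
  by apply: ereal_sup_ubound; exists mu.
- by apply: ereal_inf_lbound; exists nu.
- by apply: ereal_sup_ubound; exists mu.
- apply: ge_ereal_sup => _ [mu' mu'm <-]; apply: (le_trans _ (up _ mu'm)).
  by apply: ereal_inf_lbound; exists nu.
Qed.

End congruence.

(** * Player 1's payoff along a fixed path *)

Lemma stop_payoff_ge0 (R : realType) (r : R) (f h : 'I_2 -> R) w m n :
  (forall i, 0 <= f i) -> (forall i, 0 <= h i) -> 0 <= stop_payoff r f h w m n.
Proof.
move=> f0 h0; rewrite /stop_payoff; case: ifP => _; first by rewrite mulr_ge0 ?expR_ge0.
by case: ifP => _//; rewrite mulr_ge0 ?expR_ge0.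
Qed.

(** A path in state 1 stays there for a while, so the occupation time at [z] is also attained at a
    rational time. Only countably many values can arise in this way. *)
Lemma occ_plateau (R : realType) (w : cadlag_path R) (z : R) :
  0 <= z -> X z w = 1 -> exists q : rat, z <= ratr q /\ occ w z (ratr q) = 0.
Proof.
move=> z0 Xz; have [/(_ _ z0) wz _ _] := svalP w.
have [e /= e0 we] : exists2 e : R, 0 < e & forall x, z < x -> x < z + e -> X x w = X z w.
  case: wz => e /= e0 we; exists e => // x zx xe; apply: we => //=.
  by rewrite ltr_distlC; lra.
have /rat_in_itvoo[q] : z < z + e by rewrite ltrDl.
rewrite in_itv/= => /andP[zq qe]; exists q; split; first exact: ltW.
rewrite /occ (_ : \int[_]_(x in _) _ = \int[lebesgue_measure]_(x in `[z, ratr q]) cst 0 x).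
  by rewrite Rintegral_cst// mul0r.
apply: eq_Rintegral => x; rewrite inE/= in_itv/= => /andP[zx xq].
rewrite /in0; move: zx; rewrite le_eqVlt => /predU1P[<-|zx]; first by rewrite Xz.
by rewrite we ?Xz// (le_lt_trans xq).
Qed.

Lemma affine_param_le (R : realType) (k u z : R) : k < 1 ->
  (u <= k + (1 - k) * z) = ((u - k) / (1 - k) <= z).
Proof.
by move=> k1; rewrite -lerBlDl mulrC -ler_pdivrMr ?subr_gt0.
Qed.

Section pathwise.
Context (R : realType) (r lam s : R) (f h c : 'I_2 -> R).
Hypotheses (r_gt0 : 0 < r) (lam_gt0 : 0 < lam) (s_ge0 : 0 <= s).
Hypotheses (f0 : forall i, 0 <= f i) (h0 : forall i, 0 <= h i).
Hypotheses (c01 : forall i, 0 <= c i <= 1) (c1 : c 1 = 0).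

Variables (w : Omega R) (m : R -> \bar R) (t : R) (N : nat).
Hypotheses (mm : measurable_fun setT m)
  (mE : forall u, 0 <= u <= 1 -> m u = cut_strategy lam s c w u).
Hypothesis st : s <= t.

Let cw := c (X 0 w).
Let grid k : R := s + k%:R * ((t - s) / N.+1%:R).
Let x k : R := expR (- lam * occ w s (grid k)).

Let d_ge0 : 0 <= (t - s) / N.+1%:R. Proof. by rewrite divr_ge0// subr_ge0. Qed.

Let s_grid k : s <= grid k. Proof. by rewrite lerDl mulr_ge0. Qed.

Let gridN : grid N.+1 = t. Proof. by rewrite /grid mulrC divfK ?pnatr_eq0// subrKC. Qed.

Let grid_nd k : grid k <= grid k.+1.
Proof. by rewrite lerD2l ler_wpM2r// ler_nat. Qed.

Let grid_t k : (k <= N.+1)%N -> grid k <= t.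
Proof. by move=> kN; rewrite -gridN lerD2l ler_wpM2r// ler_nat. Qed.

Let x_nd k : x k.+1 <= x k.
Proof. by rewrite ler_expR !mulNr lerN2 ler_pM2l// occ_nd. Qed.

Let x_gt0 k : 0 < x k. Proof. exact: expR_gt0. Qed.

Let x0 : x 0%N = 1. Proof. by rewrite /x /grid mul0r addr0 occ_ss mulr0 expR0. Qed.

Let cw01 : 0 <= cw <= 1. Proof. exact: c01. Qed.

Let cw_le1 (z : R) : z <= 1 -> cw + (1 - cw) * z <= 1.
Proof.
move=> z1; have /andP[_ w1] := cw01; rewrite -subr_ge0.
have -> : 1 - (cw + (1 - cw) * z) = (1 - cw) * (1 - z) by ring.
by rewrite mulr_ge0// subr_ge0.
Qed.

(** The interval of [u] is cut into [N.+3] cells: the atom up to [cw], the parameters that stop in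
    each of the [N.+1] grid cells, and those that survive [t]. Cells are closed on the right, as the
    inequality in [hitting_threshold_le] is weak. A stop inside a grid cell is discounted as if it
    came at the end of the cell, which gives a lower bound. *)
Let e (j : nat) : R :=
  if j is j'.+1 then (if (j' <= N.+1)%N then cw + (1 - cw) * (1 - x j') else 1) else 0.

Let coef (j : nat) : R :=
  if j is j'.+1 then
    (if (j' <= N)%N then h 0 * expR (- r * grid j'.+1) else expR (- r * t) * f (X t w))
  else h 0.

Let e_nd : nondecreasing_seq e.
Proof.
have /andP[w0 w1] := cw01; apply/nondecreasing_seqP => -[|j] /=.
  by rewrite x0 subrr mulr0 addr0.
have xj := x_gt0 j; have xj' := x_nd j.
case: (ltnP j N.+1) => jN.
  have jN' : (j <= N)%N := jN.
  rewrite ?jN ?jN' ?(ltnW jN) lerD2l; apply: ler_wpM2l; first by rewrite subr_ge0.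
  by rewrite lerD2l lerN2.
by case: ifP => // _; rewrite cw_le1// gerBl ltW.
Qed.

Let int_step : \int[lebesgue_measure]_(u in `[0%R, 1%R]) step false e coef N.+3 u =
  cw * h 0 + (1 - cw) * (\sum_(k < N.+1) h 0 * expR (- r * grid k.+1) * (x k - x k.+1)
    + expR (- r * t) * f (X t w) * x N.+1).
Proof.
have /andP[w0 w1] := cw01.
have e01 j : 0 <= e j <= 1.
  case: j => [|j] /=; first by rewrite lexx ler01.
  have xj := x_gt0 j; have xj1 : x j <= 1.
    by elim: (j) => [|i ih]; [rewrite x0|exact: le_trans (x_nd i) ih].
  case: ifP => _; last by rewrite ler01 lexx.
  by rewrite cw_le1 ?gerBl ?(ltW xj)// addr_ge0// mulr_ge0// subr_ge0.
rewrite Rintegral_step//; last 2 first.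
- exact: itv_lebesgue_fin.
- move=> k _ u /cellP[/= uk uk']; rewrite in_itv/=.
  have /andP[ek _] := e01 k; have /andP[_ ek'] := e01 k.+1.
  by rewrite (le_trans ek (ltW uk)) (le_trans uk' ek').
rewrite big_ord_recl big_ord_recr/= /bump/= !add1n ltnn leqnn x0 subrr mulr0 addr0 subr0.
rewrite [h 0 * _]mulrC; congr (_ + _).
rewrite [RHS]mulrDr; congr (_ + _); last by rewrite add0n ltnn; ring.
rewrite mulr_sumr; apply: eq_bigr => k _ /=.
have kN := ltn_ord k; rewrite add0n add1n -ltnS kN (ltnW kN).
have key (A B C D : R) : A * (D + (1 - D) * (1 - B) - (D + (1 - D) * (1 - C))) =
  (1 - D) * (A * (C - B)) by ring.
exact: key.
Qed.

(* Player 1 can stop in state 1 only if the threshold is a value taken by the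
   occupation time on a plateau, hence at some rational time. *)
Let bad : set R := range (fun o : option rat =>
  if o is Some q then cw + (1 - cw) * (1 - expR (- lam * occ w s (ratr q))) else cw).

Let bad0 : lebesgue_measure.-negligible bad.
Proof.
have cb : countable bad := sub_countable (card_image_le _ _) (countableP _).
exists bad; split => //; first exact: countable_measurable.
exact: countable_lebesgue_measure0.
Qed.

Let step_le u : 0 <= u <= 1 -> ~ bad u ->
  step false e coef N.+3 u <= stop_payoff r f h w (m u) t%:E.
Proof.
move=> u01 nbad; have /andP[u0 u1] := u01; have /andP[w0 w1] := cw01.
have t0 : 0 <= t by exact: le_trans st.
case: (stepP false coef e_nd N.+3 u) => [|[_ ->]]; last exact: stop_payoff_ge0.
move=> [[|j] [jN /cellP[/= eu ue] ->]].
  move: ue; rewrite x0 subrr mulr0 addr0 => uc.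
  have {}uc : u < cw.
    (* The atom excludes [u = cw] while the cell contains it; this point is the value of [bad] at
       [None]. *)
    by rewrite lt_neqAle uc andbT; apply/eqP => uE; apply: nbad; exists None.
  have Xw : X 0 w = 0.
    have [//|X1] := ord2P (X 0 w); move: uc; rewrite /cw X1 c1 => uc.
    by have := lt_trans eu uc; rewrite ltxx.
  rewrite mE// /cut_strategy -/cw uc /stop_payoff lte_fin ltNge t0/=.
  by rewrite ltry mulr0 expR0 mul1r Xw.
have jN1 : (j <= N.+1)%N by [].
move: eu; rewrite jN1 => eu.
have xj1 : x j <= 1.
  by elim: (j) => [|i ih]; [rewrite x0|exact: le_trans (x_nd i) ih].
have cu : cw < u.
  by apply: le_lt_trans eu; rewrite lerDl mulr_ge0// subr_ge0.
have cw1 : cw < 1 by exact: lt_le_trans cu u1.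
pose v := (u - cw) / (1 - cw).
have /andP[v0 v1] : 0 <= v <= 1 by apply: cut_param => //; exact: ltW.
have muE : m u = occupation_hitting s (threshold lam v) w.
  by rewrite mE// /cut_strategy -/cw ltNge (ltW cu).
move: jN1; rewrite leq_eqVlt => /predU1P[jE|jN1].
  have mt : (t%:E < m u)%E.
    rewrite muE ltNge hitting_threshold_le// /v -affine_param_le// -ltNge.
    by move: eu; rewrite jE /x gridN.
  by rewrite jE ltnn /stop_payoff mt.
have jN1' : (j <= N)%N := jN1.
move: ue; rewrite ?jN1 ?jN1' affine_param_le// => vx.
have mg : (m u <= (grid j.+1)%:E)%E by rewrite muE hitting_threshold_le.
have mt : (m u <= t%:E)%E by apply: (le_trans mg); rewrite lee_fin grid_t.
rewrite ?jN1 ?jN1' /stop_payoff ltNge mt/=.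
have ms : (s%:E <= m u)%E by rewrite muE occupation_hitting_ge.
move: mg mt ms; case mz : (m u) => [z| |] //; rewrite !lee_fin => zg zt sz.
rewrite ltry/=.
have v_lt1 : v < 1.
  by apply: (le_lt_trans vx); rewrite ltrBlDr ltrDl x_gt0.
have y0 : 0 <= - ln (1 - v) / lam.
  rewrite divr_ge0 ?(ltW lam_gt0)// oppr_ge0 ln_le0//.
  by rewrite lerBlDr lerDl.
have occz : occ w s z = - ln (1 - v) / lam.
  by apply: occ_occupation_hitting => //; rewrite -thresholdE// -muE.
have -> : X z w = 0.
  have [//|X1] := ord2P (X z w); exfalso; apply: nbad.
  have [q [zq occq]] := occ_plateau (le_trans s_ge0 sz) X1.
  exists (Some q) => //; rewrite (occ_split _ sz zq) occq addr0 occz.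
  rewrite !mulNr mulrN opprK [lam * _]mulrC divfK ?gt_eqF// lnK ?posrE ?subr_gt0//.
  by rewrite subKr /v mulrC divfK ?gt_eqF ?subr_gt0// subrKC.
by rewrite mulrC ler_wpM2r// ler_expR !mulNr lerN2 ler_pM2l.
Qed.

Lemma pathwise_lower_bound :
  ((cw * h 0 + (1 - cw) * (\sum_(k < N.+1) h 0 * expR (- r * grid k.+1) * (x k - x k.+1)
    + expR (- r * t) * f (X t w) * x N.+1))%:E <=
  \int[lebesgue_measure]_(u in `[0%R, 1%R]) (stop_payoff r f h w (m u) t%:E)%:E)%E.
Proof.
rewrite -int_step -(@bmfun_integralE _ _ _ lebesgue_measure); last 3 first.
- exact: measurable_itv.
- exact: itv_lebesgue_fin.
- exact: bmfun_step.
apply: ae_ge0_le_integral => //.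
- move=> u _; rewrite lee_fin; case: (stepP false coef e_nd N.+3 u) => [[j [_ _ ->]]|[_ ->]//].
  case: j => [|j] /=; first exact: h0.
  by case: ifP => _; rewrite mulr_ge0 ?expR_ge0.
- by apply/measurable_EFinP; have [] := @bmfun_step R false e coef `[0, 1]%classic N.+3.
- by move=> u _; rewrite lee_fin stop_payoff_ge0.
- apply/measurable_EFinP; apply: (@measurable_funS _ _ _ _ setT) => //.
  exact: (measurable_stop_payoff r f h (w := fun=> w) (n := fun=> t%:E)).
- have [B [mB B0 bB]] := bad0; exists B; split => //.
  move=> u /= nu; apply: bB; apply: contrapT => nbad; apply: nu => u01.
  by rewrite lee_fin step_le//; move: u01; rewrite /= in_itv.
Qed.

End pathwise.

(** * Reduction to deterministic opponents *)

Section swap.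
Context (R : realType) (r : R) (f h : 'I_2 -> R) (P : probability (Omega R) R).
Hypotheses (f0 : forall i, 0 <= f i) (h0 : forall i, 0 <= h i).

Let I01 : set R := `[0, 1]%classic.

Let mI01 : measurable I01. Proof. exact: measurable_itv. Qed.

Lemma lebesgue_measure01 : lebesgue_measure I01 = 1%E.
Proof. by rewrite /I01 lebesgue_measure_itv/= lte_fin ltr01 oppr0 adde0. Qed.

(** Values outside the parameter interval are unconstrained; they are replaced by 0 so that
    Tonelli's theorem meets a globally measurable function. *)
Lemma mixed_extension (mu : Omega R -> R -> \bar R) : mixed_stopping_time mu ->
  exists2 mu' : Omega R -> R -> \bar R, measurable_fun setT (fun wu : Omega R * R => mu' wu.1 wu.2) &
  forall w u, 0 <= u <= 1 -> mu' w u = mu w u.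
Proof.
move=> [mm _]; pose D := [set: Omega R] `*` I01.
exists (fun w u => ((fun wu : Omega R * R => mu wu.1 wu.2) \_ D) (w, u)).
  have : measurable_fun setT ((fun wu : Omega R * R => mu wu.1 wu.2) \_ D).
    by apply/(measurable_restrictT _ _).1 => //; exact: measurableX.
  by apply: eq_measurable_fun => -[].
by move=> w u u01; rewrite patchE mem_set//; split => //=; rewrite in_itv.
Qed.

Lemma random_extension (nu : R -> \bar R) : random_time nu ->
  exists2 nu' : R -> \bar R, measurable_fun setT nu' & forall v, 0 <= v <= 1 -> nu' v = nu v.
Proof.
move=> [mn _]; exists (nu \_ I01); first exact/(measurable_restrictT _ _).1.
by move=> v v01; rewrite patchE mem_set// /I01/= in_itv.
Qed.

Let pay (mu : Omega R -> R -> \bar R) nu (x : Omega R * R * R) : \bar R :=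
  (stop_payoff r f h x.1.1 (mu x.1.1 x.1.2) (nu x.2))%:E.

Let mpay mu nu : measurable_fun setT (fun wu : Omega R * R => mu wu.1 wu.2) ->
  measurable_fun setT nu -> measurable_fun setT (pay mu nu).
Proof.
move=> mm mn; apply/measurable_EFinP; apply: measurable_stop_payoff.
- exact: (measurableT_comp measurable_fst measurable_fst).
- exact: (measurableT_comp mm measurable_fst).
- exact: (measurableT_comp mn measurable_snd).
Qed.

Let pay_ge0 mu nu x : (0 <= pay mu nu x)%E.
Proof. by rewrite lee_fin stop_payoff_ge0. Qed.

Let mpay_u mu nu : measurable_fun setT (fun wu : Omega R * R => mu wu.1 wu.2) ->
  measurable_fun setT nu ->
  measurable_fun setT (fun wv : Omega R * R =>
    \int[lebesgue_measure]_(u in I01) pay mu nu (wv.1, u, wv.2))%E.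
Proof.
move=> mm mn; apply: (@measurable_integral_dom _ _ _ _ _ lebesgue_measure setT I01
  (fun x : Omega R * R * R => pay mu nu (x.1.1, x.2, x.1.2))) => //.
apply: (@measurable_funS _ _ _ _ setT) => //.
apply: (measurableT_comp (mpay mm mn)).
apply: measurable_fun_pair; last exact: (measurableT_comp measurable_snd measurable_fst).
by apply: measurable_fun_pair => //; exact: (measurableT_comp measurable_fst measurable_fst).
Qed.

Let mpay_v mu nu : measurable_fun setT (fun wu : Omega R * R => mu wu.1 wu.2) ->
  measurable_fun setT nu ->
  measurable_fun setT (fun wu : Omega R * R =>
    \int[lebesgue_measure]_(v in I01) pay mu nu (wu, v))%E.
Proof.
move=> mm mn.
apply: (@measurable_integral_dom _ _ _ _ _ lebesgue_measure setT I01 (pay mu nu)) => //.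
by apply: (@measurable_funS _ _ _ _ setT) => //; exact: mpay.
Qed.

Lemma measurable_payoff_u mu n : mixed_stopping_time mu ->
  measurable_fun setT (fun w : Omega R =>
    \int[lebesgue_measure]_(u in `[0%R, 1%R]) (stop_payoff r f h w (mu w u) n)%:E)%E.
Proof.
move=> /mixed_extension[mu' mm E].
have : measurable_fun setT (fun w : Omega R =>
    \int[lebesgue_measure]_(u in I01) (stop_payoff r f h w (mu' w u) n)%:E)%E.
  apply: (@measurable_integral_dom _ _ _ _ _ lebesgue_measure setT I01
    (fun x : Omega R * R => (stop_payoff r f h x.1 (mu' x.1 x.2) n)%:E)) => //.
    apply: (@measurable_funS _ _ _ _ setT) => //; apply/measurable_EFinP.
    exact: (measurable_stop_payoff r f h measurable_fst mm (measurable_cst n)).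
  by move=> x; rewrite lee_fin stop_payoff_ge0.
apply: eq_measurable_fun => w _ /=; apply: eq_integral => u.
by rewrite inE /I01/= in_itv/= => u01; rewrite E.
Qed.

Let Gamma_swap_wv mu nu : measurable_fun setT (fun wu : Omega R * R => mu wu.1 wu.2) ->
  measurable_fun setT nu ->
  Gamma r f h P mu nu = (\int[lebesgue_measure]_(v in I01) \int[P]_w
    \int[lebesgue_measure]_(u in I01) (stop_payoff r f h w (mu w u) (nu v))%:E)%E.
Proof.
move=> mm mn.
apply: (@tonelli_dom _ _ _ _ _ P lebesgue_measure setT I01 (fun wv : Omega R * R =>
  \int[lebesgue_measure]_(u in I01) (stop_payoff r f h wv.1 (mu wv.1 u) (nu wv.2))%:E)%E) => //.
- by apply: (@measurable_funS _ _ _ _ setT) => //; exact: mpay_u.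
- by move=> x; apply: integral_ge0 => u _; rewrite lee_fin stop_payoff_ge0.
Qed.

Let Gamma_swap_wu mu nu : measurable_fun setT (fun wu : Omega R * R => mu wu.1 wu.2) ->
  measurable_fun setT nu ->
  Gamma r f h P mu nu = (\int[lebesgue_measure]_(u in I01) \int[P]_w
    \int[lebesgue_measure]_(v in I01) (stop_payoff r f h w (mu w u) (nu v))%:E)%E.
Proof.
move=> mm mn.
transitivity (\int[P]_w \int[lebesgue_measure]_(u in I01)
    \int[lebesgue_measure]_(v in I01) (stop_payoff r f h w (mu w u) (nu v))%:E)%E.
  apply: eq_integral => w _.
  apply: (@tonelli_dom _ _ _ _ _ lebesgue_measure lebesgue_measure I01 I01
    (fun vu : R * R => (stop_payoff r f h w (mu w vu.2) (nu vu.1))%:E)%E) => //.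
    apply: (@measurable_funS _ _ _ _ setT) => //.
    apply/measurable_EFinP; apply: measurable_stop_payoff => //.
      apply: (measurableT_comp mm (f := fun x : Omega R * R => mu x.1 x.2) (g := fun vu : R * R => (w, vu.2))).
      by apply: measurable_fun_pair.
    exact: (measurableT_comp mn measurable_fst).
  by move=> x; rewrite lee_fin stop_payoff_ge0.
apply: (@tonelli_dom _ _ _ _ _ P lebesgue_measure setT I01 (fun wu : Omega R * R =>
  \int[lebesgue_measure]_(v in I01) (stop_payoff r f h wu.1 (mu wu.1 wu.2) (nu v))%:E)%E) => //.
- by apply: (@measurable_funS _ _ _ _ setT) => //; exact: mpay_v.
- by move=> x; apply: integral_ge0 => u _; rewrite lee_fin stop_payoff_ge0.
Qed.

Let Gamma_eq mu mu' nu nu' : (forall w u, 0 <= u <= 1 -> mu' w u = mu w u) ->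
  (forall v, 0 <= v <= 1 -> nu' v = nu v) ->
  Gamma r f h P mu nu = Gamma r f h P mu' nu'.
Proof.
move=> E E'; apply: eq_integral => w _; apply: eq_integral => v.
rewrite inE /I01/= in_itv/= => v01; apply: eq_integral => u.
by rewrite inE /I01/= in_itv/= => u01; rewrite E// E'.
Qed.

Let integral01_cst (V : \bar R) : (0 <= V)%E ->
  (\int[lebesgue_measure]_(v in I01) cst V v)%E = V.
Proof.
by move=> V0; rewrite integral_cst// [X in (_ * X)%E]lebesgue_measure01 mule1.
Qed.

(** After Tonelli's theorem the integral over [v] comes last, and a random time is an average of
    deterministic times [n], possibly infinite. *)
Lemma player1_guarantee mu (V : \bar R) : mixed_stopping_time mu -> (0 <= V)%E ->
  (forall n : \bar R, (0 <= n)%E -> (V <= \int[P]_w \int[lebesgue_measure]_(u in I01)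
     (stop_payoff r f h w (mu w u) n)%:E)%E) ->
  forall nu, random_time nu -> (V <= Gamma r f h P mu nu)%E.
Proof.
move=> mixm V0 VP nu rnu.
have [mu' mm E] := mixed_extension mixm; have [nu' mn E'] := random_extension rnu.
rewrite (Gamma_eq E E') Gamma_swap_wv// -[leLHS]integral01_cst//.
apply: ge0_le_integral => //.
- apply: (@measurable_integral_dom _ _ _ _ _ P I01 setT (fun vw : R * Omega R =>
    \int[lebesgue_measure]_(u in I01) (stop_payoff r f h vw.2 (mu' vw.2 u) (nu' vw.1))%:E)%E) => //.
    apply: (@measurable_funS _ _ _ _ setT) => //.
    exact: (measurableT_comp (mpay_u mm mn)
      (measurable_fun_pair measurable_snd measurable_fst)).
  by move=> x; apply: integral_ge0 => u _; rewrite lee_fin stop_payoff_ge0.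
- move=> v; rewrite /I01/= in_itv/= => v01; rewrite E'//.
  have [_ nu0] := rnu; apply: (le_trans (VP _ (nu0 _ v01))).
  rewrite le_eqVlt; apply/orP; left; apply/eqP; apply: eq_integral => w _.
  by apply: eq_integral => u; rewrite inE /I01/= in_itv/= => u01; rewrite E.
Qed.

(** After Tonelli's theorem the integral over [u] comes last, and each section [mu ^~ u] is a pure
    stopping time. *)
Lemma player2_guarantee nu (V : \bar R) : random_time nu -> (0 <= V)%E ->
  (forall tau : Omega R -> \bar R, stopping_time tau -> measurable_fun setT tau ->
   (\int[P]_w \int[lebesgue_measure]_(v in I01) (stop_payoff r f h w (tau w) (nu v))%:E <= V)%E) ->
  forall mu, mixed_stopping_time mu -> (Gamma r f h P mu nu <= V)%E.
Proof.
move=> rnu V0 VP mu mixm.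
have [mu' mm E] := mixed_extension mixm; have [nu' mn E'] := random_extension rnu.
rewrite (Gamma_eq E E') Gamma_swap_wu// -[leRHS]integral01_cst//.
apply: ge0_le_integral => //.
- by move=> v _; do 2 (apply: integral_ge0 => ? _); rewrite lee_fin stop_payoff_ge0.
- apply: (@measurable_integral_dom _ _ _ _ _ P I01 setT (fun uw : R * Omega R =>
    \int[lebesgue_measure]_(v in I01) (stop_payoff r f h uw.2 (mu' uw.2 uw.1) (nu' v))%:E)%E) => //.
    apply: (@measurable_funS _ _ _ _ setT) => //.
    exact: (measurableT_comp (mpay_v mm mn)
      (measurable_fun_pair measurable_snd measurable_fst)).
  by move=> x; apply: integral_ge0 => u _; rewrite lee_fin stop_payoff_ge0.
- move=> u; rewrite /I01/= in_itv/= => u01.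
  have [_ /(_ u u01) st] := mixm.
  have mtau : measurable_fun setT (mu ^~ u).
    have mp : measurable_fun setT (fun w : Omega R => (w, u)) by exact: measurable_fun_pair.
    have := measurableT_comp mm mp.
    by apply: eq_measurable_fun => w _ /=; rewrite E.
  apply: le_trans (VP _ st mtau).
  rewrite le_eqVlt; apply/orP; left; apply/eqP; apply: eq_integral => w _.
  by apply: eq_integral => v; rewrite inE /I01/= in_itv/= => v01; rewrite E// E'.
Qed.

End swap.

(* In each cell, [r (1 - e^(-k d)) >= r k d e^(-k d) >= k e^(-k d) (1 - e^(-r d))]. *)
Lemma discounted_sum_lower (R : realType) (r k d : R) n : 0 < r -> 0 < k -> 0 <= d ->
  expR (- r * d) * (k / (r + k)) * (1 - expR (- (r + k) * (n%:R * d))) <=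
  \sum_(i < n) expR (- r * (i.+1%:R * d)) *
    (expR (- k * (i%:R * d)) - expR (- k * (i.+1%:R * d))).
Proof.
move=> r0 k0 d0; have rk0 : 0 < r + k by rewrite addr_gt0.
have cell : k / (r + k) * (1 - expR (- (r + k) * d)) <= 1 - expR (- k * d).
  rewrite mulrAC ler_pdivrMr//.
  have er : 1 - r * d <= expR (- r * d).
    by have := expR_ge1Dx (- r * d); rewrite mulNr.
  have ek : k * d * expR (- k * d) <= 1 - expR (- k * d).
    have := expR_ge1Dx (k * d); rewrite -(ler_pM2r (expR_gt0 (- k * d))).
    by rewrite -expRD mulNr subrr expR0 mulrDl mul1r; lra.
  have -> : expR (- (r + k) * d) = expR (- r * d) * expR (- k * d).
    by rewrite -expRD; congr expR; ring.
  have ep := expR_gt0 (- k * d).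
  set E := expR (- k * d) in ek ep *; set G := expR (- r * d) in er *.
  have h1 : k * E * (1 - G) <= k * E * (r * d).
    by apply: ler_wpM2l; [rewrite mulr_ge0// ltW|lra].
  have h2 : r * (k * d * E) <= r * (1 - E) by rewrite ler_pM2l.
  lra.
elim: n => [|n ih].
  by rewrite big_ord0 mul0r mulr0 expR0 subrr mulr0.
rewrite big_ord_recr/=; apply: le_trans (lerD ih (lexx _)).
have eN : - r * (n.+1%:R * d) = - r * d + - r * (n%:R * d) by rewrite -natr1; ring.
have eK : - k * (n.+1%:R * d) = - k * d + - k * (n%:R * d) by rewrite -natr1; ring.
have eRK : - (r + k) * (n.+1%:R * d) =
    - (r + k) * d + (- r * (n%:R * d) + - k * (n%:R * d)) by rewrite -natr1; ring.
have eRK' : - (r + k) * (n%:R * d) = - r * (n%:R * d) + - k * (n%:R * d) by ring.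
rewrite eN eK eRK eRK' !expRD.
set A := expR (- r * (n%:R * d)); set B := expR (- k * (n%:R * d)).
have A0 : 0 < A by exact: expR_gt0.
have B0 : 0 < B by exact: expR_gt0.
set G := expR (- r * d); have G0 : 0 < G by exact: expR_gt0.
move: cell; set th := k / (r + k); set Q := expR (- (r + k) * d); set E := expR (- k * d) => cell.
have := ler_wpM2l (ltW (mulr_gt0 G0 (mulr_gt0 A0 B0))) cell.
clearbody A B G th Q E; lra.
Qed.

(** * What player 1 guarantees against stops after the clock has started *)

Section player1_bound.
Context (R : realType) (a b r p p0 lam s k0 : R) (P : probability (Omega R) R)
  (f h c g : 'I_2 -> R).
Hypotheses (ha : 0 < a) (hb : 0 < b) (r_gt0 : 0 < r).
Hypothesis Plaw : is_chain_law (generator a b) p P.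
Hypotheses (p0_gt0 : 0 < p0) (p0_lt1 : p0 < 1) (lam_gt0 : 0 < lam).
Hypothesis lamE : b - (a + b) * p0 = lam * (p0 * (1 - p0)).
Hypotheses (f0 : forall i, 0 <= f i) (h0 : forall i, 0 <= h i).
Hypotheses (c01 : forall i, 0 <= c i <= 1) (c1 : c 1 = 0).
Hypotheses (s_ge0 : 0 <= s) (k0_ge0 : 0 <= k0).
Hypothesis cg : forall w : Omega R, 1 - c (X 0 w) = g (X s w).
Hypothesis init : forall i, g i * fine (P [set w | X s w = i]) = k0 * two_point p0 i.
(* The indifference condition of player 2 at the belief [p0]. *)
Hypothesis FE : (r + lam * p0) * lin f p0 = lam * p0 * h 0.

Let PT : (P setT < +oo)%E. Proof. by rewrite ltey_eq fin_num_measure. Qed.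

Let bocc t : s <= t -> bmfun [set: Omega R] (fun w => expR (- lam * occ w s t)).
Proof.
by move=> st; have [] := feynman_kac ha hb Plaw p0_gt0 p0_lt1 lam_gt0 lamE 0 s_ge0 st init.
Qed.

Let integral_occ_f (F : 'I_2 -> R) t : s <= t ->
  \int[P]_w (g (X s w) * (expR (- lam * occ w s t) * F (X t w))) =
  k0 * (expR (- (lam * p0) * (t - s)) * lin F p0).
Proof.
move=> st; have t0 : 0 <= t := le_trans s_ge0 st.
have bb j : bmfun [set: Omega R] (fun w => g (X s w) *
    (expR (- lam * occ w s t) * (X t w == j)%:R)).
  apply: bmfunM; first exact: bmfun_X.
  by apply: bmfunM; [exact: bocc|exact: (bmfun_X (fun i => (i == j)%:R))].
transitivity (\int[P]_w (F 0 * (g (X s w) * (expR (- lam * occ w s t) * (X t w == 0)%:R))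
  + F 1 * (g (X s w) * (expR (- lam * occ w s t) * (X t w == 1)%:R)))).
  apply: eq_Rintegral => w _.
  by case: (ord2P (X t w)) => -> /=; ring.
rewrite (bmfun_RintegralD measurableT PT); [|exact: bmfunZ (bb _)..].
rewrite (bmfun_RintegralZ measurableT PT _ (bb 0)) (bmfun_RintegralZ measurableT PT _ (bb 1)).
have [_ ->] := feynman_kac ha hb Plaw p0_gt0 p0_lt1 lam_gt0 lamE 0 s_ge0 st init.
have [_ ->] := feynman_kac ha hb Plaw p0_gt0 p0_lt1 lam_gt0 lamE 1 s_ge0 st init.
by rewrite /two_point/= /lin; ring.
Qed.

Let integral_occ t : s <= t ->
  \int[P]_w (g (X s w) * expR (- lam * occ w s t)) =
  k0 * expR (- (lam * p0) * (t - s)).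
Proof.
move=> st; have := integral_occ_f (fun=> 1) st.
have -> : lin (fun=> 1 : R) p0 = 1 by rewrite /lin; ring.
by rewrite mulr1 => <-; apply: eq_Rintegral => w _; rewrite mulr1.
Qed.

Let integral_g : \int[P]_w (g (X s w)) = k0.
Proof.
have := integral_occ (lexx s); rewrite subrr mulr0 expR0 mulr1 => <-.
by apply: eq_Rintegral => w _; rewrite occ_ss mulr0 expR0 mulr1.
Qed.

(** The mass [1 - k0] stops at time 0 in state 0. The rest has the law [two_point p0] at time [s],
    and keeps it conditionally on survival, so it stops at the constant rate [lam * p0] and earns
    [h 0]. By [FE] the resulting amount does not depend on [t]. *)
Lemma cut_strategy_finite_guarantee (t : R) : s <= t ->
  (((1 - k0) * h 0 + k0 * expR (- r * s) * lin f p0)%:E <=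
  \int[P]_w \int[lebesgue_measure]_(u in `[0%R, 1%R])
    (stop_payoff r f h w (cut_strategy lam s c w u) t%:E)%:E)%E.
Proof.
move=> st; have t0 : 0 <= t := le_trans s_ge0 st.
have mixc := mixed_cut_strategy lam_gt0 s_ge0 c01.
have [m mm mE] := mixed_extension mixc.
have muw w : measurable_fun setT (m w).
  have mp : measurable_fun setT (fun u : R => ((w : Omega R), u)) by exact: measurable_fun_pair.
  exact: (measurableT_comp mm mp).
set Z := (\int[P]_w _)%E.
pose d N := (t - s) / N.+1%:R; pose gr N k := s + k%:R * d N.
have d0 N : 0 <= d N by rewrite divr_ge0// subr_ge0.
have sgr N k : s <= gr N k by rewrite lerDl mulr_ge0.
pose x N k (w : Omega R) := expR (- lam * occ w s (gr N k)).
have bx N k : bmfun [set: Omega R] (x N k) by exact: bocc.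
have bg : bmfun [set: Omega R] (fun w => g (X s w)) by exact: bmfun_X.
have bf : bmfun [set: Omega R] (fun w => f (X t w)) by exact: bmfun_X.
have grN N : gr N N.+1 = t by rewrite /gr /d mulrC divfK ?pnatr_eq0// subrKC.
pose T1 N k (w : Omega R) := h 0 * expR (- r * gr N k.+1) *
  (g (X s w) * x N k w + -1 * (g (X s w) * x N k.+1 w)).
have bT1 N k : bmfun [set: Omega R] (T1 N k).
  by apply: bmfunZ; apply: bmfunD; [|apply: bmfunZ]; apply: bmfunM.
pose T2 (w : Omega R) := expR (- r * t) * (g (X s w) * (expR (- lam * occ w s t) * f (X t w))).
have bT2 : bmfun [set: Omega R] T2.
  by apply: bmfunZ; apply: bmfunM => //; apply: bmfunM => //; exact: bocc.
pose T0 (w : Omega R) := h 0 + - h 0 * g (X s w).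
have bT0 : bmfun [set: Omega R] T0 by apply: bmfunD; [exact: bmfun_cst|exact: bmfunZ].
(* The bound of [pathwise_lower_bound], split into terms whose expectations [feynman_kac] gives. *)
pose T N (w : Omega R) := T0 w + (\sum_(k < N.+1) T1 N k w + T2 w).
have bS N : bmfun [set: Omega R] (fun w => \sum_(k < N.+1) T1 N k w).
  by apply: (@bmfun_sum _ _ _ _ N.+1 (T1 N)).
have bT N : bmfun [set: Omega R] (T N).
  by apply: bmfunD => //; exact: bmfunD.
have TZ N : ((\int[P]_w T N w)%R%:E <= Z)%E.
  rewrite -(bmfun_integralE measurableT PT (bT N)).
  have TE w : T N w = c (X 0 w) * h 0 + (1 - c (X 0 w)) *
      (\sum_(k < N.+1) h 0 * expR (- r * gr N k.+1) * (x N k w - x N k.+1 w)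
       + expR (- r * t) * f (X t w) * x N N.+1 w).
    have cE : c (X 0 w) = 1 - g (X s w) by rewrite -cg; ring.
    rewrite /T /T0 cE subKr mulrDr; congr (_ + (_ + _)).
    - ring.
    - by rewrite mulr_sumr; apply: eq_bigr => k _; rewrite /T1 mulN1r -mulrBr mulrCA.
    - by rewrite /T2 /x grN; ring.
  apply: ge0_le_integral => //.
  - move=> w _; rewrite lee_fin TE; have /andP[w0 w1] := c01 (X 0 w).
    rewrite addr_ge0 ?mulr_ge0 ?subr_ge0// addr_ge0//; last first.
      by rewrite !mulr_ge0 ?expR_ge0.
    apply: sumr_ge0 => k _; rewrite !mulr_ge0 ?expR_ge0// subr_ge0 ler_expR.
    rewrite !mulNr lerN2 ler_pM2l// occ_nd//.
    by rewrite lerD2l ler_wpM2r// ler_nat.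
  - by apply/measurable_EFinP; have [] := bT N.
  - exact: measurable_payoff_u.
  - move=> w _; rewrite TE.
    have := pathwise_lower_bound r_gt0 lam_gt0 s_ge0 f0 h0 c01 c1 N (muw w) (mE w) st.
    move=> /le_trans; apply; rewrite le_eqVlt; apply/orP; left; apply/eqP.
    by apply: eq_integral => u; rewrite inE/= in_itv/= => u01; rewrite mE.
have int_T N : \int[P]_w T N w = (1 - k0) * h 0 +
    (\sum_(k < N.+1) h 0 * expR (- r * gr N k.+1) *
      (k0 * expR (- (lam * p0) * (k%:R * d N)) - k0 * expR (- (lam * p0) * (k.+1%:R * d N)))
    + expR (- r * t) * (k0 * (expR (- (lam * p0) * (t - s)) * lin f p0))).
  rewrite /T (bmfun_RintegralD measurableT PT bT0); last exact: bmfunD.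
  rewrite (bmfun_RintegralD measurableT PT (bS N) bT2).
  rewrite (bmfun_Rintegral_sum measurableT PT (F := T1 N))// -/T2.
  congr (_ + (_ + _)).
  - rewrite /T0 (bmfun_RintegralD measurableT PT); [|exact: bmfun_cst|exact: bmfunZ].
    rewrite (bmfun_RintegralZ measurableT PT)// integral_g Rintegral_cst//.
    by rewrite [X in _ * fine X]probability_setT/=; ring.
  - apply: eq_bigr => k _; rewrite /T1.
    have bgx j : bmfun [set: Omega R] (fun w => g (X s w) * x N j w) by exact: bmfunM.
    rewrite (bmfun_RintegralZ measurableT PT); last first.
      by apply: bmfunD => //; exact: bmfunZ.
    rewrite (bmfun_RintegralD measurableT PT (bgx k) (bmfunZ _ (bgx k.+1))).
    have Ix j : \int[P]_w (g (X s w) * x N j w) =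
      k0 * expR (- (lam * p0) * (gr N j - s)) := integral_occ (sgr N j).
    rewrite (bmfun_RintegralZ measurableT PT _ (bgx k.+1)) !Ix mulN1r.
    by rewrite /gr !(addrC s) !addrK.
  - by rewrite /T2 (bmfun_RintegralZ measurableT PT) ?integral_occ_f//;
      apply: bmfunM => //; apply: bmfunM => //; exact: bocc.
pose E := expR (- (r + lam * p0) * (t - s)).
pose V := k0 * expR (- r * s) * lin f p0.
(* The factor [expR (- r * d N)] is the loss caused by discounting at the end of each cell; it tends
   to 1. *)
have low N : (1 - k0) * h 0 + V * (expR (- r * d N) * (1 - E) + E) <= \int[P]_w T N w.
  rewrite int_T lerD2l mulrDr; apply: lerD; last first.
    rewrite le_eqVlt; apply/orP; left; apply/eqP; rewrite /V /E.
    have -> : - r * t = - r * s + - r * (t - s) by ring.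
    have -> : - (r + lam * p0) * (t - s) = - r * (t - s) + - (lam * p0) * (t - s) by ring.
    by rewrite !expRD; ring.
  have kap0 : 0 < lam * p0 by rewrite mulr_gt0.
  have rk0 : r + lam * p0 != 0 by rewrite gt_eqF// addr_gt0.
  have HE : lin f p0 = lam * p0 / (r + lam * p0) * h 0.
    by apply: (mulfI rk0); rewrite FE; field.
  have := discounted_sum_lower N.+1 r_gt0 kap0 (d0 N).
  have -> : N.+1%:R * d N = t - s by rewrite -(grN N) /gr addrC addKr.
  rewrite -/E => key.
  have c0 : 0 <= k0 * expR (- r * s) * h 0 by rewrite !mulr_ge0// expR_ge0.
  have := ler_wpM2l c0 key; rewrite mulr_sumr /V HE.
  have -> : k0 * expR (- r * s) * h 0 *
      (expR (- r * d N) * (lam * p0 / (r + lam * p0)) * (1 - E)) =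
    k0 * expR (- r * s) * (lam * p0 / (r + lam * p0) * h 0) * (expR (- r * d N) * (1 - E)) by ring.
  move=> /le_trans; apply; rewrite le_eqVlt; apply/orP; left; apply/eqP.
  apply: eq_bigr => k _.
  have -> : - r * gr N k.+1 = - r * s + - r * (k.+1%:R * d N) by rewrite /gr; ring.
  by rewrite expRD; ring.
have lowZ N : (((1 - k0) * h 0 + V * (expR (- r * d N) * (1 - E) + E))%:E <= Z)%E.
  by apply: le_trans (TZ N); rewrite lee_fin.
clear TZ; move: Z lowZ => [z| |] lowZ; [|by rewrite leey|by have := lowZ 0%N].
rewrite lee_fin; have cv : (1 - k0) * h 0 + V * (expR (- r * d N) * (1 - E) + E)
    @[N --> \oo] --> (1 - k0) * h 0 + V * (expR (- r * 0) * (1 - E) + E).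
  apply: cvgD; first exact: cvg_cst.
  apply: cvgMr; apply: cvgD; last exact: cvg_cst.
  apply: cvgMl; apply: continuous_cvg; first exact: continuous_expR.
  apply: cvgMr; rewrite -(mulr0 (t - s)); apply: cvgMr; exact: cvg_harmonic.
have : (1 - k0) * h 0 + V * (expR (- r * 0) * (1 - E) + E) <= z.
  by apply: (cvgr_to_le cv); apply: nearW => N; exact: lowZ.
by rewrite mulr0 expR0 mul1r subrK mulr1.
Qed.

End player1_bound.

(** * Player 2 never stops, or stops before the clock has started *)

Section player1_remaining.
Context (R : realType) (r : R) (P : probability (Omega R) R) (f h : 'I_2 -> R).
Hypotheses (r_gt0 : 0 < r) (f0 : forall i, 0 <= f i) (h0 : forall i, 0 <= h i).

Let PT : (P setT < +oo)%E. Proof. by rewrite ltey_eq fin_num_measure. Qed.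

Lemma stop_payoff_le_infty (w : cadlag_path R) (m : \bar R) (T : R) :
  stop_payoff r f h w m T%:E <= stop_payoff r f h w m +oo%E + expR (- r * T) * (f 0 + f 1).
Proof.
have B0 : 0 <= expR (- r * T) * (f 0 + f 1) by rewrite mulr_ge0 ?expR_ge0// addr_ge0.
have [Tm|mT] := ltP T%:E m; last first.
  have ym : (+oo < m)%E = false by rewrite ltNge leey.
  by rewrite {1}/stop_payoff ltNge mT/= /stop_payoff ym lerDl.
rewrite {1}/stop_payoff Tm /= -[leLHS]add0r lerD ?stop_payoff_ge0//.
rewrite ler_wpM2l ?expR_ge0//.
by case: (ord2P (X T w)) => ->; rewrite ?lerDl ?lerDr.
Qed.

(** Replacing a late deterministic stop [T] by [+oo] lowers the payoff by at most
    [expR (- r * T) * (f 0 + f 1)], which vanishes as [T] grows. *)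
Lemma guarantee_infty (mu : Omega R -> R -> \bar R) (s V : R) :
  mixed_stopping_time mu ->
  (forall t, s <= t -> (V%:E <= \int[P]_w \int[lebesgue_measure]_(u in `[0%R, 1%R])
    (stop_payoff r f h w (mu w u) t%:E)%:E)%E) ->
  (V%:E <= \int[P]_w \int[lebesgue_measure]_(u in `[0%R, 1%R])
    (stop_payoff r f h w (mu w u) +oo%E)%:E)%E.
Proof.
move=> mixm VP; have [mu' mm mE] := mixed_extension mixm.
have muw w : measurable_fun setT (mu' w).
  have mp : measurable_fun setT (fun u : R => ((w : Omega R), u)) by exact: measurable_fun_pair.
  exact: (measurableT_comp mm mp).
set Z := (\int[P]_w _)%E.
have bound (T : R) : s <= T -> (V%:E <= Z + (expR (- r * T) * (f 0 + f 1))%:E)%E.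
  set B := expR _ * _; have B0 : 0 <= B by rewrite mulr_ge0 ?expR_ge0// addr_ge0.
  move=> sT; apply: (le_trans (VP T sT)).
  have mpay n w : measurable_fun setT (fun u => (stop_payoff r f h w (mu' w u) n)%:E).
    apply/measurable_EFinP.
    exact: (measurable_stop_payoff r f h (w := fun=> w) (n := fun=> n)).
  have inner w : (\int[lebesgue_measure]_(u in `[0%R, 1%R])
      (stop_payoff r f h w (mu w u) T%:E)%:E <=
    \int[lebesgue_measure]_(u in `[0%R, 1%R])
      (stop_payoff r f h w (mu w u) +oo)%:E + B%:E)%E.
    have E n : (\int[lebesgue_measure]_(u in `[0%R, 1%R]) (stop_payoff r f h w (mu w u) n)%:E =
        \int[lebesgue_measure]_(u in `[0%R, 1%R]) (stop_payoff r f h w (mu' w u) n)%:E)%E.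
      by apply: eq_integral => u; rewrite inE/= in_itv/= => u01; rewrite mE.
    rewrite !E.
    have -> : B%:E = (\int[lebesgue_measure]_(u in `[0%R, 1%R]) (cst B%:E u))%E.
      by rewrite integral_cst// [X in (_ * X)%E]lebesgue_measure01 mule1.
    rewrite -ge0_integralD//.
    - apply: ge0_le_integral => //.
      + by move=> u _; rewrite lee_fin stop_payoff_ge0.
      + exact: (measurable_funS measurableT _ (mpay _ _)).
      + apply: emeasurable_funD => //; exact: (measurable_funS measurableT _ (mpay _ _)).
      + by move=> u _; rewrite -EFinD lee_fin stop_payoff_le_infty.
    - by move=> u _; rewrite lee_fin stop_payoff_ge0.
    - exact: (measurable_funS measurableT _ (mpay _ _)).
  have -> : B%:E = (\int[P]_w (cst B%:E w))%E.
    by rewrite integral_cst// [X in (_ * X)%E]probability_setT mule1.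
  rewrite /Z -ge0_integralD//.
  - apply: ge0_le_integral => //.
    + by move=> w _; apply: integral_ge0 => u _; rewrite lee_fin stop_payoff_ge0.
    + exact: measurable_payoff_u.
    + by apply: emeasurable_funD => //; exact: measurable_payoff_u.
  - by move=> w _; apply: integral_ge0 => u _; rewrite lee_fin stop_payoff_ge0.
  - exact: measurable_payoff_u.
clear VP; move: Z bound => [z| |] bound; [|by rewrite leey|by have := bound s (lexx s)].
rewrite lee_fin.
have cv : z + expR (- r * (s + n%:R)) * (f 0 + f 1) @[n --> \oo] --> z + 0 * (f 0 + f 1).
  apply: cvgD; first exact: cvg_cst.
  apply: cvgMl.
  have -> : (fun n : nat => expR (- r * (s + n%:R))) = (fun n => expR (- r * s) * expR (- r) ^+ n).
    apply/funext => n; rewrite mulrDr expRD; congr (_ * _).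
    by rewrite mulrC -expRM_natl.
  rewrite -(mulr0 (expR (- r * s))); apply: cvgMr; apply: cvg_expr.
  by rewrite ger0_norm ?expR_ge0// -[ltRHS]expR0 ltr_expR oppr_lt0.
rewrite mul0r addr0 in cv.
apply: (cvgr_to_ge cv); apply: nearW => n.
by rewrite -lee_fin EFinD; apply: bound; rewrite lerDl.
Qed.

Lemma Rintegral_X (F : 'I_2 -> R) (t : R) : 0 <= t ->
  \int[P]_w (F (X t w)) = lin F (fine (P [set w | X t w = 0])).
Proof.
move=> t0; have m0 := @measurable_X R t 0 t0.
transitivity (\int[P]_w (F 1 + (F 0 - F 1) * \1_[set w : Omega R | X t w = 0] w)).
  by apply: eq_Rintegral => w _; rewrite indicX -ffun2E.
have bi := @bmfun_indic _ _ R setT _ m0.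
rewrite (bmfun_RintegralD measurableT PT); [|exact: bmfun_cst|exact: bmfunZ].
rewrite (bmfun_RintegralZ measurableT PT _ bi) (Rintegral_indic P measurableT m0) setIT.
by rewrite Rintegral_cst// [X in _ * fine X]probability_setT /lin/=; ring.
Qed.

Lemma early_payoff (mu : Omega R -> R -> \bar R) (s t : R) : 0 <= t -> t < s ->
  (forall w u, 0 <= u <= 1 -> (s%:E <= mu w u)%E) ->
  (\int[P]_w \int[lebesgue_measure]_(u in `[0%R, 1%R])
    (stop_payoff r f h w (mu w u) t%:E)%:E =
   (expR (- r * t) * lin f (fine (P [set w | X t w = 0%R])))%:E)%E.
Proof.
move=> t0 ts smu; rewrite -Rintegral_X//.
have bf : bmfun [set: Omega R] (fun w => f (X t w)) by exact: bmfun_X.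
rewrite -(bmfun_RintegralZ measurableT PT)// -(bmfun_integralE measurableT PT); last exact: bmfunZ.
apply: eq_integral => w _.
transitivity (\int[lebesgue_measure]_(u in `[0%R, 1%R])
    cst (expR (- r * t) * f (X t w))%:E u)%E; last first.
  by rewrite integral_cst// [X in (_ * X)%E]lebesgue_measure01 mule1.
apply: eq_integral => u; rewrite inE/= in_itv/= => u01.
by rewrite /stop_payoff (lt_le_trans _ (smu w u u01))// lte_fin.
Qed.

End player1_remaining.

(** * The stopping problem faced by player 1 *)

Section markov_expectation.
Context (R : realType) (a b p : R) (P : probability (Omega R) R).
Hypotheses (ha : 0 < a) (hb : 0 < b).
Hypothesis Plaw : is_chain_law (generator a b) p P.

Let PT : (P setT < +oo)%E. Proof. by rewrite ltey_eq fin_num_measure. Qed.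

Definition semigroup (F : 'I_2 -> R) (t : R) (i : 'I_2) : R :=
  tr a b t i 0 * F 0 + tr a b t i 1 * F 1.

Let prob_at (A : set (Omega R)) (t : R) i : R := fine (P (A `&` [set w | X t w = i])).

Let integral_indic_X (A : set (Omega R)) (F : 'I_2 -> R) (t : R) :
  0 <= t -> measurable A ->
  \int[P]_w (\1_A w * F (X t w)) = F 0 * prob_at A t 0 + F 1 * prob_at A t 1.
Proof.
move=> t0 mA; have mi i := @measurable_X R t i t0.
have mAi i : measurable (A `&` [set w | X t w = i]) by apply: measurableI.
transitivity (\int[P]_w (F 0 * \1_(A `&` [set w : Omega R | X t w = 0]) w +
   F 1 * \1_(A `&` [set w : Omega R | X t w = 1]) w)).
  apply: eq_Rintegral => w _; rewrite !(indicI _ A)/= !indicX.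
  by case: (ord2P (X t w)) => -> /=; ring.
have bi i := @bmfun_indic _ _ R setT _ (mAi i).
rewrite (bmfun_RintegralD measurableT PT); [|exact: bmfunZ (bi _)..].
rewrite (bmfun_RintegralZ measurableT PT _ (bi 0)) (bmfun_RintegralZ measurableT PT _ (bi 1)).
by rewrite !(Rintegral_indic P measurableT)// !setIT.
Qed.

Lemma markov_expectation (A : set (Omega R)) (F : 'I_2 -> R) (s t : R) :
  0 <= s -> s <= t -> filtX s A ->
  \int[P]_w (\1_A w * F (X t w)) = \int[P]_w (\1_A w * semigroup F (t - s) (X s w)).
Proof.
move=> s0 st sA; have t0 := le_trans s0 st.
have mA : measurable A := filtX_measurable sA.
rewrite !integral_indic_X//.
have mAs i : measurable (A `&` [set w | X s w = i]) by apply: measurableI => //; exact: measurable_X.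
have mt j := @measurable_X R t j t0.
have E j : prob_at A t j = prob_at A s 0 * tr a b (t - s) 0 j + prob_at A s 1 * tr a b (t - s) 1 j.
  rewrite /prob_at.
  have -> : A `&` [set w | X t w = j] =
      (A `&` [set w | X s w = 0] `&` [set w | X t w = j]) `|`
      (A `&` [set w | X s w = 1] `&` [set w | X t w = j]).
    apply/seteqP; split => [w [Aw wj]|w [[[Aw _] wj]|[[Aw _] wj]]]; [|by split..].
    by have [?|?] := ord2P (X s w); [left|right].
  rewrite measureU; [|exact: measurableI..|]; last first.
    by apply/seteqP; split => // w [[[_ /= ->]] _ [[]]].
  have M i : P (A `&` [set w | X s w = i] `&` [set w | X t w = j]) =
    (P (A `&` [set w | X s w = i]) * (tr a b (t - s) i j)%:E)%E by exact: (chain_markov ha hb Plaw).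
  rewrite [X in fine (X + _)](M 0) [X in fine (_ + X)](M 1) fineD; last 2 first.
  - by rewrite fin_numM// fin_num_measure.
  - by rewrite fin_numM// fin_num_measure.
  by rewrite !fineM// fin_num_measure.
by rewrite !E /semigroup; ring.
Qed.

Lemma semigroupE (F : 'I_2 -> R) (t : R) i : semigroup F t i =
  F i + (1 - expR (- (a + b) * t)) / (a + b) *
    (if i == 0 then a * (F 1 - F 0) else b * (F 0 - F 1)).
Proof.
by rewrite /semigroup /tr !mxE; case: (ord2P i) => -> /=; ring.
Qed.

End markov_expectation.

Lemma is_derive_expR_scale (R : realType) (k : R) :
  is_derive (0 : R) (1 : R) (fun x => expR (k * x)) k.
Proof.
have e0 : is_derive (0 : R) (1 : R) (fun x : R => k * x) k.
  by apply: is_derive_eq; rewrite /GRing.scale/= mulr1.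
have e1 : is_derive (k * 0) (1 : R) expR 1.
  by apply: is_derive_eq; rewrite mulr0 expR0.
have := @is_derive1_comp _ expR (fun x : R => k * x) 0 _ _ e1 e0.
by rewrite mul1r.
Qed.

(* The drift is the first-order term in the mesh; being strictly negative, it
   absorbs the error term. *)
Lemma one_step_supermartingale (R : realType) (a b r eta : R) (f W : 'I_2 -> R) i :
  0 < a + b ->
  - (r + eta) * W i + (if i == 0 then a * (W 1 - W 0) else b * (W 0 - W 1)) + eta * f i < 0 ->
  \forall n \near \oo, let d : R := n.+1%:R^-1 in
  expR (- r * d) * ((1 - expR (- eta * d)) * semigroup a b f d i +
    expR (- eta * d) * semigroup a b W d i) <= W i.
Proof.
move=> s0; set qW := (if _ then _ else _) => drift.
pose qf := if i == 0 then a * (f 1 - f 0) else b * (f 0 - f 1).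
pose A (x : R) := expR (- r * x); pose B (x : R) := expR (- eta * x).
pose C (x : R) := expR (- (a + b) * x).
have dA : is_derive (0 : R) (1 : R) A (- r) := is_derive_expR_scale _.
have dB : is_derive (0 : R) (1 : R) B (- eta) := is_derive_expR_scale _.
have dC : is_derive (0 : R) (1 : R) C (- (a + b)) := is_derive_expR_scale _.
have [A0 B0 C0] : [/\ A 0 = 1, B 0 = 1 & C 0 = 1] by rewrite /A /B /C !mulr0 expR0.
(* The excess of the one-step expectation over [W i] for mesh [x]: it vanishes at 0, and its
   derivative there is the drift. *)
pose psi (x : R) := A x * ((1 - B x) * (f i + (1 - C x) * (qf / (a + b))) +
  B x * (W i + (1 - C x) * (qW / (a + b)))) - W i.
have dpsi : is_derive (0 : R) (1 : R) psi (- (r + eta) * W i + qW + eta * f i).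
  rewrite /psi; apply: is_derive_eq.
  rewrite /GRing.scale/= A0 B0 C0.
  by field; rewrite gt_eqF.
have psi0 : psi 0 = 0 by rewrite /psi A0 B0 C0; ring.
have := cvg_scaled_derive (ler01 : 0 <= 1) dpsi psi0.
rewrite mul1r => /(cvgr_lt _)/(_ _ drift).
apply: filterS => n; rewrite div1r pmulr_rlt0// => /ltW.
rewrite /psi subr_le0 /A /B /C /= !semigroupE => h; apply: le_trans h.
rewrite le_eqVlt; apply/orP; left; apply/eqP.
congr (_ * (_ * (_ + _) + _ * (_ + _))); rewrite -/qf -/qW; ring.
Qed.

(** Here [q ^+ j - q ^+ j.+1] is the probability that player 2 stops in cell [j]. In the application
    [al k] is the expected discounted [W] on paths not stopped by player 1 before grid time [k];
    [om k] is the same one step later, before those stopped in the cell are taken out, so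
    [om k - al k.+1] is what they collect. *)
Lemma discrete_supermartingale (R : realType) (phi om al : R^nat) (q : R) N :
  0 <= q -> (forall k, (1 - q) * phi k + q * om k <= al k) ->
  (forall k, al k.+1 <= om k) -> (forall k, 0 <= al k) ->
  \sum_(j < N) (phi j + \sum_(k < j) (om k - al k.+1)) * (q ^+ j - q ^+ j.+1) <= al 0%N.
Proof.
move=> q0 drift al_om al0; pose G n := \sum_(k < n) (om k - al k.+1).
(* The invariant keeps the event that player 2 is still in play: player 1 has then collected [G N]
   or holds the prospect [al N]. *)
suff H : \sum_(j < N) (phi j + G j) * (q ^+ j - q ^+ j.+1) + q ^+ N * (G N + al N) <= al 0%N.
  apply: le_trans H; rewrite lerDl mulr_ge0 ?exprn_ge0// addr_ge0//.
  by apply: sumr_ge0 => k _; rewrite subr_ge0.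
elim: N => [|N ih]; first by rewrite big_ord0 add0r expr0 mul1r /G big_ord0 add0r.
apply: le_trans ih; rewrite big_ord_recr/= -addrA lerD2l.
have -> : G N.+1 = G N + (om N - al N.+1) by rewrite /G big_ord_recr.
rewrite exprSr -subr_ge0.
have -> : q ^+ N * (G N + al N) - ((phi N + G N) * (q ^+ N - q ^+ N * q) +
    q ^+ N * q * (G N + (om N - al N.+1) + al N.+1)) =
  q ^+ N * (al N - ((1 - q) * phi N + q * om N)) by ring.
by rewrite mulr_ge0 ?exprn_ge0// subr_ge0.
Qed.

(** A stop strictly before [t] is a stop by some [t - m.+1%:R^-1]. This makes [alive k] known at the
    grid time [k], without right continuity of the filtration. *)
Lemma stopping_time_ge (R : realType) (tau : cadlag_path R -> \bar R) (t : R) :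
  stopping_time tau -> 0 <= t -> filtX t [set w | (t%:E <= tau w)%E].
Proof.
move=> [tau0 st] t0; have F0 : filtX t set0 by exact: sigma_algebra0.
rewrite (_ : [set _ | _] = ~` \bigcup_m [set w | (tau w <= (t - m.+1%:R^-1)%:E)%E]).
  apply: (@measurableC _ (g_sigma_algebraType _)).
  apply: (@bigcupT_measurable _ (g_sigma_algebraType _)) => m.
  suff : filtX t [set w | (tau w <= (t - m.+1%:R^-1)%:E)%E] by [].
  have [u0|u0] := leP 0 (t - m.+1%:R^-1).
    by apply: (filtX_le _ (st _ u0)); rewrite gerBl.
  suff -> : [set w | (tau w <= (t - m.+1%:R^-1)%:E)%E] = set0 by exact: F0.
  by apply/seteqP; split => // w /=; rewrite leNgt (lt_le_trans _ (tau0 w))// lte_fin.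
apply/seteqP; split => w /=.
  move=> tw [m _] /= wm; have := le_trans tw wm.
  by rewrite lee_fin leNgt ltrBlDr ltrDl invr_gt0 ltr0n.
move=> nw; rewrite leNgt; apply/negP => wt; apply: nw.
have := tau0 w; case tE : (tau w) wt => [z| |] //; rewrite lte_fin => zt _.
have tz : 0 < t - z by rewrite subr_gt0.
exists (Num.truncn (t - z)^-1) => //=; rewrite tE lee_fin lerBrDl -lerBrDr.
have /truncn_itv/andP[_ h] : 0 <= (t - z)^-1 by rewrite invr_ge0 ltW.
by rewrite -[leRHS]invrK lef_pV2 ?posrE ?invr_gt0 ?ltr0n// ltW.
Qed.

Section grid_payoff.
Context (R : realType) (r d : R) (f W : 'I_2 -> R) (tau : Omega R -> \bar R).
Hypothesis d_gt0 : 0 < d.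

Definition alive k (w : Omega R) : R := \1_[set w : Omega R | ((k%:R * d)%:E <= tau w)%E] w.

Definition stopped_gain k w : R :=
  (alive k w - alive k.+1 w) * (expR (- r * (k.+1%:R * d)) * W (X (k.+1%:R * d) w)).

(** The amount credited to player 1 when player 2 stops in cell [j]: [f] if player 1 is in play at
    the start of the cell, otherwise [W] at the grid point after [tau]. Paying [f] when both stop in
    one cell is harmless in the limit, since [h <= f]. *)
Definition grid_gain j w : R :=
  alive j w * (expR (- r * (j.+1%:R * d)) * f (X (j.+1%:R * d) w)) +
  \sum_(k < j) stopped_gain k w.

Lemma aliveE k w : alive k w = ((k%:R * d)%:E <= tau w)%E%:R.
Proof.
by rewrite /alive indicE; congr (nat_of_bool _)%:R; apply/idP/idP; rewrite inE.
Qed.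

Lemma alive_le1 k w : 0 <= alive k w <= 1.
Proof. by rewrite aliveE ler0n lern1 leq_b1. Qed.

Lemma alive_nd k w : alive k.+1 w <= alive k w.
Proof.
rewrite !aliveE ler_nat; case: (boolP (_ <= tau w)%E) => // kw.
rewrite (le_trans _ kw)// lee_fin ler_pM2r// ler_nat//.
Qed.

Lemma grid_gain_before j w : ((j%:R * d)%:E <= tau w)%E ->
  grid_gain j w = expR (- r * (j.+1%:R * d)) * f (X (j.+1%:R * d) w).
Proof.
move=> jw; rewrite /grid_gain aliveE jw mul1r big1 ?addr0// => k _.
have kd i : (i <= j)%N -> ((i%:R * d)%:E <= tau w)%E.
  by move=> ij; apply: le_trans jw; rewrite lee_fin ler_pM2r// ler_nat.
by rewrite /stopped_gain !aliveE !kd ?subrr ?mul0r// ltnW.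
Qed.

Lemma grid_gain_after j w z : 0 <= z -> tau w = z%:E -> z < j%:R * d ->
  grid_gain j w = expR (- r * next_grid d z) * W (X (next_grid d z) w).
Proof.
move=> z0 tE zj; have aE k : alive k w = (k%:R * d <= z)%R%:R by rewrite aliveE tE lee_fin.
rewrite /grid_gain aE leNgt zj/= mul0r add0r /next_grid.
have /truncn_itv : 0 <= z / d by rewrite divr_ge0// ltW.
set k0 := Num.truncn _; rewrite ler_pdivlMr// ltr_pdivrMr// => /andP[k1 k2].
have k0j : (k0 < j)%N by rewrite -(ltr_nat R) -(ltr_pM2r d_gt0) (le_lt_trans k1).
rewrite (bigD1 (Ordinal k0j))//= [X in _ + X]big1 ?addr0.
  by rewrite /stopped_gain !aE k1 leNgt k2 subr0 mul1r.
move=> k kk0; rewrite /stopped_gain !aE.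
have [lk|lk|ek] := ltngtP k k0.
- have h i : (i <= k0)%N -> (i%:R * d <= z)%R.
    by move=> ik; rewrite (le_trans _ k1)// ler_pM2r// ler_nat.
  by rewrite !h ?subrr ?mul0r// ltnW.
- have h i : (k0 < i)%N -> (i%:R * d <= z)%R = false.
    move=> ik; apply/negbTE; rewrite -ltNge (lt_le_trans k2)// ler_pM2r// ler_nat//.
  by rewrite !h ?subrr ?mul0r// ltnS ltnW.
- by exfalso; move/eqP: kk0; apply; apply: val_inj.
Qed.

End grid_payoff.

Lemma threshold_le (R : realType) (lam u y : R) : 0 < lam -> u <= 1 ->
  (threshold lam u <= y%:E)%E = (u <= 1 - expR (- lam * y)).
Proof.
move=> lam0; rewrite le_eqVlt => /predU1P[->|u1].
  by rewrite threshold1// leye_eq/=; apply/esym/negbTE; rewrite -ltNge ltrBlDr ltrDl expR_gt0.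
rewrite thresholdE// lee_fin ler_pdivrMr// lerNl -[LHS]ler_expR.
rewrite lnK ?posrE ?subr_gt0// mulNr (mulrC lam).
by apply/idP/idP => h; lra.
Qed.

(** For uniform [v] this is the exponential time of rate [lam]. *)
Lemma random_time_threshold (R : realType) (lam : R) : 0 < lam ->
  random_time (threshold lam).
Proof.
move=> lam0; split.
  apply: measurable_fun_ereal_le => y.
  rewrite (_ : _ `&` _ = `[0, 1]%classic `&` `]-oo, (1 - expR (- lam * y))]%classic).
    by apply: measurableI; exact: measurable_itv.
  apply/seteqP; split => u [u01 /=];
    have /andP[_ u1] : 0 <= u <= 1 by have := u01; rewrite /= in_itv.
    by rewrite threshold_le// => h; split => //=; rewrite in_itv.
  by rewrite in_itv/= => h; split => //=; rewrite threshold_le.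
move=> u /andP[u0]; rewrite le_eqVlt => /predU1P[->|u1]; first by rewrite threshold1.
by rewrite thresholdE// lee_fin divr_ge0 ?(ltW lam0)// oppr_ge0 ln_le0// lerBlDr lerDl.
Qed.

Lemma measurable_limn_einf d (T : measurableType d) (R : realType) (D : set T)
    (u : nat -> T -> \bar R) : (forall n, measurable_fun D (u n)) ->
  measurable_fun D (fun x => limn_einf (u ^~ x)).
Proof.
move=> mu; rewrite /limn_einf; apply: measurableT_comp => //.
apply: measurable_fun_limn_esup => n; exact: measurableT_comp.
Qed.

Lemma limn_einf_le (R : realType) (u : (\bar R)^nat) (c : \bar R) :
  (\forall n \near \oo, (u n <= c)%E) -> (limn_einf u <= c)%E.
Proof.
move=> [N _ uN]; rewrite limn_einf_lim; apply: lime_le; first exact: is_cvg_einfs.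
apply: nearW => n; apply: (le_trans _ (uN (maxn N n) _)); last exact: leq_maxl.
by apply: ereal_inf_lbound; exists (maxn N n) => //=; exact: leq_maxr.
Qed.

Lemma semigroupZ (R : realType) (a b k t : R) (F : 'I_2 -> R) i :
  semigroup a b (fun i => k * F i) t i = k * semigroup a b F t i.
Proof. by rewrite /semigroup; ring. Qed.

(** * Stopping problem against an exponential time of player 2 *)

Section player2_bound.
Context (R : realType) (a b r eta p : R) (P : probability (Omega R) R)
  (f h W : 'I_2 -> R) (tau : Omega R -> \bar R).
Hypotheses (ha : 0 < a) (hb : 0 < b) (r_gt0 : 0 < r) (eta_gt0 : 0 < eta).
Hypothesis Plaw : is_chain_law (generator a b) p P.
Hypotheses (h0 : forall i, 0 <= h i) (hf : forall i, h i <= f i) (hW : forall i, h i <= W i).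
Hypothesis drift : forall i, - (r + eta) * W i +
  (if i == 0 then a * (W 1 - W 0) else b * (W 0 - W 1)) + eta * f i < 0.
Hypotheses (st : stopping_time tau) (mt : measurable_fun setT tau).

Let PT : (P setT < +oo)%E. Proof. by rewrite ltey_eq fin_num_measure. Qed.
Let f0 i : 0 <= f i. Proof. exact: le_trans (h0 i) (hf i). Qed.
Let W0 i : 0 <= W i. Proof. exact: le_trans (h0 i) (hW i). Qed.

Let dd (n : nat) : R := n.+1%:R^-1.
Let dd_gt0 n : 0 < dd n. Proof. by rewrite invr_gt0. Qed.
Let dd_cvg : dd @ \oo --> 0. Proof. exact: cvg_harmonic. Qed.

Let one_step n := forall i, expR (- r * dd n) * ((1 - expR (- eta * dd n)) *
    semigroup a b f (dd n) i + expR (- eta * dd n) * semigroup a b W (dd n) i) <= W i.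

Let one_step_near : \forall n \near \oo, one_step n.
Proof.
have s0 : 0 < a + b by rewrite addr_gt0.
have h0' := @one_step_supermartingale R a b r eta f W 0 s0 (drift 0).
have h1' := @one_step_supermartingale R a b r eta f W 1 s0 (drift 1).
near=> n; move=> i; case: (ord2P i) => ->; [near: n; exact: h0'|near: n; exact: h1'].
Unshelve. all: by end_near. Qed.

Let gain n := grid_gain r (dd n) f W tau.

Let kd_ge0 n k : 0 <= k%:R * dd n. Proof. by rewrite mulr_ge0// ltW. Qed.

Let alive_filtX n k : filtX (k%:R * dd n) [set w | ((k%:R * dd n)%:E <= tau w)%E].
Proof. exact: stopping_time_ge. Qed.

Let balive n k : bmfun [set: Omega R] (alive (dd n) tau k).
Proof.
apply: bmfun_indic; apply: filtX_measurable; exact: alive_filtX.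
Qed.

Let bterm n k (F : 'I_2 -> R) c t : 0 <= t ->
  bmfun [set: Omega R] (fun w => alive (dd n) tau k w * (c * F (X t w))).
Proof.
by move=> t0; apply: bmfunM => //; apply: bmfunZ; exact: bmfun_X.
Qed.

Let stoppedE n k w : stopped_gain r (dd n) W tau k w =
  alive (dd n) tau k w * (expR (- r * (k.+1%:R * dd n)) * W (X (k.+1%:R * dd n) w)) +
  -1 * (alive (dd n) tau k.+1 w * (expR (- r * (k.+1%:R * dd n)) * W (X (k.+1%:R * dd n) w))).
Proof. by rewrite /stopped_gain; ring. Qed.

Let bstopped n k : bmfun [set: Omega R] (stopped_gain r (dd n) W tau k).
Proof.
rewrite (funext (stoppedE n k)).
by apply: bmfunD; [|apply: bmfunZ]; exact: bterm.
Qed.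

Let bgain n j : bmfun [set: Omega R] (gain n j).
Proof.
apply: bmfunD; first exact: bterm.
by apply: (@bmfun_sum _ _ _ _ j (stopped_gain r (dd n) W tau)).
Qed.

Let q n := expR (- eta * dd n).

(** Optional stopping on the grid: [alive k] is known at grid time [k], so the Markov property
    replaces the next value by the semigroup, and [one_step] is the drift inequality of
    [discrete_supermartingale]. *)
Let gain_expectation n N : one_step n ->
  \sum_(j < N) (\int[P]_w gain n j w) * (q n ^+ j - q n ^+ j.+1) <= \int[P]_w W (X 0 w).
Proof.
move=> onestep.
pose e k := expR (- r * (k%:R * dd n)).
have eS k : e k.+1 = e k * expR (- r * dd n).
  by rewrite /e -expRD -natr1; congr expR; ring.
pose phi k := \int[P]_w (alive (dd n) tau k w * (e k.+1 * f (X (k.+1%:R * dd n) w))).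
pose om k := \int[P]_w (alive (dd n) tau k w * (e k.+1 * W (X (k.+1%:R * dd n) w))).
pose al k := \int[P]_w (alive (dd n) tau k w * (e k * W (X (k%:R * dd n) w))).
have intgain j : \int[P]_w gain n j w = phi j + \sum_(k < j) (om k - al k.+1).
  rewrite /gain /grid_gain (bmfun_RintegralD measurableT PT); last first.
    - by apply: (@bmfun_sum _ _ _ _ j (stopped_gain r (dd n) W tau)).
    - exact: bterm.
  rewrite (bmfun_Rintegral_sum measurableT PT (F := stopped_gain r (dd n) W tau))//.
  congr (_ + _); apply: eq_bigr => k _.
  rewrite (funext (stoppedE n k)) (bmfun_RintegralD measurableT PT); last first.
    - by apply: bmfunZ; exact: bterm.
    - exact: bterm.
  by rewrite (bmfun_RintegralZ measurableT PT) ?mulN1r//; exact: bterm.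
have MK k (F : 'I_2 -> R) c : \int[P]_w (alive (dd n) tau k w * (c * F (X (k.+1%:R * dd n) w))) =
    \int[P]_w (alive (dd n) tau k w * (c * semigroup a b F (dd n) (X (k%:R * dd n) w))).
  have kk : k%:R * dd n <= k.+1%:R * dd n by rewrite ler_pM2r// ler_nat.
  rewrite (markov_expectation ha hb Plaw (fun i => c * F i) (kd_ge0 n k) kk (@alive_filtX n k)).
  have -> : k.+1%:R * dd n - k%:R * dd n = dd n by rewrite -natr1; ring.
  by apply: eq_Rintegral => w _; rewrite semigroupZ.
under eq_bigr do rewrite intgain.
have -> : \int[P]_w W (X 0 w) = al 0%N.
  apply: eq_Rintegral => w _; rewrite aliveE mul0r /e mul0r mulr0 expR0 mul1r.
  by have [-> _] := st; rewrite mul1r.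
apply: discrete_supermartingale.
- exact: expR_ge0.
- move=> k; rewrite /phi /om !MK.
  rewrite -(bmfun_RintegralZ measurableT PT (1 - q n)); last exact: bterm.
  rewrite -(bmfun_RintegralZ measurableT PT (q n)); last exact: bterm.
  rewrite -(bmfun_RintegralD measurableT PT); [|by apply: bmfunZ; exact: bterm..].
  apply: bmfun_Rintegral_le => //; [|exact: bterm|].
    by apply: bmfunD; apply: bmfunZ; exact: bterm.
  move=> w _; set x := X _ w; rewrite eS.
  have /andP[a0 _] := alive_le1 (dd n) tau k w.
  have e0 : 0 <= e k by exact: expR_ge0.
  have := ler_wpM2l (mulr_ge0 a0 e0) (onestep x); rewrite -/(q n).
  have key (A E g q' s1 s2 : R) : (1 - q') * (A * (E * g * s1)) + q' * (A * (E * g * s2)) =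
    A * E * (g * ((1 - q') * s1 + q' * s2)) by ring.
  by move=> H; rewrite key [leRHS]mulrA.
- move=> k; apply: bmfun_Rintegral_le => //; try exact: bterm.
  move=> w _; apply: ler_wpM2r; first by rewrite mulr_ge0 ?expR_ge0.
  exact: alive_nd.
- move=> k; apply: Rintegral_ge0 => w _; have /andP[a0 _] := alive_le1 (dd n) tau k w.
  by rewrite !mulr_ge0 ?expR_ge0.
Qed.

(** With mesh [1 / n.+1] these cells cover a horizon [n.+1], which tends to infinity. *)
Let N (n : nat) : nat := (n.+1 * n.+1)%N.

(** The breakpoints put [v] in cell [j] exactly when the exponential time [threshold eta v] lies in
    the grid cell [j]. *)
Let stepf n w v := step true (fun j => 1 - q n ^+ j) (fun j => gain n j w) (N n) v.

Let q_nd n : nondecreasing_seq (fun j => 1 - q n ^+ j).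
Proof.
apply/nondecreasing_seqP => j; rewrite lerD2l lerN2 exprS ger_pMl ?exprn_gt0 ?expR_gt0//.
by rewrite /q -[leRHS]expR0 ler_expR mulNr oppr_le0 mulr_ge0// ltW.
Qed.

Let cvg_next_grid_payoff (F : 'I_2 -> R) (x : R) w : 0 <= x ->
  expR (- r * next_grid (dd n) x) * F (X (next_grid (dd n) x) w) @[n --> \oo] -->
  expR (- r * x) * F (X x w).
Proof.
move=> x0; apply: cvgM.
  apply: continuous_cvg; first exact: continuous_expR.
  by apply: cvgMr; exact: cvg_next_grid.
apply: cvg_near_cst; apply: filterS (X_next_grid w dd_gt0 dd_cvg x0) => n -> //.
Qed.

(** Right continuity gives the limit at the grid points that follow the two times. If player 1 stops
    strictly first, the limit has [W] in place of [h]; otherwise it has [f], which dominates [h] in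
    a tie. *)
Let path_limit w v : 0 <= v -> v < 1 -> exists L : R,
  stop_payoff r f h w (tau w) (threshold eta v) <= L /\ stepf n w v @[n --> \oo] --> L.
Proof.
move=> v0 v1; set y := - ln (1 - v) / eta.
have y0 : 0 <= y by rewrite divr_ge0 ?(ltW eta_gt0)// oppr_ge0 ln_le0// lerBlDr lerDl.
have vE : 1 - v = expR (- eta * y).
  by rewrite /y !mulNr mulrN opprK [eta * _]mulrC divfK ?gt_eqF// lnK// posrE subr_gt0.
pose J n := Num.truncn (y / dd n).
have JP n : (J n)%:R * dd n <= y < (J n).+1%:R * dd n.
  have /truncn_itv : 0 <= y / dd n by rewrite divr_ge0// ltW.
  by rewrite ler_pdivlMr// ltr_pdivrMr.
have stepE : \forall n \near \oo, stepf n w v = gain n (J n) w.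
  exists (Num.truncn y).+1 => // n /= yn; apply: (step_cell _ (@q_nd n)).
    have /andP[J1 _] := JP n; have /truncn_itv/andP[_ y2] := y0.
    rewrite /N -(ltr_nat R) -(ltr_pM2r (dd_gt0 n)) natrM /dd mulfK ?pnatr_eq0//.
    by rewrite (le_lt_trans J1)// (lt_le_trans y2)// ler_nat ltnW.
  have qE j : q n ^+ j = expR (- eta * (j%:R * dd n)).
    by rewrite /q -expRM_natl; congr expR; ring.
  have /andP[J1 J2] := JP n.
  have e1 : expR (- eta * y) <= expR (- eta * ((J n)%:R * dd n)).
    by rewrite ler_expR !mulNr lerN2 ler_pM2l.
  have e2 : expR (- eta * ((J n).+1%:R * dd n)) < expR (- eta * y).
    by rewrite ltr_expR !mulNr ltrN2 ltr_pM2l.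
  apply/cellP; rewrite !qE; move: e1 e2; rewrite -vE.
  set E1 := expR _; set E2 := expR _ => e1 e2; split; rewrite /=; lra.
rewrite thresholdE// -/y.
have Jgrid n : (J n).+1%:R * dd n = next_grid (dd n) y by [].
have [ytau|tauy] := leP y%:E (tau w).
  exists (expR (- r * y) * f (X y w)); split.
    rewrite /stop_payoff; move: ytau; rewrite le_eqVlt => /predU1P[ytau|->//].
    by rewrite -ytau ltxx ltry/= ler_wpM2l ?expR_ge0.
  apply: cvg_trans (@cvg_next_grid_payoff f y w y0); apply: near_eq_cvg.
  apply: filterS stepE => n ->; rewrite /gain grid_gain_before//.
  by apply: le_trans ytau; rewrite lee_fin; have /andP[] := JP n.
have := st.1 w; case tE : (tau w) tauy => [z| |] //; rewrite lte_fin lee_fin => zy z0.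
exists (expR (- r * z) * W (X z w)); split.
  rewrite /stop_payoff lte_fin ltNge (ltW zy)/= ltry.
  by rewrite ler_wpM2l ?expR_ge0.
apply: cvg_trans (@cvg_next_grid_payoff W z w z0); apply: near_eq_cvg.
have yz : 0 < y - z by rewrite subr_gt0.
(* Once the mesh is below [y - z], the stop at [z] falls in an earlier cell than [y]. *)
have dsmall : \forall n \near \oo, dd n < y - z by exact: (cvgr_lt _ dd_cvg).
near=> n.
have -> : stepf n w v = gain n (J n) w by near: n.
rewrite /gain (grid_gain_after r f W (dd_gt0 n) z0 tE)//.
have /andP[_ J2] := JP n; have dn : dd n < y - z by near: n.
by move: J2; rewrite -natr1 mulrDl mul1r; lra.
Unshelve. all: by end_near. Qed.

Let I01 : set R := `[0, 1]%classic.
Let I01o : set R := `[0, 1[%classic.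
Let mI01 : measurable I01. Proof. exact: measurable_itv. Qed.
Let mI01o : measurable I01o. Proof. exact: measurable_itv. Qed.

Let stepf_ge0 n w v : 0 <= stepf n w v.
Proof.
case: (stepP true (fun j => gain n j w) (@q_nd n) (N n) v) => [[j [_ _]]|[_]] ; rewrite /stepf => -> //.
have a01 k := alive_le1 (dd n) tau k w.
rewrite /gain /grid_gain addr_ge0//.
  by have /andP[a0 _] := a01 j; rewrite !mulr_ge0 ?expR_ge0.
apply: sumr_ge0 => k _; rewrite /stopped_gain mulr_ge0 ?mulr_ge0 ?expR_ge0//.
by rewrite subr_ge0 alive_nd.
Qed.

Let II n w : R := \sum_(j < N n) gain n j w * (q n ^+ j - q n ^+ j.+1).

Let int_stepf n w :
  (\int[lebesgue_measure]_(v in I01o) (stepf n w v)%:E = (II n w)%:E)%E.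
Proof.
rewrite (@bmfun_integralE _ _ _ lebesgue_measure); last 3 first.
- exact: measurable_itv.
- exact: itv_lebesgue_fin.
- exact: bmfun_step.
congr EFin; rewrite /stepf (Rintegral_step _ (@q_nd n) (measurable_itv _) (itv_lebesgue_fin _ _ _ _)).
  by apply: eq_bigr => j _; congr (_ * _); ring.
move=> k _ v /cellP[/= v1 v2]; rewrite /I01o/= in_itv/=; apply/andP; split.
  apply: le_trans v1; rewrite subr_ge0 exprn_ile1 ?expR_ge0//.
  by rewrite /q -[leRHS]expR0 ler_expR mulNr oppr_le0 mulr_ge0// ltW.
by apply: (lt_le_trans v2); rewrite gerBl exprn_ge0// expR_ge0.
Qed.

Let bII n : bmfun [set: Omega R] (II n).
Proof.
apply: (@bmfun_sum _ _ _ _ (N n) (fun j w => gain n j w * (q n ^+ j - q n ^+ j.+1))) => j _.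
by apply: bmfunM; [exact: bgain|exact: bmfun_cst].
Qed.

(** Fatou's lemma is applied in [v] for each path and then over paths; nonnegativity of the grid
    gains is enough for both. *)
Lemma player2_payoff_le :
  (\int[P]_w \int[lebesgue_measure]_(v in `[0%R, 1%R])
    (stop_payoff r f h w (tau w) (threshold eta v))%:E <= (\int[P]_w W (X 0 w))%R%:E)%E.
Proof.
have [nu mn nuE] := random_extension (random_time_threshold eta_gt0).
have mpay : measurable_fun setT (fun wv : Omega R * R =>
    (stop_payoff r f h wv.1 (tau wv.1) (nu wv.2))%:E).
  apply/measurable_EFinP; apply: measurable_stop_payoff => //.
    exact: (measurableT_comp mt measurable_fst).
  exact: (measurableT_comp mn measurable_snd).
have mpayw w : measurable_fun setT (fun v => (stop_payoff r f h w (tau w) (nu v))%:E).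
  have mp : measurable_fun setT (fun v : R => ((w : Omega R), v)) by exact: measurable_fun_pair.
  exact: (measurableT_comp mpay mp).
have inner w : (\int[lebesgue_measure]_(v in I01) (stop_payoff r f h w (tau w) (nu v))%:E <=
    limn_einf (fun n => (II n w)%:E))%E.
  (* The point [v = 1], where the threshold is infinite, is dropped before [path_limit] is used. *)
  rewrite -integral_itv_bndo_bndc; last exact: (measurable_funS measurableT _ (mpayw w)).
  have mstep n : measurable_fun I01o (fun v => (stepf n w v)%:E).
    by apply/measurable_EFinP; have [] := @bmfun_step R true (fun j => 1 - q n ^+ j) (fun j => gain n j w) I01o (N n).
  apply: (@le_trans _ _ (\int[lebesgue_measure]_(v in I01o) limn_einf (fun n => (stepf n w v)%:E))%E).
    apply: ge0_le_integral => //.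
    - by move=> v _; rewrite lee_fin stop_payoff_ge0.
    - exact: (measurable_funS measurableT _ (mpayw w)).
    - exact: measurable_limn_einf.
    - move=> v; rewrite /= in_itv/= => /andP[v0 v1].
      have v01 : 0 <= v <= 1 by rewrite v0 ltW.
      rewrite (nuE _ v01); have [L [pL cL]] := path_limit w v0 v1.
      have [eL _] : (limn_einf (fun n => (stepf n w v)%:E) = L%:E) *
          (limn_esup (fun n => (stepf n w v)%:E) = L%:E).
        by apply: cvg_limn_einf_sup; apply: cvg_EFin => //; exact: nearW.
      apply: (@le_trans _ _ L%:E); first by rewrite lee_fin.
      by rewrite -eL.
  have -> : (fun n => (II n w)%:E) =
      (fun n => \int[lebesgue_measure]_(v in I01o) (stepf n w v)%:E)%E.
    by apply/funext => n; rewrite int_stepf.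
  by apply: fatou => // n v _; rewrite lee_fin.
have -> : (\int[P]_w \int[lebesgue_measure]_(v in `[0%R, 1%R])
    (stop_payoff r f h w (tau w) (threshold eta v))%:E =
    \int[P]_w \int[lebesgue_measure]_(v in I01) (stop_payoff r f h w (tau w) (nu v))%:E)%E.
  apply: eq_integral => w _; apply: eq_integral => v.
  by rewrite inE/= in_itv/= => v01; rewrite nuE.
apply: (@le_trans _ _ (\int[P]_w limn_einf (fun n => (II n w)%:E))%E).
  apply: ge0_le_integral => //.
  - by move=> w _; apply: integral_ge0 => v _; rewrite lee_fin stop_payoff_ge0.
  - apply: (@measurable_integral_dom _ _ _ _ _ lebesgue_measure setT I01 (fun wv : Omega R * R =>
      (stop_payoff r f h wv.1 (tau wv.1) (nu wv.2))%:E)) => //.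
      exact: (measurable_funS measurableT _ mpay).
    by move=> x; rewrite lee_fin stop_payoff_ge0.
  - by apply: measurable_limn_einf => n; apply/measurable_EFinP; have [] := bII n.
apply: (@le_trans _ _ (limn_einf (fun n => \int[P]_w (II n w)%:E))%E).
  apply: fatou => //.
  - by move=> n; apply/measurable_EFinP; have [] := bII n.
  - move=> n w _; rewrite -int_stepf; apply: integral_ge0 => v _.
    by rewrite lee_fin.
apply: limn_einf_le; apply: filterS one_step_near => n onestep.
rewrite (bmfun_integralE measurableT PT (bII n)) lee_fin.
apply: le_trans (gain_expectation (N n) onestep); rewrite le_eqVlt; apply/orP; left; apply/eqP.
rewrite /II (bmfun_Rintegral_sum measurableT PT
  (F := fun j w => gain n j w * (q n ^+ j - q n ^+ j.+1))); last first.
  by move=> j _; apply: bmfunM; [exact: bgain|exact: bmfun_cst].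
apply: eq_bigr => j _; rewrite mulrC -(bmfun_RintegralZ measurableT PT _ (bgain n j)).
by apply: eq_Rintegral => w _; rewrite mulrC.
Qed.

End player2_bound.

(** * The threshold belief and the values *)

Section threshold_prior.
Context (R : realType) (a b r : R) (f h : 'I_2 -> R).
Hypotheses (ha : 0 < a) (hb : 0 < b) (hr : 0 < r).
Hypotheses (f1_gt0 : 0 < f 1) (f1_lt : f 1 < f 0).
Hypothesis hbr : f 1 < b / (b + r) * h 0.

Let quad (x : R) : R :=
  (h 0 - lin f x) * (b - (a + b) * x) - r * lin f x * (1 - x).

Let s_gt0 : 0 < a + b. Proof. by rewrite addr_gt0. Qed.

Let prior_lt1 x : x < b / (a + b) -> x < 1.
Proof.
move=> /lt_le_trans; apply.
by rewrite ler_pdivrMr// mul1r lerDr ltW.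
Qed.

Lemma is_p0P x : is_p0 a b r f h x <-> 0 < x < b / (a + b) /\
  (h 0 - lin f x) * (b - (a + b) * x) = r * lin f x * (1 - x).
Proof.
have lh : lin h 1 = h 0 by rewrite /lin; ring.
rewrite /is_p0 lh; split => -[/andP[x0 xb] E]; split; rewrite ?x0//.
  have x1 := prior_lt1 xb; have d1 : 1 - x != 0 by rewrite subr_eq0 gt_eqF.
  have d2 : (a + b) * x - b != 0.
    by rewrite lt_eqF// subr_lt0 mulrC -ltr_pdivlMr.
  move/eqP: E; rewrite eqr_div// => /eqP E.
  apply/eqP; rewrite -subr_eq0; apply/eqP.
  have -> : (h 0 - lin f x) * (b - (a + b) * x) - r * lin f x * (1 - x) =
    - ((h 0 - lin f x) * ((a + b) * x - b) - - r * lin f x * (1 - x)) by ring.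
  by rewrite E subrr oppr0.
have x1 := prior_lt1 xb; have d1 : 1 - x != 0 by rewrite subr_eq0 gt_eqF.
have d2 : (a + b) * x - b != 0.
  by rewrite lt_eqF// subr_lt0 mulrC -ltr_pdivlMr.
apply/eqP; rewrite eqr_div//; apply/eqP.
have -> : (h 0 - lin f x) * ((a + b) * x - b) =
  - ((h 0 - lin f x) * (b - (a + b) * x)) by ring.
by rewrite E; ring.
Qed.

Let quad_end_lt0 : quad (b / (a + b)) < 0.
Proof.
have bs0 : 0 < b / (a + b) by rewrite divr_gt0.
have bs1 : 0 < 1 - b / (a + b).
  by rewrite subr_gt0 ltr_pdivrMr// mul1r ltrDr.
rewrite /quad [(a + b) * _]mulrC divfK ?gt_eqF// subrr mulr0 sub0r oppr_lt0.
rewrite mulr_gt0// mulr_gt0// /lin addr_gt0// mulr_gt0//.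
exact: lt_trans f1_lt.
Qed.

(** [quad] is a quadratic with positive leading coefficient, positive at 0 by [hbr] and negative at
    [b / (a + b)], so it has a root in between. Two distinct roots there would factor it and make it
    positive at [b / (a + b)]. *)
Lemma exists_unique_p0 : exists! x : R, is_p0 a b r f h x.
Proof.
pose D := f 0 - f 1; pose A := D * (a + b) + r * D.
pose B := - (h 0 - f 1) * (a + b) - D * b - r * (D - f 1).
pose C := (h 0 - f 1) * b - r * f 1.
have D0 : 0 < D by rewrite subr_gt0.
have A0 : 0 < A by rewrite addr_gt0// mulr_gt0.
have quadE x : quad x = A * x ^+ 2 + B * x + C.
  by rewrite /quad /A /B /C /D /lin; ring.
have bs0 : 0 < b / (a + b) by rewrite divr_gt0.
have C0 : 0 < C.
  have br0 : 0 < b + r by rewrite addr_gt0.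
  have hbr' : f 1 * (b + r) < b * h 0 by rewrite -ltr_pdivlMr// mulrAC.
  by rewrite /C; lra.
(* The sign is changed because [poly_ivt] expects a nonpositive value first. *)
pose P : {poly R} := - (A *: 'X^2 + B *: 'X + C%:P).
have PE x : P.[x] = - quad x by rewrite quadE /P !hornerE.
have [x] : exists2 x, 0 <= x <= b / (a + b) & root P x.
  apply: poly_ivt; first exact: ltW.
  rewrite !PE oppr_le0 oppr_ge0 (ltW quad_end_lt0) andbT quadE.
  by rewrite expr0n/= !mulr0 !add0r ltW.
rewrite /root PE oppr_eq0 => /andP[x0 xb] /eqP qx.
have {}x0 : 0 < x.
  rewrite lt_neqAle x0 andbT; apply/eqP => x0'; move: qx; rewrite -x0' quadE.
  by rewrite expr0n/= !mulr0 !add0r => C00; rewrite C00 ltxx in C0.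
have {}xb : x < b / (a + b).
  rewrite lt_neqAle xb andbT; apply/eqP => xb'; move: qx; rewrite xb' => q0.
  by have := quad_end_lt0; rewrite q0 ltxx.
exists x; split.
  by apply/is_p0P; rewrite x0 xb; split => //; apply/eqP; rewrite -subr_eq0; apply/eqP.
move=> y /is_p0P[/andP[y0 yb] qy'].
have qy : quad y = 0 by rewrite /quad qy' subrr.
apply/eqP; apply/negPn; apply/negP => xy.
have xy0 : x - y != 0 by rewrite subr_eq0.
have Bxy : A * (x + y) + B = 0.
  apply: (mulfI xy0); rewrite mulr0.
  have -> : (x - y) * (A * (x + y) + B) = quad x - quad y by rewrite !quadE; ring.
  by rewrite qx qy subrr.
have q : quad (b / (a + b)) = A * ((b / (a + b) - x) * (b / (a + b) - y)).
  rewrite -[LHS]subr0 -qy !quadE.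
  have -> : B = - (A * (x + y)) by apply/eqP; rewrite -addr_eq0 addrC; apply/eqP.
  by ring.
have := quad_end_lt0; rewrite q ltNge ltW// mulr_gt0// mulr_gt0// subr_gt0//.
Qed.

End threshold_prior.

Lemma chain_marginal (R : realType) (a b p t : R) (P : probability (Omega R) R) :
  0 < a -> 0 < b -> is_chain_law (generator a b) p P -> 0 <= t ->
  fine (P [set w | X t w = 0]) =
  p + (1 - expR (- (a + b) * t)) / (a + b) * (b - (a + b) * p).
Proof.
move=> ha hb Plaw t0.
pose F (i : 'I_2) : R := (i == 0)%:R.
have F0 q : lin F q = q by rewrite /lin /F/=; ring.
have tT : filtX 0 [set: Omega R] by exact: (@measurableT _ (g_sigma_algebraType _)).
have := markov_expectation ha hb Plaw F (lexx 0) t0 tT.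
under eq_Rintegral do rewrite indicT mul1r.
under [in X in _ = X -> _]eq_Rintegral do rewrite indicT mul1r.
rewrite (Rintegral_X P F t0) (Rintegral_X P _ (lexx 0)) F0 => ->.
rewrite (chain_init Plaw)/= /lin subr0 !semigroupE /F/=.
by field; rewrite gt_eqF// addr_gt0.
Qed.

(* [x - p >= (b - (a+b) x) t] for [x] the law at time [t], so that
   [F p <= F x - r F x t <= e^(-r t) F x]. *)
Lemma discounted_stopping_increases (R : realType) (a b r p t : R) (f : 'I_2 -> R) :
  0 < a -> 0 < b -> 0 < r -> 0 <= t -> 
  let x := p + (1 - expR (- (a + b) * t)) / (a + b) * (b - (a + b) * p) in
  0 <= b - (a + b) * x -> f 1 <= f 0 -> 0 <= lin f x ->
  r * lin f x <= (f 0 - f 1) * (b - (a + b) * x) ->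
  lin f p <= expR (- r * t) * lin f x.
Proof.
move=> ha hb hr t0 x xb ff Fx drift; have s0 : 0 < a + b by rewrite addr_gt0.
pose e := expR (- (a + b) * t); have e0 : 0 < e by exact: expR_gt0.
have xE : b - (a + b) * x = e * (b - (a + b) * p).
  by rewrite /x -/e; field; rewrite gt_eqF.
have xp : (b - (a + b) * x) * t <= x - p.
  have -> : x - p = (b - (a + b) * x) * ((e^-1 - 1) / (a + b)).
    by rewrite xE /x -/e; field; rewrite !gt_eqF.
  apply: ler_wpM2l => //; rewrite ler_pdivlMr// lerBrDl /e -expRN mulNr opprK mulrC.
  by rewrite [(a + b) * _]mulrC expR_ge1Dx.
have FE : lin f p = lin f x - (f 0 - f 1) * (x - p) by rewrite /lin; ring.
have h1 : (f 0 - f 1) * ((b - (a + b) * x) * t) <= (f 0 - f 1) * (x - p).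
  by apply: ler_wpM2l; rewrite ?subr_ge0.
have h2 : r * lin f x * t <= (f 0 - f 1) * (b - (a + b) * x) * t by apply: ler_wpM2r.
have h3 : (1 - r * t) * lin f x <= expR (- r * t) * lin f x.
  by apply: ler_wpM2r => //; have := expR_ge1Dx (- r * t); rewrite mulNr.
move: h3; rewrite FE; move: h1 h2; clear; set F := lin f x; set E := expR _.
move=> h1 h2 h3; lra.
Qed.

Lemma player2_stop_now (R : realType) (r : R) (P : probability (Omega R) R)
    (f h : 'I_2 -> R) (p : R) :
  (forall i, 0 <= h i) -> (forall i, h i <= f i) ->
  fine (P [set w | X 0 w = 0]) = p ->
  forall mu, mixed_stopping_time mu ->
    (Gamma r f h P mu (fun=> 0%E) <= (lin f p)%:E)%E.
Proof.
move=> h0 hf Pp; have f0 i : 0 <= f i := le_trans (h0 i) (hf i).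
have PT : (P setT < +oo)%E by rewrite ltey_eq fin_num_measure.
have bf : bmfun [set: Omega R] (fun w => f (X 0 w)) by exact: bmfun_X.
have intf : \int[P]_w f (X 0 w) = lin f p by rewrite (Rintegral_X P f (lexx 0)) Pp.
apply: player2_guarantee => //.
  by rewrite lee_fin -intf; apply: Rintegral_ge0 => w _.
move=> tau [tau0 _] mtau; rewrite -intf -(bmfun_integralE measurableT PT bf).
have mpay : measurable_fun setT (fun w : Omega R =>
    (stop_payoff r f h w (tau w) 0%E)%:E).
  by apply/measurable_EFinP; exact: measurable_stop_payoff.
have -> : (\int[P]_w \int[lebesgue_measure]_(v in `[0%R, 1%R])
    (stop_payoff r f h w (tau w) 0%E)%:E = \int[P]_w (stop_payoff r f h w (tau w) 0%E)%:E)%E.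
  apply: eq_integral => w _.
  transitivity (\int[lebesgue_measure]_(v in `[0%R, 1%R]) cst (stop_payoff r f h w (tau w) 0%E)%:E v)%E => //.
  by rewrite integral_cst// [X in (_ * X)%E]lebesgue_measure01 mule1.
apply: ge0_le_integral => //.
- by move=> w _; rewrite lee_fin stop_payoff_ge0.
- by apply/measurable_EFinP; have [] := bf.
- move=> w _; rewrite lee_fin /stop_payoff.
  have := tau0 w; rewrite le_eqVlt => /predU1P[<-|->].
    by rewrite ltxx ltry mulr0 expR0 mul1r.
  by rewrite mulr0 expR0 mul1r.
Qed.

(** * Optimality in the three cases *)

Section optimality.
Context (R : realType) (a b r : R) (f h : 'I_2 -> R) (p0 : R).
Hypotheses (ha : 0 < a) (hb : 0 < b) (hr : 0 < r).
Hypotheses (h_gt0 : forall i, 0 < h i) (hf : forall i, h i < f i) (f1_lt : f 1 < f 0).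
Hypotheses (p0_gt0 : 0 < p0) (p0_lt : p0 < b / (a + b)).
Hypothesis p0E : (h 0 - lin f p0) * (b - (a + b) * p0) = r * lin f p0 * (1 - p0).

Let s_gt0 : 0 < a + b. Proof. by rewrite addr_gt0. Qed.
Let h0 i : 0 <= h i. Proof. exact: ltW. Qed.
Let hf' i : h i <= f i. Proof. exact: ltW. Qed.
Let f_gt0 i : 0 < f i. Proof. exact: lt_trans (h_gt0 i) (hf i). Qed.
Let f0 i : 0 <= f i. Proof. exact: ltW. Qed.

Let p0_lt1 : p0 < 1.
Proof.
apply: (lt_le_trans p0_lt); by rewrite ler_pdivrMr// mul1r lerDr ltW.
Qed.

Let drift_gt0 : 0 < b - (a + b) * p0.
Proof. by rewrite subr_gt0 mulrC -ltr_pdivlMr. Qed.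

Let lam := lambda1 a b p0.

Lemma lambda1_gt0 : 0 < lam.
Proof. by rewrite /lam /lambda1 divr_gt0// mulr_gt0// subr_gt0. Qed.

Let lamE : b - (a + b) * p0 = lam * (p0 * (1 - p0)).
Proof. by rewrite /lam /lambda1 divfK// gt_eqF// mulr_gt0// subr_gt0. Qed.

Let FE : (r + lam * p0) * lin f p0 = lam * p0 * h 0.
Proof.
have d : 1 - p0 != 0 by rewrite gt_eqF// subr_gt0.
apply: (mulIf d); apply/eqP; rewrite -subr_eq0; apply/eqP.
have -> : (r + lam * p0) * lin f p0 * (1 - p0) - lam * p0 * h 0 * (1 - p0) =
  r * lin f p0 * (1 - p0) - (h 0 - lin f p0) * (lam * (p0 * (1 - p0))) by ring.
by rewrite -lamE p0E subrr.
Qed.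

Let F_gt0 q : 0 <= q <= 1 -> 0 < lin f q.
Proof.
move=> /andP[q0 q1]; have -> : lin f q = f 1 + q * (f 0 - f 1) by rewrite /lin; ring.
by rewrite ltr_wpDr// mulr_ge0// subr_ge0 ltW.
Qed.

Section fixed_prior.
Variables (p : R) (P : probability (Omega R) R).
Hypotheses (p01 : 0 <= p <= 1) (Plaw : is_chain_law (generator a b) p P).

Let init0 i : fine (P [set w | X 0 w = i]) = two_point p i.
Proof. by rewrite (chain_init Plaw)/two_point; case: ifP. Qed.

Let random_time0 : random_time (fun=> 0%E : \bar R).
Proof. by split => //; exact: measurable_cst. Qed.

Lemma optimal_at_p0 : p = p0 -> optimal1 r f h P (mu_i lam).
Proof.
move=> pE; pose c (_ : 'I_2) : R := 0.
have c01 i : 0 <= c i <= 1 by rewrite lexx ler01.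
have congr w u : 0 <= u <= 1 -> mu_i lam w u = cut_strategy lam 0 c w u.
  by move=> /andP[u0 _]; rewrite /mu_i /cut_strategy /c ltNge u0/= !subr0 divr1.
apply: (optimal1_congr congr).
have mixc := mixed_cut_strategy lambda1_gt0 (lexx 0) c01.
apply: (optimal1_saddle (nu := fun=> 0%E) (V := (lin f p0)%:E)) => //.
- apply: player1_guarantee => //; first by rewrite lee_fin ltW// F_gt0// ltW//= ltW.
  have fin t : 0 <= t -> ((lin f p0)%:E <= \int[P]_w \int[lebesgue_measure]_(u in `[0%R, 1%R])
      (stop_payoff r f h w (cut_strategy lam 0 c w u) t%:E)%:E)%E.
    move=> t0; have := @cut_strategy_finite_guarantee R a b r p p0 lam 0 1 P f h c (fun=> 1)
      ha hb hr Plaw p0_gt0 p0_lt1 lambda1_gt0 lamE f0 h0 c01 erefl (lexx 0) ler01.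
    rewrite subrr mul0r add0r mulr0 expR0 !mul1r; apply => //.
    + by move=> w; rewrite subr0.
    + by move=> i; rewrite !mul1r init0 pE.
  move=> [t| |] // t0; [exact: fin|exact: (guarantee_infty hr f0 h0 mixc fin)].
- by apply: player2_stop_now => //; rewrite init0 /two_point/=.
Qed.

(** Player 1 waits until the law of the state has moved up to [p0]. A stop of player 2 during this
    phase pays the discounted [lin f] of the current law, which is at least [lin f p], the cost of
    stopping at once. *)
Lemma optimal_below_p0 : p < p0 -> optimal1 r f h P (mu_iii lam (tp P p0)).
Proof.
move=> pp0; have /andP[p_ge0 p_le1] := p01.
have marg t : 0 <= t -> fine (P [set w | X t w = 0]) =
    p + (1 - expR (- (a + b) * t)) / (a + b) * (b - (a + b) * p).
  by move=> t0; exact: chain_marginal Plaw t0.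
have bsp : 0 < b - (a + b) * p.
  by apply: (lt_trans drift_gt0); rewrite ltrD2l ltrN2 ltr_pM2l.
(* For [x] the law at time [t], [b - (a + b) * x] decays like [expR (- (a + b) * t)]; [ratio] is the
   factor by which it has shrunk on reaching [p0], whence [ts]. *)
pose ratio := (b - (a + b) * p0) / (b - (a + b) * p).
have ratio_gt0 : 0 < ratio by rewrite divr_gt0.
have ratio_lt1 : ratio < 1.
  by rewrite ltr_pdivrMr// mul1r ltrD2l ltrN2 ltr_pM2l.
pose ts := - ln ratio / (a + b).
have ts_ge0 : 0 <= ts by rewrite divr_ge0 ?(ltW s_gt0)// oppr_ge0 ln_le0// ltW.
have law_p0 t : 0 <= t -> (fine (P [set w | X t w = 0]) = p0) <-> t = ts.
  move=> t0; rewrite marg//; have sn0 : a + b != 0 by rewrite gt_eqF.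
  have key : p + (1 - expR (- (a + b) * t)) / (a + b) * (b - (a + b) * p) - p0 =
      (ratio - expR (- (a + b) * t)) * ((b - (a + b) * p) / (a + b)).
    by rewrite /ratio; field; rewrite sn0 gt_eqF.
  split=> [E|tE]; last first.
    apply/eqP; rewrite -subr_eq0 key tE.
    have -> : - (a + b) * ts = ln ratio by rewrite /ts; field.
    by rewrite lnK ?posrE// subrr mul0r.
  have : (ratio - expR (- (a + b) * t)) * ((b - (a + b) * p) / (a + b)) = 0.
    by rewrite -key E subrr.
  move/eqP; rewrite mulf_eq0 [X in _ || X]gt_eqF ?divr_gt0// orbF subr_eq0 => /eqP rE.
  by rewrite /ts rE expRK; field.
have tpE : tp P p0 = ts.
  rewrite /tp (_ : [set _ | _] = [set ts]) ?inf1//.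
  apply/seteqP; split => [t [t0 E]|_ ->] /=; first by apply/(law_p0 _ t0); rewrite E.
  split=> //; have /(law_p0 _ ts_ge0) <- := erefl ts.
  by rewrite fineK// fin_num_measure//; exact: measurable_X.
rewrite tpE; pose c (_ : 'I_2) : R := 0.
have c01 i : 0 <= c i <= 1 by rewrite lexx ler01.
have congr w u : 0 <= u <= 1 -> mu_iii lam ts w u = cut_strategy lam ts c w u.
  by move=> /andP[u0 _]; rewrite /mu_iii /cut_strategy /c ltNge u0/= !subr0 divr1.
apply: (optimal1_congr congr).
have mixc := mixed_cut_strategy lambda1_gt0 ts_ge0 c01.
have Fp0 := F_gt0 (q := p0); have Fp := F_gt0 p01.
have ts_law : fine (P [set w | X ts w = 0]) = p0 by apply/law_p0.
(* At [p0] this is the equation [p0E] with [h 0] replaced by the larger [f 0]. It extends to smaller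
   [x] because the left side increases in [x] and the right side decreases. *)
have drift_F x : x <= p0 -> r * lin f x <= (f 0 - f 1) * (b - (a + b) * x).
  move=> xp0; have D0 : 0 < f 0 - f 1 by rewrite subr_gt0.
  have at_p0 : r * lin f p0 <= (f 0 - f 1) * (b - (a + b) * p0).
    have d : 0 < 1 - p0 by rewrite subr_gt0.
    rewrite -(ler_pM2r d) -p0E mulrAC; apply: ler_wpM2r; first exact: ltW.
    have -> : (f 0 - f 1) * (1 - p0) = f 0 - lin f p0 by rewrite /lin; ring.
    by rewrite lerD2r ltW.
  have h1 : r * lin f x <= r * lin f p0.
    rewrite ler_pM2l//; have -> : lin f p0 = lin f x + (f 0 - f 1) * (p0 - x) by rewrite /lin; ring.
    by rewrite lerDl mulr_ge0 ?subr_ge0// ltW.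
  apply: (le_trans h1); apply: (le_trans at_p0); rewrite ler_pM2l//.
  by rewrite lerD2l lerN2 ler_pM2l.
have early t : 0 <= t -> t <= ts ->
    lin f p <= expR (- r * t) * lin f (fine (P [set w | X t w = 0])).
  move=> t0 tts; have xp0 : fine (P [set w | X t w = 0]) <= p0.
    rewrite -ts_law !marg// lerD2l; apply: ler_wpM2r; first exact: ltW.
    rewrite ler_pM2r ?invr_gt0// lerD2l lerN2 ler_expR !mulNr lerN2.
    by rewrite ler_pM2l.
  have x01 : 0 <= fine (P [set w | X t w = 0]) <= 1.
    by rewrite fine_ge0 ?measure_ge0//= (le_trans xp0)// ltW.
  have := drift_F _ xp0; have := F_gt0 x01; rewrite marg// => Fx dr.
  apply: discounted_stopping_increases => //; [|exact: ltW|exact: ltW].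
  rewrite -(marg _ t0) subr_ge0 -subr_ge0; apply: ltW; apply: (lt_le_trans drift_gt0).
  by rewrite lerD2l lerN2 ler_pM2l.
apply: (optimal1_saddle (nu := fun=> 0%E) (V := (lin f p)%:E)) => //; last first.
  by apply: player2_stop_now => //; rewrite init0 /two_point/=.
apply: player1_guarantee => //; first by rewrite lee_fin ltW.
have fin t : ts <= t -> ((lin f p)%:E <= \int[P]_w \int[lebesgue_measure]_(u in `[0%R, 1%R])
    (stop_payoff r f h w (cut_strategy lam ts c w u) t%:E)%:E)%E.
  move=> t0; apply: (@le_trans _ _ (expR (- r * ts) * lin f p0)%:E).
    by rewrite lee_fin -[in leRHS]ts_law early.
  have := @cut_strategy_finite_guarantee R a b r p p0 lam ts 1 P f h c (fun=> 1)
    ha hb hr Plaw p0_gt0 p0_lt1 lambda1_gt0 lamE f0 h0 c01 erefl ts_ge0 ler01.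
  rewrite subrr mul0r add0r mul1r; apply => //.
  + by move=> w; rewrite subr0.
  + move=> i; rewrite !mul1r /two_point; case: ifP => [/eqP->//|i0].
    have -> : i = 1 by case: (ord2P i) i0 => ->.
    have m k := @measurable_X R ts k ts_ge0.
    have := Rintegral_X P (fun i : 'I_2 => (i == 1)%:R : R) ts_ge0; rewrite ts_law.
    under eq_Rintegral do rewrite -indicX.
    by rewrite (Rintegral_indic P measurableT (m 1)) setIT => ->; rewrite /lin/=; ring.
move=> [t| |] // t0; last exact: (guarantee_infty hr f0 h0 mixc fin).
have [tst|tts] := leP ts t; first exact: fin.
rewrite (early_payoff r P f h t0 tts); last first.
  move=> w u /andP[u0 _]; rewrite /cut_strategy /c ltNge u0/=.
  exact: occupation_hitting_ge.
by rewrite lee_fin early// ltW.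
Qed.

(** The atom [k] in state 0 is the one after which the belief is [p0]:
    [p * (1 - k) * (1 - p0) = (1 - p) * p0]. *)
Lemma optimal_above_p0 : p0 < p -> optimal1 r f h P (mu_ii lam (c_ p p0)).
Proof.
move=> p0p; have /andP[p_ge0 p_le1] := p01; have p_gt0 : 0 < p := lt_trans p0_gt0 p0p.
have d1 : 0 < 1 - p0 by rewrite subr_gt0.
set k := c_ p p0; pose c (i : 'I_2) : R := if i == 0 then k else 0.
have k01 : 0 <= k <= 1.
  have pd : 0 < p * (1 - p0) by rewrite mulr_gt0.
  rewrite /k /c_ divr_ge0 ?subr_ge0 ?(ltW p0p) ?(ltW pd)//= ler_pdivrMr// mul1r.
  by rewrite mulrBr mulr1 lerD2l lerN2 ger_pMl.
have c01 i : 0 <= c i <= 1 by rewrite /c; case: ifP => // _; rewrite lexx ler01.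
have congr w u : 0 <= u <= 1 -> mu_ii lam k w u = cut_strategy lam 0 c w u.
  move=> /andP[u0 _]; rewrite /mu_ii /cut_strategy /c /utilde u0/=.
  case: (ord2P (X 0 w)) => -> /=; first by rewrite mulr1 mulr0 addr0.
  by rewrite ltNge u0/= mulr0 add0r mulr1 !subr0 divr1.
apply: (optimal1_congr congr).
have mixc := mixed_cut_strategy lambda1_gt0 (lexx 0) c01.
(* The probability [1 - p * k] of surviving the atom: the survivors in state 1 have mass [1 - p], a
   fraction [1 - p0] of all survivors. *)
pose k0 := (1 - p) / (1 - p0).
have k0_ge0 : 0 <= k0 by rewrite divr_ge0 ?subr_ge0// ltW.
have k0_le1 : k0 <= 1 by rewrite ler_pdivrMr// mul1r lerD2l lerN2 ltW.
pose V := (1 - k0) * h 0 + k0 * lin f p0.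
have Fp0 : 0 < lin f p0 by rewrite F_gt0// !ltW.
have V_ge0 : 0 <= V by rewrite addr_ge0// mulr_ge0 ?subr_ge0// ltW.
(* Player 2 stops at an exponential time whose rate makes player 1, when in
   state 0, indifferent between stopping and waiting; [w1] is the value in
   state 1. *)
pose x := p0 / (1 - p0); pose D := f 0 - h 0; pose w1 := f 1 + x * D.
have D_gt0 : 0 < D by rewrite subr_gt0.
have x_gt0 : 0 < x by rewrite divr_gt0.
have p0x : p0 = x / (1 + x) by rewrite /x; field; rewrite gt_eqF//= addrNK oner_eq0.
(* [p0E] divided by [(1 - p0) ^+ 2], in terms of the odds [x]; with the choice of [eta] it says that
   [W] has zero drift in state 1. *)
have balance : (b - a * x) * (h 0 - w1) = r * (f 1 + x * f 0).
  have n1 : 1 - p0 != 0 by rewrite gt_eqF.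
  have e1 : b - (a + b) * p0 = (1 - p0) * (b - a * x) by rewrite /x; field.
  have e2 : h 0 - lin f p0 = (1 - p0) * (h 0 - w1) by rewrite /w1 /x /D /lin; field.
  have e3 : lin f p0 = (1 - p0) * (f 1 + x * f 0) by rewrite /x /lin; field.
  have n2 : (1 - p0) * (1 - p0) != 0 by rewrite mulf_neq0.
  apply: (mulfI n2).
  have -> : (1 - p0) * (1 - p0) * ((b - a * x) * (h 0 - w1)) =
    ((1 - p0) * (h 0 - w1)) * ((1 - p0) * (b - a * x)) by ring.
  by rewrite -e1 -e2 p0E e3; ring.
have bax : 0 < b - a * x.
  rewrite -(pmulr_rgt0 _ d1); have -> // : (1 - p0) * (b - a * x) = b - (a + b) * p0.
  by rewrite /x; field; rewrite gt_eqF.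
have hw1 : 0 < h 0 - w1.
  by rewrite -(pmulr_rgt0 _ bax) balance mulr_gt0// addr_gt0// mulr_gt0.
(* Solves [- (r + eta) * h 0 + a * (w1 - h 0) + eta * f 0 = 0], the zero-drift equation in state
   0. *)
pose eta := (r * h 0 + a * (h 0 - w1)) / D.
have eta_gt0 : 0 < eta by rewrite divr_gt0// addr_gt0// mulr_gt0.
have etaD : eta * D = r * h 0 + a * (h 0 - w1) by rewrite /eta divfK// gt_eqF.
pose W (i : 'I_2) : R := if i == 0 then h 0 else w1.
have hW i : h i <= W i.
  case: (ord2P i) => -> //; rewrite /W/= (le_trans (hf' 1))//.
  by rewrite lerDl mulr_ge0// ltW.
(* [w1] is where the line through [(p0, lin f p0)] and [(1, h 0)] meets [p = 0]. *)
have WV : lin W p = V.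
  by rewrite /V /k0 /lin /W/= /w1 /x /D; field; rewrite gt_eqF.
apply: (optimal1_saddle (nu := threshold eta) (V := V%:E)) => //.
- exact: random_time_threshold.
- apply: player1_guarantee => //.
  have fin t : 0 <= t -> (V%:E <= \int[P]_w \int[lebesgue_measure]_(u in `[0%R, 1%R])
      (stop_payoff r f h w (cut_strategy lam 0 c w u) t%:E)%:E)%E.
    move=> t0; have := @cut_strategy_finite_guarantee R a b r p p0 lam 0 k0 P f h c
      (fun i => 1 - c i) ha hb hr Plaw p0_gt0 p0_lt1 lambda1_gt0 lamE f0 h0 c01 erefl
      (lexx 0) k0_ge0.
    rewrite mulr0 expR0 mulr1; apply => // i.
    rewrite init0 /two_point /c; case: ifP => _; last by rewrite subr0 mul1r /k0 divfK// gt_eqF.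
    by rewrite /k /c_ /k0; field; rewrite !gt_eqF.
  move=> [t| |] // t0; [exact: fin|exact: (guarantee_infty hr f0 h0 mixc fin)].
- apply: player2_guarantee => //; first exact: random_time_threshold.
  move=> tau st mtau; apply/lee_addgt0Pr => eps eps0.
  (* [W] has zero drift, but strict negativity is required; adding the constant [eps] lowers the
     drift by [(r + eta) * eps]. *)
  pose We i := W i + eps.
  have hWe i : h i <= We i by rewrite (le_trans (hW i))// lerDl ltW.
  have drift i : - (r + eta) * We i +
      (if i == 0 then a * (We 1 - We 0) else b * (We 0 - We 1)) + eta * f i < 0.
    have re : 0 < (r + eta) * eps by rewrite mulr_gt0// addr_gt0.
    have -> : - (r + eta) * We i +
      (if i == 0 then a * (We 1 - We 0) else b * (We 0 - We 1)) + eta * f i =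
      - ((r + eta) * eps); last by rewrite oppr_lt0.
    rewrite /We /W; case: (ord2P i) => -> /=.
      have -> : - (r + eta) * (h 0 + eps) + a * (w1 + eps - (h 0 + eps)) + eta * f 0 =
        eta * D - (r * h 0 + a * (h 0 - w1)) - (r + eta) * eps by rewrite /D; ring.
      by rewrite etaD subrr sub0r.
    have -> : - (r + eta) * (w1 + eps) + b * (h 0 + eps - (w1 + eps)) + eta * f 1 =
      (b - a * x) * (h 0 - w1) - r * w1 - x * (eta * D - a * (h 0 - w1)) - (r + eta) * eps.
      by rewrite /w1; ring.
    by rewrite balance etaD /w1 /D; ring.
  have := player2_payoff_le ha hb eta_gt0 Plaw h0 hf' hWe drift st mtau.
  by rewrite (Rintegral_X P We (lexx 0)) init0 /two_point/= -EFinD -WV /lin /We (_ : _ + _ = p * W 0 + (1 - p) * W 1 + eps)//; ring.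
Qed.

End fixed_prior.
End optimality.

Theorem proposition5p5 (R : realType) (a b r : R) (f h : 'I_2 -> R)
    (ha : 0 < a) (hb : 0 < b) (hr : 0 < r)
    (hhf : forall p : R, 0 <= p <= 1 -> 0 < lin h p < lin f p)
    (hh : lin h 0 < lin h 1) (hf : lin f 0 < lin f 1)
    (hbr : lin f 0 < b / (b + r) * lin h 1) :
  (exists! p0 : R, is_p0 a b r f h p0) /\
  (forall p0 : R, is_p0 a b r f h p0 ->
    0 < lambda1 a b p0 /\
    (forall (p : R) (P : probability (Omega R) R),
      0 <= p <= 1 -> is_chain_law (generator a b) p P ->
      [/\ p = p0 -> optimal1 r f h P (mu_i (lambda1 a b p0)),
          p0 < p -> optimal1 r f h P (mu_ii (lambda1 a b p0) (c_ p p0)) &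
          p < p0 -> optimal1 r f h P (mu_iii (lambda1 a b p0) (tp P p0))])).
Proof.
have lin0 (g : 'I_2 -> R) : lin g 0 = g 1 by rewrite /lin; ring.
have lin1 (g : 'I_2 -> R) : lin g 1 = g 0 by rewrite /lin; ring.
rewrite !lin0 !lin1 in hf hbr.
have hi i : 0 < h i < f i.
  case: (ord2P i) => ->; first by have := hhf 1; rewrite !lin1; apply; rewrite ler01 lexx.
  by have := hhf 0; rewrite !lin0; apply; rewrite ler01 lexx.
have h_gt0 i : 0 < h i by have /andP[] := hi i.
have hf_lt i : h i < f i by have /andP[] := hi i.
have f1_gt0 : 0 < f 1 := lt_trans (h_gt0 1) (hf_lt 1).
split; first exact: exists_unique_p0.
move=> p0 /(is_p0P _ _ _ ha hb)[/andP[p0_gt0 p0_lt] p0E].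
split; first exact: (lambda1_gt0 ha hb p0_gt0 p0_lt).
move=> p P p01 Plaw; split.
- exact: (optimal_at_p0 ha hb hr h_gt0 hf_lt hf p0_gt0 p0_lt p0E Plaw).
- exact: (optimal_above_p0 ha hb hr h_gt0 hf_lt hf p0_gt0 p0_lt p0E p01 Plaw).
- exact: (optimal_below_p0 ha hb hr h_gt0 hf_lt hf p0_gt0 p0_lt p0E p01 Plaw).
Qed.
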